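(* Let $\mathcal{L}$ be a pseudo-differential operator with symbol $\mathcal{M}(\xi)=P(\xi)^{-1}D(\xi)P(\xi)$ of the class described in the context (homogeneous of degree $2\alpha$, $\alpha>0$), let $u_0\in L^2(\mathbb{R}^n)^m$, and let $u(t)=e^{t\mathcal{L}}u_0$ be the solution of $u_t=\mathcal{L}u$ in $\mathbb{R}^n\times(0,\infty)$, $u|_{t=0}=u_0$. (1) If the decay character $r^*=r^*(u_0)$ exists and $r^*\in(-n/2,+\infty)$, then there exist $C_1,C_2>0$ such that for all $t>0$ $$C_1(1+t)^{-\frac1\alpha(r^*+n/2)}\le\|u(t)\|_{L^2}^2\le C_2(1+t)^{-\frac1\alpha(r^*+n/2)}.$$ (2) Conversely, if there are $r^*\in(-n/2,\infty)$ and $C_1,C_2>0$ such that $$C_1(1+t)^{-\frac1\alpha(r^*+n/2)}\le\|u(t)\|_{L^2}^2\le C_2(1+t)^{-\frac1\alpha(r^*+n/2)}\quad\text{for all }t>0,$$ then $u_0$ possesses a decay character and $r^*(u_0)=r^*$.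
   Context: Class of operators: for an integer $m\ge1$, the symbol is $\mathcal{M}(\xi)=P(\xi)^{-1}D(\xi)P(\xi)$ for a.e. $\xi\in\mathbb{R}^n$, where $P(\xi)$ is an orthogonal $m\times m$ matrix whose entries are homogeneous functions of $\xi$, smooth outside $\xi=0$, and $D(\xi)$ is the diagonal matrix $D(\xi)_{ij}=-c_i|\xi|^{2\alpha}\delta_{ij}$ with $c_i\ge c>0$ ($i=1,\dots,m$) and $\alpha>0$. The solution is given by $\widehat u(\xi,t)=e^{t\mathcal{M}(\xi)}\widehat u_0(\xi)$. Decay indicators: for $u_0\in L^2(\mathbb{R}^n)$ (scalar or vector-valued) and $r\in\mathbb{R}$, with $B_\rho=\{|\xi|\le\rho\}$, set $$P_r(u_0)_-=\liminf_{\rho\to0^+}\rho^{-2r-n}\int_{B_\rho}|\widehat u_0(\xi)|^2d\xi,\qquad P_r(u_0)_+=\limsup_{\rho\to0^+}\rho^{-2r-n}\int_{B_\rho}|\widehat u_0(\xi)|^2d\xi,$$ both in $[0,+\infty]$. Decay character: $u_0$ is said to have a decay character $r^*(u_0)\in(-n/2,\infty)$ if there is a number $r^*(u_0)\in(-n/2,\infty)$ with $$r^*(u_0)=\max\{r\in\mathbb{R}: P_r(u_0)_+<\infty\}=\min\{r\in\mathbb{R}: P_r(u_0)_->0\}$$ (both the maximum and the minimum being attained). *)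

(* Defs.v *)
From HB Require Import structures.
From mathcomp Require Import all_boot all_order all_algebra.
From mathcomp Require Import complex.
From mathcomp Require Import all_classical all_reals all_analysis.
Import Order.TTheory GRing.Theory Num.Theory.
Import numFieldNormedType.Exports.

Set Implicit Arguments.
Unset Strict Implicit.
Unset Printing Implicit Defensive.

Local Open Scope classical_set_scope.
Local Open Scope ring_scope.

Definition measure_rV_display : measure_display -> measure_display.
Proof. exact. Qed.

(* 'rV[R]_n carries the product sigma-algebra: the one generated by the
   coordinate projections, i.e. the Borel sigma-algebra of R^n. *)
Section measurable_rV.
Context {R : realType}.
Variable n : nat.

Definition rV_coord (i : 'I_n) (x : 'rV[R]_n) : measurableTypeR R := x ord0 i.

Let rV_set0 : g_sigma_preimage rV_coord set0.
Proof. exact: sigma_algebra0. Qed.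

Let rV_setC A : g_sigma_preimage rV_coord A -> g_sigma_preimage rV_coord (~` A).
Proof. exact: sigma_algebraC. Qed.

Let rV_bigcup (F : _^nat) : (forall i, g_sigma_preimage rV_coord (F i)) ->
  g_sigma_preimage rV_coord (\bigcup_i (F i)).
Proof. exact: sigma_algebra_bigcup. Qed.

HB.instance Definition _ :=
  @isMeasurable.Build (measure_rV_display default_measure_display)
    'rV[R]_n (g_sigma_preimage rV_coord) rV_set0 rV_setC rV_bigcup.

Lemma measurable_rV_coord (i : 'I_n) : measurable_fun setT (rV_coord i).
Proof.
move=> _ Y mY; rewrite setTI; apply: sub_sigma_algebra => /=.
rewrite -bigcup_seq/=; exists i => /=; first by rewrite mem_index_enum.
by exists Y => //; rewrite setTI.
Qed.

Lemma measurable_fun_rVP d (T : measurableType d) (f : T -> 'rV[R]_n) :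
  (forall i, measurable_fun setT (rV_coord i \o f)) -> measurable_fun setT f.
Proof.
move=> mf.
suff H : g_sigma_preimage (fun i => rV_coord i \o f) `<=` measurable.
  move: H; rewrite g_sigma_preimage_comp => prefS.
  by move=> _ A mA; apply: prefS; exists A.
apply: smallest_sub; first exact: sigma_algebra_measurable.
apply: (big_ind (fun s : set (set T) => s `<=` measurable)) => //.
- by move=> X Y HX HY A [/HX|/HY].
- by move=> i _ A [B mB <-]; exact: mf.
Qed.

End measurable_rV.

Section lebesgue_rV_succ.
Context {R : realType} (n : nat).
Variable mu : {sigma_finite_measure set 'rV[R]_n -> \bar R}.

Definition rV_cons (p : measurableTypeR R * 'rV[R]_n) : 'rV[R]_n.+1 :=
  row_mx (const_mx (p.1 : R) : 'rV[R]_1) p.2.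

Lemma measurable_rV_cons : measurable_fun setT rV_cons.
Proof.
apply: measurable_fun_rVP => i.
have [j|j] := split_ordP (i : 'I_(1 + n)).
- move=> ->; rewrite (_ : _ \o _ = fst); first exact: measurable_fst.
  apply/funext => -[x y]; rewrite /= /rV_coord /rV_cons /=.
  exact: etrans (row_mxEl _ _ _ _) (mxE _ _ _ _).
- move=> ->; rewrite (_ : _ \o _ = @rV_coord R n j \o snd).
    exact: measurableT_comp (measurable_rV_coord j) measurable_snd.
  apply/funext => -[x y]; rewrite /= /rV_coord /rV_cons /=.
  exact: row_mxEr.
Qed.

Definition lebesgue_rV_succ : set 'rV[R]_n.+1 -> \bar R :=
  pushforward (lebesgue_measure \x mu)%E rV_cons.

Let succ0 : lebesgue_rV_succ set0 = 0%E.
Proof. by rewrite /lebesgue_rV_succ/pushforward preimage_set0 measure0. Qed.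

Let succ_ge0 A : (0 <= lebesgue_rV_succ A)%E.
Proof. by rewrite /lebesgue_rV_succ /pushforward measure_ge0. Qed.

Let succ_sigma_additive : semi_sigma_additive lebesgue_rV_succ.
Proof.
have m A : measurable A -> measurable (rV_cons @^-1` A).
  by move=> mA; rewrite -[X in measurable X]setTI; exact: measurable_rV_cons.
move=> F mF tF mUF; rewrite /lebesgue_rV_succ/pushforward preimage_bigcup.
apply: measure_semi_sigma_additive.
- by move=> k; exact: m.
- apply/trivIsetP => /= i j _ _ ij; rewrite -preimage_setI.
  by move/trivIsetP : tF => /(_ _ _ _ _ ij) ->//; rewrite preimage_set0.
- by rewrite -preimage_bigcup; exact: m.
Qed.

HB.instance Definition _ := isMeasure.Build _ _ _
  lebesgue_rV_succ succ0 succ_ge0 succ_sigma_additive.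

Let succ_sigma_finite : sigma_finite setT lebesgue_rV_succ.
Proof.
pose leb : {sigma_finite_measure set (measurableTypeR R) -> \bar R} :=
  lebesgue_measure.
have [F UF mF] : sigma_finite setT (leb \x mu)%E.
  have /sigma_finiteP[F [TF ndF Foo]] := sigma_finiteT leb.
  have /sigma_finiteP[G [TG ndG Goo]] := sigma_finiteT mu.
  exists (fun k => F k `*` G k).
    rewrite -setXTT TF TG predeqE => -[x y]; split.
      move=> [/= [i _ Fix] [k _ Gky]]; exists (maxn i k) => //; split.
      - by move: x Fix; exact/subsetPset/ndF/leq_maxl.
      - by move: y Gky; exact/subsetPset/ndG/leq_maxr.
    by move=> [k _ []/= ? ?]; split; exists k.
  move=> k; have [? ?] := Foo k; have [? ?] := Goo k.
  split; first exact: measurableX.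
  by rewrite product_measure1E// lte_mul_pinfty// ge0_fin_numE.
pose unc (x : 'rV[R]_n.+1) : measurableTypeR R * 'rV[R]_n :=
  (x ord0 ord0, rsubmx (x : 'rV[R]_(1 + n))).
have unK : cancel rV_cons unc.
  move=> [x y]; rewrite /unc /rV_cons; congr pair.
    rewrite (_ : ord0 = lshift n (ord0 : 'I_1)); last exact: val_inj.
    exact: etrans (row_mxEl _ _ _ _) (mxE _ _ _ _).
  exact: row_mxKr.
have munc : measurable_fun setT unc.
  apply/measurable_fun_pairP; split.
    exact: measurable_rV_coord.
  apply: measurable_fun_rVP => i.
  rewrite (_ : _ \o _ = @rV_coord R n.+1 (rshift 1 i)).
    exact: measurable_rV_coord.
  by apply/funext => x; rewrite /= /rV_coord /= mxE.
exists (fun k => unc @^-1` F k).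
  by rewrite -preimage_bigcup -UF preimage_setT.
move=> k; have [mFk Fk] := mF k; split.
  by rewrite -[X in measurable X]setTI; exact: munc.
rewrite /lebesgue_rV_succ /pushforward -comp_preimage.
by rewrite (_ : unc \o rV_cons = id) //; apply/funext => p /=; rewrite unK.
Qed.

HB.instance Definition _ := Measure_isSigmaFinite.Build _ _ _
  lebesgue_rV_succ succ_sigma_finite.

End lebesgue_rV_succ.

Fixpoint lebesgue_rV (R : realType) (n : nat) :
    {sigma_finite_measure set 'rV[R]_n -> \bar R} :=
  match n with
  | 0 => \d_(0 : 'rV[R]_0)
  | k.+1 => lebesgue_rV_succ (lebesgue_rV R k)
  end.

Section fourier.
Context {R : realType} {n m : nat}.
Implicit Types (x xi : 'rV[R]_n) (u v w : 'rV[R]_n -> 'cV[R[i]]_m).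

Definition dotR x xi : R := \sum_(i < n) x ord0 i * xi ord0 i.

(* The Euclidean norm; the norm [`|x|] of the library is the sup norm. *)
Definition enorm x : R := Num.sqrt (dotR x x).

Definition sqnormC (z : 'cV[R[i]]_m) : R :=
  \sum_(j < m) (complex.Re (z j ord0) ^+ 2 + complex.Im (z j ord0) ^+ 2).

Definition measurable_CV u :=
  forall j, measurable_fun setT (fun x => complex.Re (u x j ord0)) /\
            measurable_fun setT (fun x => complex.Im (u x j ord0)).

Definition sqnormL2 u : \bar R :=
  (\int[lebesgue_rV R n]_x (sqnormC (u x))%:E)%E.

Definition L2 u := measurable_CV u /\ (sqnormL2 u < +oo)%E.

Definition L1 u := forall j,
  (lebesgue_rV R n).-integrable setT (fun x => (complex.Re (u x j ord0))%:E) /\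
  (lebesgue_rV R n).-integrable setT (fun x => (complex.Im (u x j ord0))%:E).

Definition integralC (f : 'rV[R]_n -> R[i]) : R[i] :=
  Complex (Rintegral (lebesgue_rV R n) setT (fun x => complex.Re (f x)))
          (Rintegral (lebesgue_rV R n) setT (fun x => complex.Im (f x))).

Definition expNi (t : R) : R[i] := Complex (cos t) (- sin t).

(* Unnormalised convention: int exp (- i x . xi) u(x) dx; meaningful for u in
   L^1 only, as [Rintegral] is total. *)
Definition fourierL1 u xi : 'cV[R[i]]_m :=
  \col_j integralC (fun x => expNi (dotR x xi) * u x j ord0).

(* v is (a representative of) the Fourier-Plancherel transform of u: the
   extension by continuity to L^2 of [fourierL1] on L^1 and L^2. *)
Definition is_fourier u v :=
  [/\ L2 u, L2 v &
    exists w : nat -> 'rV[R]_n -> 'cV[R[i]]_m,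
      [/\ forall k, L1 (w k) /\ L2 (w k),
          sqnormL2 (w k \- u) @[k --> \oo] --> 0%E &
          sqnormL2 (fourierL1 (w k) \- v) @[k --> \oo] --> 0%E]].

End fourier.

Section decay.
Context {R : realType} {n m : nat}.
Implicit Types (u v : 'rV[R]_n -> 'cV[R[i]]_m) (r : R).

(* Here v stands for the Fourier transform of the function whose decay indicators
   are considered. *)
Definition decay_quotient r v (rho : R) : \bar R :=
  ((rho `^ (- (2 * r) - n%:R))%:E *
   \int[lebesgue_rV R n]_(xi in [set xi | enorm xi <= rho]%R)
      (sqnormC (v xi))%:E)%E.

Definition decay_inf r v : \bar R := limf_einf (decay_quotient r v) 0^'+.

Definition decay_sup r v : \bar R := limf_esup (decay_quotient r v) 0^'+.

Definition is_max (A : set R) r := A r /\ ubound A r.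

Definition is_min (A : set R) r := A r /\ lbound A r.

(* The transform v of u is unique up to a null set, so that the choice of v is
   immaterial. *)
Definition has_decay_character u r :=
  - (n%:R / 2) < r /\
  exists v, [/\ is_fourier u v,
    is_max [set s | (decay_sup s v < +oo)%E] r &
    is_min [set s | (0 < decay_inf s v)%E] r].

End decay.

Section evolution.
Context {R : realType} {n m : nat}.
Implicit Types (M : 'rV[R]_n -> 'M[R]_m).

Definition expmx (A : 'M[R]_m) : 'M[R]_m :=
  \matrix_(i, j) limn (series (fun k => (A ^+ k) i j / k`!%:R)).

Fixpoint Ck_on (k : nat) (A : set 'rV[R]_n) (f : 'rV[R]_n -> R) : Prop :=
  (forall x, A x -> {for x, continuous f}) /\
  match k with
  | 0 => True
  | k'.+1 => forall i : 'I_n,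
      (forall x, A x -> derivable f x (delta_mx ord0 i)) /\
      Ck_on k' A ('D_(delta_mx ord0 i) f)
  end.

Definition smooth_on (A : set 'rV[R]_n) (f : 'rV[R]_n -> R) :=
  forall k, Ck_on k A f.

Definition homogeneous (f : 'rV[R]_n -> R) :=
  exists d : R, forall (l : R) xi, 0 < l -> xi != 0 ->
    f (l *: xi) = l `^ d * f xi.

Definition symbol_diag (alpha : R) (c : 'I_m -> R) (xi : 'rV[R]_n) : 'M[R]_m :=
  \matrix_(i, j) (- c i * enorm xi `^ (2 * alpha) *+ (i == j)).

Definition symbol_class (alpha : R) M :=
  exists (P : 'rV[R]_n -> 'M[R]_m) (c : 'I_m -> R) (c0 : R),
    [/\ 0 < c0, forall i, c0 <= c i,
       (forall i j, homogeneous (fun xi => P xi i j)),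
       (forall i j, smooth_on [set xi | xi != 0] (fun xi => P xi i j)) &
       {ae lebesgue_rV R n, forall xi,
          P xi *m (P xi)^T = 1%:M /\
          M xi = invmx (P xi) *m symbol_diag alpha c xi *m P xi}].

(* u(t) = e^(t L) u0, where L is the Fourier multiplier of symbol M. The identity
   on the Fourier side is only required almost everywhere, since M itself is
   only prescribed almost everywhere and need not be Borel. *)
Definition is_solution M (u0 : 'rV[R]_n -> 'cV[R[i]]_m)
    (u : R -> 'rV[R]_n -> 'cV[R[i]]_m) :=
  exists v0, is_fourier u0 v0 /\
    forall t, 0 <= t -> exists v, is_fourier (u t) v /\
      {ae lebesgue_rV R n, forall xi,
        v xi = map_mx (real_complex R) (expmx (t *: M xi)) *m v0 xi}.

Definition two_sided_decay (alpha r C1 C2 : R)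
    (u : R -> 'rV[R]_n -> 'cV[R[i]]_m) :=
  forall t, 0 < t ->
    ((C1 * (1 + t) `^ (- (alpha^-1 * (r + n%:R / 2))))%:E <= sqnormL2 (u t))%E /\
    (sqnormL2 (u t) <= (C2 * (1 + t) `^ (- (alpha^-1 * (r + n%:R / 2))))%:E)%E.

End evolution.

(* Main.v *)
(** By Plancherel, [sqnormL2 (u t)] is comparable to the squared norm of the transform, which,
    the matrices [P] being orthogonal, lies between [heat (2 t C)] and [heat (2 t c0)], where
    [heat s] is the integral of [exp (- s |xi|^(2 alpha)) |v0(xi)|^2] and [v0] is the transform
    of [u0].  If [G tau] is the mass of [|v0|^2] on the ball [|xi|^(2 alpha) <= tau], then
      [G tau <= exp (s tau) heat s]   and
      [heat s <= G tau + exp (- s tau / 2) heat (s / 2)],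
    and these two inequalities with [s tau] large but fixed translate power bounds on [heat] at
    infinity into power bounds on [G] at zero and back.

    Plancherel on the line: the integral of [exp (- e |xi|) |\hat a(xi)|^2] equals
    [2 pi |a|^2 - 1/2 \int\int (a(x) - a(y))^2 P_e(x - y)] for the Poisson kernel [P_e]; the
    defect tends to [0] with [e] because continuous functions with compact support are dense
    in L^2.  The case of R^n follows by induction on [n], transforming one variable at a time. *)

Require Import Defs.
From HB Require Import structures.
From mathcomp Require Import all_boot all_order all_algebra.
From mathcomp Require Import complex.
From mathcomp Require Import all_classical all_reals all_analysis.
From mathcomp Require Import measurable_realfun ring lra.
Import Order.TTheory GRing.Theory Num.Theory.
Import numFieldNormedType.Exports.
Local Open Scope classical_set_scope.
Local Open Scope ring_scope.

Set Implicit Arguments.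
Unset Strict Implicit.
Unset Printing Implicit Defensive.

(** * Integration against bounded kernels *)

(** Fourier integrals are handled as real integrals against sines and cosines. These kernels are
    bounded, so Fubini applies to integrable functions directly. The transform of an integrable
    function need not be integrable, and for functions in L^1 and L^2 its square integrability is
    part of what has to be proved. The weight [exp (- e |xi|)] makes the interchanges legitimate,
    and monotone convergence removes it once the limit of the weighted integrals is known. The
    passage to the L^2 closure works with squared norms, where the triangle inequality costs a
    factor 2 each time; the extended transform is therefore only compared with its source up to a
    factor 4. Decay rates are stated up to constants, so comparability is enough. In the translation
    between [heat] and [G], the second inequality brings [heat] back at time [s / 2]. An upper bound
    on [heat] thus comes from an induction over dyadic times, and a lower bound on [G] requires an
    upper bound on [heat] as well, to absorb the part outside the ball. This is why the converse
    uses both sides of the decay at once. *)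

Section integral_facts.
Context d (T : measurableType d) (R : realType) (mu : {measure set T -> \bar R}).

Lemma integrable_bounded_mul {f k : T -> R} {B : R} :
  mu.-integrable setT (EFin \o f) -> measurable_fun setT k ->
  (forall x, `|k x| <= B) -> mu.-integrable setT (EFin \o (fun x => f x * k x)).
Proof.
move=> fi mk kB.
have mf : measurable_fun setT f by exact/measurable_EFinP/(measurable_int mu).
apply: (@le_integrable _ _ _ mu setT measurableT _ (fun x => B%:E * (EFin \o f) x)%E).
- exact/measurable_EFinP/measurable_funM.
- move=> x _ /=; rewrite lee_fin !normrM mulrC.
  by rewrite ler_wpM2r// (le_trans (kB x))// ler_norm.
- exact: integrableZl.
Qed.

(** Closure properties recast for real integrands composed with [EFin], the form taken by every
    integrability hypothesis below. *)
Lemma integrable_EFinZl (c : R) {f : T -> R} :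
  mu.-integrable setT (EFin \o f) ->
  mu.-integrable setT (EFin \o (fun x => c * f x)).
Proof. exact: integrableZl. Qed.

Lemma integrable_EFinD {f g : T -> R} :
  mu.-integrable setT (EFin \o f) -> mu.-integrable setT (EFin \o g) ->
  mu.-integrable setT (EFin \o (fun x => f x + g x)).
Proof. exact: integrableD. Qed.

Lemma integrable_EFinB {f g : T -> R} :
  mu.-integrable setT (EFin \o f) -> mu.-integrable setT (EFin \o g) ->
  mu.-integrable setT (EFin \o (fun x => f x - g x)).
Proof. exact: integrableB. Qed.

Lemma integrable_le {f g : T -> R} :
  measurable_fun setT f -> (forall x, `|f x| <= g x) ->
  mu.-integrable setT (EFin \o g) -> mu.-integrable setT (EFin \o f).
Proof.
move=> mf fg; apply: le_integrable => //; first exact/measurable_EFinP.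
by move=> x _ /=; rewrite lee_fin (le_trans (fg x))// ler_norm.
Qed.

Lemma ge0_integrable {f : T -> R} :
  measurable_fun setT f -> (forall x, 0 <= f x) ->
  (\int[mu]_x (f x)%:E < +oo)%E -> mu.-integrable setT (EFin \o f).
Proof.
move=> mf f0 fi; apply/integrableP; split; first exact/measurable_EFinP.
by under eq_integral do rewrite /= ger0_norm//.
Qed.

Lemma integral_EFin_Rintegral {f : T -> R} :
  mu.-integrable setT (EFin \o f) ->
  (\int[mu]_x (f x)%:E)%E = (Rintegral mu setT f)%:E.
Proof. by move=> fi; rewrite /Rintegral fineK//; exact: integrable_fin_num. Qed.

End integral_facts.

(** * Parametric integrals and Fubini with a bounded kernel *)

Section product_integral.
Context d1 d2 (X : measurableType d1) (Y : measurableType d2) (R : realType).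

(** Tonelli makes the integrals of the positive and negative parts measurable in the parameter, and
    [fine] is measurable; slices with an infinite integral get the value 0, so integrability is not
    at stake. *)
Lemma measurable_fun_Rintegral_snd (m2 : {sigma_finite_measure set Y -> \bar R})
    (k : X * Y -> R) :
  measurable_fun setT k ->
  measurable_fun setT (fun x => Rintegral m2 setT (fun y => k (x, y))).
Proof.
move=> mk; apply: (measurableT_comp (fine_measurable measurableT)).
have mK : measurable_fun setT (EFin \o k) by exact/measurable_EFinP.
rewrite (_ : (fun x => _) = (fun x => \int[m2]_y (EFin \o k)^\+ (x, y)) \-
   (fun x => \int[m2]_y (EFin \o k)^\- (x, y)))%E; last first.
  by apply/funext => x; rewrite integralE; congr (_ - _)%E;
    apply: eq_integral => y _; rewrite ?funeposE ?funenegE.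
apply: emeasurable_funB.
- by apply: measurable_fun_fubini_tonelli_F => //; exact: measurable_funepos.
- by apply: measurable_fun_fubini_tonelli_F => //; exact: measurable_funeneg.
Qed.

Variables (m1 : {sigma_finite_measure set X -> \bar R})
          (m2 : {sigma_finite_measure set Y -> \bar R}).

Lemma integrable_prod_bounded (p : X -> R) (q : Y -> R) (k : X * Y -> R) (B : R) :
  m1.-integrable setT (EFin \o p) -> m2.-integrable setT (EFin \o q) ->
  measurable_fun setT k -> (forall z, `|k z| <= B) ->
  (m1 \x m2)%E.-integrable setT (EFin \o (fun z => p z.1 * q z.2 * k z)).
Proof.
move=> pi qi mk kB.
have mp : measurable_fun setT p by exact/measurable_EFinP/(measurable_int m1).
have mq : measurable_fun setT q by exact/measurable_EFinP/(measurable_int m2).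
have mpq : measurable_fun setT (fun z : X * Y => p z.1 * q z.2).
  apply: measurable_funM; apply: measurableT_comp => //.
apply: integrable_bounded_mul mk kB.
apply/integrable12ltyP; first exact/measurable_EFinP.
rewrite (_ : (fun x => _) =
  (fun x => (Rintegral m2 setT (fun y => `|q y|))%:E * `|(p x)%:E|))%E; last first.
  apply/funext => x /=.
  have -> : (fun y => `|p x * q y|%:E) = (fun y => `|p x|%:E * `|(q y)%:E|)%E.
    by apply/funext => y; rewrite normrM.
  rewrite ge0_integralZl//; last by do 2 apply: measurableT_comp => //.
  rewrite muleC; congr (_ * _)%E.
  rewrite -integral_EFin_Rintegral//; exact: (integrable_abse qi).
rewrite ge0_integralZl//.
- by rewrite lte_mul_pinfty// ?lee_fin ?Rintegral_ge0//; case/integrableP: pi.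
- by do 2 apply: measurableT_comp => //.
- by rewrite lee_fin Rintegral_ge0.
Qed.

(** The integrable factors stay outside the inner integrals, which is the shape of the interchanges
    in the Plancherel computation. The bound on [k] makes every slice integrable, so that [fine]
    loses nothing on either side. *)
Lemma Rintegral_swap (p : X -> R) (q : Y -> R) (k : X * Y -> R) (B : R) :
  m1.-integrable setT (EFin \o p) -> m2.-integrable setT (EFin \o q) ->
  measurable_fun setT k -> (forall z, `|k z| <= B) ->
  Rintegral m1 setT (fun x => p x * Rintegral m2 setT (fun y => q y * k (x, y))) =
  Rintegral m2 setT (fun y => q y * Rintegral m1 setT (fun x => p x * k (x, y))).
Proof.
move=> pi qi mk kB.
have i1 := integrable_prod_bounded pi qi mk kB.
rewrite /Rintegral; congr fine.
have := Fubini i1; rewrite /=.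
rewrite [X in X = _ -> _](_ : _ =
   \int[m1]_x (p x * fine (\int[m2]_y (q y * k (x, y))%:E))%:E)%E; last first.
  apply: eq_integral => x _.
  have qk : m2.-integrable setT (EFin \o (fun y => q y * k (x, y))).
    exact: integrable_bounded_mul qi (measurable_fun_pair2 x mk) (fun y => kB (x, y)).
  rewrite -[fine _]/(Rintegral m2 setT (fun y => q y * k (x, y))) -RintegralZl//.
  rewrite -integral_EFin_Rintegral.
    by apply: eq_integral => y _; rewrite mulrA.
  exact: integrable_EFinZl.
move=> ->; apply: eq_integral => y _.
have pk : m1.-integrable setT (EFin \o (fun x => p x * k (x, y))).
  exact: integrable_bounded_mul pi (measurable_fun_pair1 y mk) (fun x => kB (x, y)).
rewrite -[fine _]/(Rintegral m1 setT (fun x => p x * k (x, y))) -RintegralZl//.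
rewrite -integral_EFin_Rintegral.
  by apply: eq_integral => x _; rewrite [in RHS]mulrCA mulrA.
exact: integrable_EFinZl.
Qed.

End product_integral.

(** * The Poisson kernel *)

Section real_line.
Context {R : realType}.
Notation mu := (@lebesgue_measure R).
Implicit Types (f F : R -> R) (a l e x z : R).

Lemma is_derive_continuous f (f' : R -> R) : (forall x : R, is_derive x 1 f (f' x)) -> continuous f.
Proof.
move=> df x; apply: differentiable_continuous; apply/derivable1_diffP.
by have [] := df x.
Qed.

Lemma ge0_integral_ray f F a l : (forall x, 0 <= f x) -> continuous f ->
  (forall x : R, is_derive x 1 F (f x)) -> F x @[x --> +oo] --> l ->
  (\int[mu]_(x in `[a, +oo[) (f x)%:E = (l - F a)%:E)%E.
Proof.
move=> f0 cf dF Fl; rewrite EFinB.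
have cF := is_derive_continuous dF.
apply: ge0_continuous_FTC2y => //.
- exact: continuous_subspaceT.
- by apply: cvg_at_right_filter; exact: cF.
- by move=> x _; rewrite derive1E; have [] := dF x.
Qed.

(** The line is cut at 0 and the negative half reflected onto a ray, where [- F (- x)] is an
    antiderivative of [f (- x)]. *)
Lemma ge0_integral_line f F l l' : (forall x, 0 <= f x) -> continuous f ->
  (forall x : R, is_derive x 1 F (f x)) -> F x @[x --> +oo] --> l ->
  F x @[x --> -oo] --> l' -> (\int[mu]_x (f x)%:E = (l - l')%:E)%E.
Proof.
move=> f0 cf dF Fl Fl'.
have mf : measurable_fun setT f by exact: continuous_measurable_fun.
rewrite -(setUv `[0, +oo[%classic) ge0_integral_setU//=; last 4 first.
  exact: measurableC.
  by rewrite setUv; exact/measurable_EFinP.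
  by move=> x _; rewrite lee_fin.
  exact/disj_setPCl.
rewrite (ge0_integral_ray _ f0 cf dF Fl) setCitvr.
rewrite integral_itv_bndo_bndc; last exact/measurable_EFinP/measurable_funTS.
rewrite -oppr0 ge0_integration_by_substitutionNy//; last exact: continuous_subspaceT.
have dFN (x : R) : is_derive x 1 (fun x => - F (- x)) (f (- x)).
  have dFx := dF (- x).
  by apply: is_derive_eq; rewrite ?scalerN1 /= ?mulrN1 ?mulrN ?mulr1 ?opprK.
rewrite (ge0_integral_ray 0 _ _ dFN (l := - l')).
- by rewrite -EFinD oppr0; congr EFin; ring.
- by move=> x; exact: f0.
- by move=> x; apply: continuous_comp; [exact: opp_continuous|exact: cf].
- by apply: cvgN; exact/cvgNy_compNP.
Qed.

(** Normalised with total mass [2 * pi], so that it is exactly the Fourier transform of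
    [exp (- e |x|)]. *)
Definition poisson (e z : R) : R := 2 * e / (e ^+ 2 + z ^+ 2).

Lemma poisson_ge0 e z : 0 < e -> 0 <= poisson e z.
Proof. by move=> e0; rewrite divr_ge0// ?mulr_ge0// ?addr_ge0 ?sqr_ge0// ltW. Qed.

Lemma poisson_den_gt0 e z : 0 < e -> 0 < e ^+ 2 + z ^+ 2.
Proof. by move=> e0; rewrite ltr_pwDl ?exprn_gt0// sqr_ge0. Qed.

Lemma poissonN e z : poisson e (- z) = poisson e z.
Proof. by rewrite /poisson sqrrN. Qed.

Lemma continuous_poisson e x : 0 < e -> continuous (fun y => poisson e (x - y)).
Proof.
move=> e0 y; apply: cvgM; first exact: cvg_cst.
apply: cvgV; first by rewrite gt_eqF// poisson_den_gt0.
apply: cvgD; first exact: cvg_cst.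
apply: (@continuous_comp _ _ _ (fun y : R => x - y) (fun t => t ^+ 2)).
  by apply: cvgB; [exact: cvg_cst|exact: cvg_id].
exact: exprn_continuous.
Qed.

Lemma cvgNy_atan : (@atan R) x @[x --> -oo] --> - (pi / 2).
Proof.
apply/cvgNy_compNP; rewrite (_ : _ \o _ = fun x => - atan x); last first.
  by apply/funext => x /=; rewrite atanN.
by apply: cvgN; exact: cvgy_atan.
Qed.

Lemma integral_poisson e x : 0 < e ->
  (\int[mu]_y (poisson e (x - y))%:E = (2 * pi)%:E)%E.
Proof.
move=> e0.
have dF (y : R) : is_derive y 1 (fun y => 2 * atan ((y - x) / e)) (poisson e (x - y)).
  apply: is_derive_eq.
  rewrite /poisson /GRing.scale /=.
  have := poisson_den_gt0 (x - y) e0 => /lt0r_neq0.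
  move=> den; field.
  by rewrite den gt_eqF.
rewrite (ge0_integral_line _ _ dF (l := 2 * (pi / 2)) (l' := 2 * - (pi / 2))).
- by congr EFin; field.
- by move=> y; exact: poisson_ge0.
- exact: continuous_poisson.
- apply: cvgM; first exact: cvg_cst.
  apply: cvg_comp; last exact: cvgy_atan.
  apply: gt0_cvgMly; first by rewrite invr_gt0.
  exact: cvg_addrr.
- apply: cvgM; first exact: cvg_cst.
  apply: cvg_comp; last exact: cvgNy_atan.
  apply: gt0_cvgMlNy; first by rewrite invr_gt0.
  exact: cvg_addrr_Ny.
Qed.

End real_line.

(** * The exponential weight and its cosine transform *)

Section exponential_weight.
Context {R : realType}.
Notation mu := (@lebesgue_measure R).
Implicit Types (e x z : R).

Definition expw (e x : R) : R := expR (- (e * `|x|)).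

Lemma expw_ge0 e x : 0 <= expw e x. Proof. exact: expR_ge0. Qed.

Lemma expw_even e x : expw e (- x) = expw e x.
Proof. by rewrite /expw normrN. Qed.

Lemma continuous_expw e : continuous (expw e).
Proof.
move=> x; apply: (@continuous_comp _ _ _ (fun x : R => - (e * `|x|)) expR).
  by apply: cvgN; apply: cvgM; [exact: cvg_cst|exact: norm_continuous].
exact: continuous_expR.
Qed.

Lemma continuous_cosM z : continuous (fun x : R => cos (z * x)).
Proof.
move=> x; apply: (@continuous_comp _ _ _ (fun x : R => z * x) cos).
  by apply: cvgM; [exact: cvg_cst|exact: cvg_id].
exact: continuous_cos.
Qed.

Lemma cvg_expNM e : 0 < e -> expR (- (e * x)) @[x --> +oo] --> (0 : R).
Proof.
move=> e0; apply: (@cvg_comp _ _ _ (fun x => e * x) (fun x => expR (- x))).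
  exact: (gt0_cvgMry e0 cvg_id).
exact: cvgr_expR.
Qed.

(** An antiderivative on the positive ray, vanishing at infinity. The integrand carries [1 + cos]
    instead of [cos] to be nonnegative, so that the fundamental theorem on a ray applies before
    integrability is known. *)
Let G e z (x : R) :=
  - (expR (- (e * x)) / e) +
  expR (- (e * x)) * (z * sin (z * x) - e * cos (z * x)) / (e ^+ 2 + z ^+ 2).

Let dG e z (x : R) : 0 < e ->
  is_derive x 1 (G e z) (expR (- (e * x)) * (1 + cos (z * x))).
Proof.
move=> e0; apply: is_derive_eq.
rewrite /GRing.scale /=.
have := poisson_den_gt0 z e0 => /lt0r_neq0 den.
by field; rewrite den gt_eqF.
Qed.

Let G_cvg e z : 0 < e -> G e z x @[x --> +oo] --> (0 : R).
Proof.
move=> e0; have d0 := poisson_den_gt0 z e0.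
pose B := e^-1 + (`|z| + e) / (e ^+ 2 + z ^+ 2).
have lim c : c * expR (- (e * x)) @[x --> +oo] --> (0 : R).
  rewrite -(mulr0 c); apply: cvgM; [exact: cvg_cst|exact: cvg_expNM].
apply: (@squeeze_cvgr _ _ _ _ (fun x => - B * expR (- (e * x)))
                              (fun x => B * expR (- (e * x)))) => //.
near=> x; rewrite mulNr -ler_norml.
rewrite /G /B (le_trans (ler_normD _ _))// normrN !normrM normfV.
rewrite !normfV (gtr0_norm (expR_gt0 _)) (gtr0_norm d0) (gtr0_norm e0).
rewrite mulrDl [e^-1 * _]mulrC lerD2l -mulrA [leRHS]mulrC ler_wpM2l ?expR_ge0//.
rewrite ler_wpM2r ?invr_ge0 ?(ltW d0)// (le_trans (ler_normB _ _))// !normrM.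
rewrite (gtr0_norm e0) lerD//.
- by rewrite ler_piMr// ler_norml sin_geN1 sin_le1.
- by rewrite ler_piMr ?(ltW e0)// ler_norml cos_geN1 cos_le1.
Unshelve. all: by end_near. Qed.

Let expw_cos_ge0 e z x : 0 <= expw e x * (1 + cos (z * x)).
Proof. by rewrite mulr_ge0 ?expR_ge0// -lerBlDl sub0r cos_geN1. Qed.

Let integral_expw_1cos e z : 0 < e ->
  (\int[mu]_x (expw e x * (1 + cos (z * x)))%:E = (2 / e + poisson e z)%:E)%E.
Proof.
move=> e0; rewrite ge0_symfun_integralT//; last 2 first.
- move=> x; apply: cvgM; first exact: continuous_expw.
  by apply: cvgD; [exact: cvg_cst|exact: continuous_cosM].
- by move=> x /=; rewrite expw_even mulrN cosN.
rewrite -set_itvcy.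
transitivity (2%:E * \int[mu]_(x in `[0%R, +oo[) (expR (- (e * x)) * (1 + cos (z * x)))%:E)%E.
  congr (_ * _)%E; apply: eq_integral => x; rewrite inE/= in_itv/= andbT => x0.
  by rewrite /expw ger0_norm.
have dGx (x : R) := dG z x e0.
rewrite (ge0_integral_ray _ _ _ dGx (G_cvg _ e0)).
- rewrite -EFinM; congr EFin; rewrite /G /poisson !mulr0 sin0 cos0 oppr0 expR0.
  have := poisson_den_gt0 z e0 => /lt0r_neq0 den.
  by field; rewrite den gt_eqF.
- by move=> x; rewrite mulr_ge0 ?expR_ge0// -lerBlDl sub0r cos_geN1.
- move=> x; apply: cvgM.
    apply: (@continuous_comp _ _ _ (fun x : R => - (e * x)) expR).
      by apply: cvgN; apply: cvgM; [exact: cvg_cst|exact: cvg_id].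
    exact: continuous_expR.
  by apply: cvgD; [exact: cvg_cst|exact: continuous_cosM].
Qed.

Lemma integrable_expw e : 0 < e -> mu.-integrable setT (EFin \o expw e).
Proof.
move=> e0; apply: (@integrable_le _ _ _ mu _ (fun x => expw e x * (1 + cos (0 * x)))).
- exact: continuous_measurable_fun (@continuous_expw e).
- by move=> x; rewrite mul0r cos0 (ger0_norm (expw_ge0 _ _)) ler_peMr ?expw_ge0// lerDl.
- apply: ge0_integrable => //; last by rewrite integral_expw_1cos// ltry.
  apply: continuous_measurable_fun => x; apply: cvgM; first exact: continuous_expw.
  by apply: cvgD; [exact: cvg_cst|exact: continuous_cosM].
Qed.

Lemma measurable_expw e : measurable_fun setT (expw e).
Proof. exact: continuous_measurable_fun (@continuous_expw e). Qed.

Lemma Rintegral_expw_cos e z : 0 < e ->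
  Rintegral mu setT (fun x => expw e x * cos (z * x)) = poisson e z.
Proof.
move=> e0; have iw := integrable_expw e0.
have icos z' : mu.-integrable setT (EFin \o (fun x => expw e x * cos (z' * x))).
  apply: (integrable_bounded_mul (B := 1)) => //.
    by apply: continuous_measurable_fun; exact: continuous_cosM.
  by move=> x; rewrite ler_norml cos_geN1 cos_le1.
have H z' : Rintegral mu setT (expw e) + Rintegral mu setT (fun x => expw e x * cos (z' * x)) =
    2 / e + poisson e z'.
  apply: EFin_inj; rewrite -integral_expw_1cos// -RintegralD// -integral_EFin_Rintegral.
    by apply: eq_integral => x _; rewrite mulrDr mulr1.
  exact: integrable_EFinD iw (icos z').
(* At frequency 0 the two summands coincide, which fixes the integral of the weight at [2 / e];
   subtracting it isolates the cosine. *)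
have H0 := H 0; have Hz := H z.
have E0 : Rintegral mu setT (fun x => expw e x * cos (0 * x)) = Rintegral mu setT (expw e).
  by apply: eq_Rintegral => x _; rewrite mul0r cos0 mulr1.
have P0 : poisson e 0 = 2 / e.
  by rewrite /poisson expr0n addr0; field; rewrite gt_eqF.
move: H0 Hz; rewrite E0 P0.
set a := Rintegral _ _ _; set b := Rintegral _ _ _; move=> H0 Hz.
by lra.
Qed.

Lemma poisson_le (e z : R) : 0 < e -> poisson e z <= 2 / e.
Proof.
move=> e0; rewrite /poisson ler_pdivrMr ?poisson_den_gt0//.
rewrite -subr_ge0 (_ : _ - _ = 2 / e * z ^+ 2).
  by rewrite mulr_ge0 ?sqr_ge0// divr_ge0// ltW.
by field; rewrite gt_eqF.
Qed.

(** Off the diagonal the kernel is of order [e] while still dominated by a fixed integrable kernel,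
    so the contribution of distant pairs to the defect vanishes linearly in [e]. *)
Lemma poisson_far (e r h : R) : 0 < e -> 0 < r -> r <= `|h| ->
  poisson e h <= e * (1 + (r ^+ 2)^-1) * poisson 1 h.
Proof.
move=> e0 r0 rh; rewrite /poisson.
have rh2 : r ^+ 2 <= h ^+ 2.
  by rewrite -(real_normK (num_real h)) ler_sqr ?nnegrE// ltW.
have r20 : 0 < r ^+ 2 by rewrite exprn_gt0.
have h20 : 0 < h ^+ 2 by exact: lt_le_trans rh2.
apply: (@le_trans _ _ (2 * e / h ^+ 2)).
  by rewrite ler_wpM2l ?mulr_ge0 ?(ltW e0)// lef_pV2 ?posrE ?poisson_den_gt0// lerDr sqr_ge0.
rewrite expr1n mulr1 [leRHS](_ : _ = (2 * e) * ((1 + (r ^+ 2)^-1) / (1 + h ^+ 2))); last by ring.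
rewrite ler_wpM2l ?mulr_ge0 ?(ltW e0)//.
rewrite ler_pdivlMr ?ltr_pwDl ?sqr_ge0// mulrDr mulr1 mulVf ?gt_eqF// addrC lerD2l.
by rewrite lef_pV2 ?posrE.
Qed.

End exponential_weight.

(* Otherwise rewriting with lemmas on products unfolds the kernel. *)
Opaque poisson.

(** * Plancherel's theorem on the line *)

Section cosine_sine_transform.
Context {R : realType}.
Notation mu := (@lebesgue_measure R).
Implicit Types (a : R -> R) (e : R).

(** For real [a] the transform is [cosT a - i sinT a]. *)
Definition cosT a (xi : R) : R := Rintegral mu setT (fun x => a x * cos (x * xi)).
Definition sinT a (xi : R) : R := Rintegral mu setT (fun x => a x * sin (x * xi)).

Lemma norm_cos_le1 (x : R) : `|cos x| <= 1.
Proof. by rewrite ler_norml cos_geN1 cos_le1. Qed.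

Lemma norm_sin_le1 (x : R) : `|sin x| <= 1.
Proof. by rewrite ler_norml sin_geN1 sin_le1. Qed.

Lemma measurable_cos d (T : measurableType d) (f : T -> R) :
  measurable_fun setT f -> measurable_fun setT (fun x => cos (f x)).
Proof.
move=> mf; apply: (@measurableT_comp _ _ _ _ _ _ (@cos R)) => //.
by apply: continuous_measurable_fun; exact: continuous_cos.
Qed.

Lemma measurable_sin d (T : measurableType d) (f : T -> R) :
  measurable_fun setT f -> measurable_fun setT (fun x => sin (f x)).
Proof.
move=> mf; apply: (@measurableT_comp _ _ _ _ _ _ (@sin R)) => //.
by apply: continuous_measurable_fun; exact: continuous_sin.
Qed.

Lemma integrable_mul_cos d (T : measurableType d) (m : {measure set T -> \bar R})
    (a f : T -> R) : m.-integrable setT (EFin \o a) -> measurable_fun setT f ->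
  m.-integrable setT (EFin \o (fun x => a x * cos (f x))).
Proof.
move=> ai mf; apply: integrable_bounded_mul ai _ (fun x => norm_cos_le1 (f x)).
exact: measurable_cos.
Qed.

Lemma integrable_mul_sin d (T : measurableType d) (m : {measure set T -> \bar R})
    (a f : T -> R) : m.-integrable setT (EFin \o a) -> measurable_fun setT f ->
  m.-integrable setT (EFin \o (fun x => a x * sin (f x))).
Proof.
move=> ai mf; apply: integrable_bounded_mul ai _ (fun x => norm_sin_le1 (f x)).
exact: measurable_sin.
Qed.

Lemma norm_Rintegral_mul_le d (T : measurableType d) (m : {measure set T -> \bar R})
    (a k : T -> R) : m.-integrable setT (EFin \o a) -> measurable_fun setT k ->
  (forall x, `|k x| <= 1) ->
  `|Rintegral m setT (fun x => a x * k x)| <= Rintegral m setT (fun x => `|a x|).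
Proof.
move=> ai mk k1; have aki := integrable_bounded_mul ai mk k1.
rewrite (le_trans (le_normr_Rintegral _ _))// le_Rintegral//.
- exact: integrable_abse aki.
- exact: integrable_abse ai.
- by move=> x _; rewrite normrM ler_piMr.
Qed.

Variable a : R -> R.
Hypothesis ai : mu.-integrable setT (EFin \o a).

Let ma : measurable_fun setT a.
Proof. by apply/measurable_EFinP; exact: measurable_int ai. Qed.

Lemma measurable_cosT : measurable_fun setT (cosT a).
Proof.
apply: (@measurable_fun_Rintegral_snd _ _ _ _ _ mu (fun z : R * R => a z.2 * cos (z.2 * z.1))).
apply: measurable_funM; first exact: measurableT_comp.
by apply: measurable_cos; apply: measurable_funM.
Qed.

Lemma measurable_sinT : measurable_fun setT (sinT a).
Proof.
apply: (@measurable_fun_Rintegral_snd _ _ _ _ _ mu (fun z : R * R => a z.2 * sin (z.2 * z.1))).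
apply: measurable_funM; first exact: measurableT_comp.
by apply: measurable_sin; apply: measurable_funM.
Qed.

Let icn xi : mu.-integrable setT (EFin \o (fun x => a x * cos (x * xi))).
Proof. by apply: integrable_mul_cos => //; exact: measurable_funM. Qed.

Let isn xi : mu.-integrable setT (EFin \o (fun x => a x * sin (x * xi))).
Proof. by apply: integrable_mul_sin => //; exact: measurable_funM. Qed.

Let A := Rintegral mu setT (fun x => `|a x|).

Let cosT_le xi : `|cosT a xi| <= A.
Proof.
apply: norm_Rintegral_mul_le => // [|x]; last exact: norm_cos_le1.
by apply: measurable_cos; exact: measurable_funM.
Qed.

Let sinT_le xi : `|sinT a xi| <= A.
Proof.
apply: norm_Rintegral_mul_le => // [|x]; last exact: norm_sin_le1.
by apply: measurable_sin; exact: measurable_funM.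
Qed.

Lemma sqr_cosT_sinT_le xi : cosT a xi ^+ 2 + sinT a xi ^+ 2 <= A ^+ 2 + A ^+ 2.
Proof.
have A0 : 0 <= A := le_trans (normr_ge0 _) (cosT_le xi).
rewrite -(real_normK (num_real (cosT a xi))) -(real_normK (num_real (sinT a xi))).
by rewrite lerD// ler_sqr ?nnegrE.
Qed.

(** The square of the transform is a double integral of [a x * a y * cos ((x - y) * xi)].
    Integrating in [xi] first turns the weight into the Poisson kernel. The two copies of [a] are
    released one at a time, so each interchange involves only one product of two measures. *)
Lemma Rintegral_expw_sqr_transform e : 0 < e ->
  Rintegral mu setT (fun xi => expw e xi * (cosT a xi ^+ 2 + sinT a xi ^+ 2)) =
  Rintegral mu setT (fun x => a x * Rintegral mu setT (fun y => a y * poisson e (x - y))).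
Proof.
move=> e0.
(* Only one factor of each square is expanded here; the other stays in the kernel, which is bounded
   because the transforms are bounded by the L^1 norm. *)
pose k1 (z : R * R) := cosT a z.1 * cos (z.2 * z.1) + sinT a z.1 * sin (z.2 * z.1).
have mk1 : measurable_fun setT k1.
  apply: measurable_funD; apply: measurable_funM.
  - by apply: measurableT_comp => //; exact: measurable_cosT.
  - by apply: measurable_cos; exact: measurable_funM.
  - by apply: measurableT_comp => //; exact: measurable_sinT.
  - by apply: measurable_sin; exact: measurable_funM.
have k1B z : `|k1 z| <= A + A.
  rewrite (le_trans (ler_normD _ _))// !normrM lerD//.
    by rewrite (le_trans _ (cosT_le z.1))// ler_piMr// norm_cos_le1.
  by rewrite (le_trans _ (sinT_le z.1))// ler_piMr// norm_sin_le1.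
have iw := integrable_expw e0.
transitivity (Rintegral mu setT (fun xi => expw e xi *
    Rintegral mu setT (fun x => a x * k1 (xi, x)))).
  apply: eq_Rintegral => xi _; congr (_ * _).
  transitivity (Rintegral mu setT (fun x =>
    cosT a xi * (a x * cos (x * xi)) + sinT a xi * (a x * sin (x * xi)))).
    rewrite RintegralD ?RintegralZl//; [exact: integrable_EFinZl|exact: integrable_EFinZl].
  by apply: eq_Rintegral => x _; rewrite /k1/=; ring.
rewrite (Rintegral_swap iw ai mk1 k1B); apply: eq_Rintegral => x _; congr (_ * _).
(* The second copy of [a] is expanded for fixed [x], and the subtraction formula merges the two
   products into one cosine. *)
pose k2 (z : R * R) := cos ((x - z.2) * z.1).
have mk2 : measurable_fun setT k2.
  by apply: measurable_cos; apply: measurable_funM => //; apply: measurable_funB.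
transitivity (Rintegral mu setT (fun xi => expw e xi *
    Rintegral mu setT (fun y => a y * k2 (xi, y)))).
  apply: eq_Rintegral => xi _; congr (_ * _); rewrite /k1/k2/=.
  rewrite [X in X + _ = _]mulrC [X in _ + X = _]mulrC /cosT /sinT -!RintegralZl//.
  rewrite -RintegralD//; try exact: integrable_EFinZl.
  by apply: eq_Rintegral => y _; rewrite mulrBl cosB; ring.
rewrite (Rintegral_swap iw ai mk2 (fun z => norm_cos_le1 _)).
by apply: eq_Rintegral => y _; rewrite -Rintegral_expw_cos.
Qed.

End cosine_sine_transform.

(** * The Poisson defect and its behaviour for small parameter *)

Section poisson_defect.
Context {R : realType}.
Notation mu := (@lebesgue_measure R).
Implicit Types (a g : R -> R) (e d : R).

(** Only [x] is confined to [K]: pairs that straddle the edge of the support have to be controlled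
    too. Around each centre half the radius of continuity is kept, so that the estimate survives a
    small displacement of the centre, and compactness makes the radius uniform. *)
Lemma heine_compact (K : set R) g d : compact K -> continuous g -> 0 < d ->
  exists2 r, 0 < r & forall x y, K x -> `|x - y| < r -> `|g x - g y| <= d.
Proof.
move=> cK cg d0.
pose P (r x : R) := forall y, `|x - y| < r -> `|g x - g y| <= d.
have : \forall r \near 0^'+, K `<=` P r.
  apply: ((compact_near_coveringP K).1 cK) => x Kx.
  have /cvgrPdist_lt/(_ (d / 2)) := cg x.
  rewrite divr_gt0// => /(_ isT)[r /= r0 gr].
  exists (ball x (r / 2), [set t | 0 < t < r / 2]) => /=.
    split; first by apply: nbhsx_ballx; rewrite divr_gt0.
    near=> t; apply/andP; split; near: t; first exact: nbhs_right_gt.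
    by apply: nbhs_right_lt; rewrite divr_gt0.
  move=> [x' t]/= [xx' /andP[t0 tr]] y x'y.
  have h1 : `|g x - g x'| < d / 2.
    by apply: gr => /=; rewrite (lt_le_trans xx')// ler_pdivrMr// ler_peMr ?(ltW r0)// ler1n.
  have h2 : `|g x - g y| < d / 2.
    apply: gr => /=; rewrite (_ : x - y = (x - x') + (x' - y)); last by ring.
    rewrite (le_lt_trans (ler_normD _ _))//.
    rewrite [ltRHS](splitr r) ltrD// (lt_trans x'y)//.
  rewrite (_ : g x' - g y = - (g x - g x') + (g x - g y)); last by ring.
  by rewrite (le_trans (ler_normD _ _))// normrN (splitr d) lerD// ltW.
move=> [r /= r0 H]; exists (r / 2); first by rewrite divr_gt0.
move=> x y Kx xy; apply: (H (r / 2)) => //=.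
  rewrite sub0r normrN gtr0_norm ?divr_gt0//.
  by rewrite ltr_pdivrMr// ltr_pMr// ltr1n.
by rewrite divr_gt0.
Unshelve. all: by end_near. Qed.

(** Kept in the extended reals, where Tonelli applies to any measurable [a]. Expanding the square
    gives twice the gap between [2 pi |a|^2] and the weighted integral of the squared transform. *)
Definition poisson_defect e a : \bar R :=
  (\int[mu \x mu]_z ((a z.1 - a z.2) ^+ 2 * poisson e (z.1 - z.2))%:E)%E.

Lemma measurable_poisson e : 0 < e -> measurable_fun setT (poisson e).
Proof.
move=> e0; apply: continuous_measurable_fun => x.
have := @continuous_poisson R e 0 e0 (- x).
rewrite /continuous_at sub0r opprK => H.
rewrite (_ : poisson e = (fun y => poisson e (0 - y)) \o -%R); last first.
  by apply/funext => y /=; rewrite sub0r opprK.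
apply: continuous_comp; first exact: opp_continuous.
exact: continuous_poisson.
Qed.

Lemma measurable_poissonB e : 0 < e ->
  measurable_fun setT (fun z : R * R => poisson e (z.1 - z.2)).
Proof.
move=> e0; apply: (@measurableT_comp _ _ _ _ _ _ (poisson e)).
  exact: measurable_poisson.
exact: measurable_funB.
Qed.

Lemma integral_fst_poisson e (c : R -> R) : 0 < e -> measurable_fun setT c ->
  (forall x, 0 <= c x) ->
  (\int[mu \x mu]_z (c z.1 * poisson e (z.1 - z.2))%:E =
   (2 * pi)%:E * \int[mu]_x (c x)%:E)%E.
Proof.
move=> e0 mc c0; rewrite fubini_tonelli1; last 2 first.
- apply/measurable_EFinP/measurable_funM; last exact: measurable_poissonB.
  exact: measurableT_comp.
- by move=> z; rewrite lee_fin mulr_ge0// poisson_ge0.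
rewrite -ge0_integralZl//; last 3 first.
- exact/measurable_EFinP.
- by move=> x _; rewrite lee_fin.
- by rewrite lee_fin mulr_ge0// pi_ge0.
apply: eq_integral => x _; rewrite /fubini_F /=.
under eq_integral do rewrite EFinM.
rewrite ge0_integralZl//; last 3 first.
- apply/measurable_EFinP; apply: continuous_measurable_fun; exact: continuous_poisson.
- by move=> y _; rewrite lee_fin poisson_ge0.
- by rewrite lee_fin.
by rewrite integral_poisson// muleC.
Qed.

Lemma integral_snd_poisson e (c : R -> R) : 0 < e -> measurable_fun setT c ->
  (forall x, 0 <= c x) ->
  (\int[mu \x mu]_z (c z.2 * poisson e (z.1 - z.2))%:E =
   (2 * pi)%:E * \int[mu]_x (c x)%:E)%E.
Proof.
move=> e0 mc c0; rewrite -(integral_fst_poisson e0 mc c0).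
rewrite fubini_tonelli2; last 2 first.
- apply/measurable_EFinP/measurable_funM; last exact: measurable_poissonB.
  exact: measurableT_comp.
- by move=> z; rewrite lee_fin mulr_ge0// poisson_ge0.
rewrite fubini_tonelli1; last 2 first.
- apply/measurable_EFinP/measurable_funM; last exact: measurable_poissonB.
  exact: measurableT_comp.
- by move=> z; rewrite lee_fin mulr_ge0// poisson_ge0.
apply: eq_integral => y _; apply: eq_integral => x _ /=.
by rewrite -poissonN opprB.
Qed.

Let mfst_poisson e (c : R -> R) : 0 < e -> measurable_fun setT c ->
  measurable_fun setT (fun z : R * R => c z.1 * poisson e (z.1 - z.2)).
Proof.
move=> e0 mc; apply: measurable_funM; last exact: measurable_poissonB.
exact: measurableT_comp.
Qed.

Let msnd_poisson e (c : R -> R) : 0 < e -> measurable_fun setT c ->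
  measurable_fun setT (fun z : R * R => c z.2 * poisson e (z.1 - z.2)).
Proof.
move=> e0 mc; apply: measurable_funM; last exact: measurable_poissonB.
exact: measurableT_comp.
Qed.

Lemma integral_both_poisson e (c : R -> R) : 0 < e -> measurable_fun setT c ->
  (forall x, 0 <= c x) ->
  (\int[mu \x mu]_z ((c z.1 + c z.2) * poisson e (z.1 - z.2))%:E =
   (4 * pi)%:E * \int[mu]_x (c x)%:E)%E.
Proof.
move=> e0 mc c0.
under eq_integral do rewrite mulrDl EFinD.
rewrite ge0_integralD//; last 4 first.
- by move=> z _; rewrite lee_fin mulr_ge0// poisson_ge0.
- by apply/measurable_EFinP; exact: mfst_poisson.
- by move=> z _; rewrite lee_fin mulr_ge0// poisson_ge0.
- by apply/measurable_EFinP; exact: msnd_poisson.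
rewrite integral_fst_poisson// integral_snd_poisson// -ge0_muleDl.
- by rewrite -EFinD; congr (_%:E * _)%E; ring.
- by rewrite lee_fin mulr_ge0// pi_ge0.
- by rewrite lee_fin mulr_ge0// pi_ge0.
Qed.

Let mdefect e a : 0 < e -> measurable_fun setT a ->
  measurable_fun setT (fun z : R * R => (a z.1 - a z.2) ^+ 2 * poisson e (z.1 - z.2)).
Proof.
move=> e0 ma; apply: measurable_funM; last exact: measurable_poissonB.
by apply: measurable_funX; apply: measurable_funB; exact: measurableT_comp.
Qed.

Let defect_ge0 e a (z : R * R) : 0 < e ->
  (0 <= ((a z.1 - a z.2) ^+ 2 * poisson e (z.1 - z.2))%:E)%E.
Proof. by move=> e0; rewrite lee_fin mulr_ge0 ?sqr_ge0// poisson_ge0. Qed.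

(** The bound is uniform in [e]: an error that is small in L^2 has a small defect whatever the
    parameter, which is what lets a dense class decide the limit. *)
Lemma poisson_defect_le e a : 0 < e -> measurable_fun setT a ->
  (poisson_defect e a <= (8 * pi)%:E * \int[mu]_x (a x ^+ 2)%:E)%E.
Proof.
move=> e0 ma.
have ma2 : measurable_fun setT (fun x => 2 * a x ^+ 2).
  by apply: measurable_funM => //; exact: measurable_funX.
apply: (@le_trans _ _ (\int[mu \x mu]_z
   ((2 * a z.1 ^+ 2 + 2 * a z.2 ^+ 2) * poisson e (z.1 - z.2))%:E)%E).
  apply: ge0_le_integral => //.
  - by move=> z _; exact: defect_ge0.
  - by apply/measurable_EFinP; exact: mdefect.
  - apply/measurable_EFinP; apply: measurable_funM; last exact: measurable_poissonB.
    by apply: measurable_funD;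
      [apply: (measurableT_comp ma2 measurable_fst)|apply: (measurableT_comp ma2 measurable_snd)].
  - move=> z _; rewrite lee_fin ler_wpM2r ?poisson_ge0// -subr_ge0.
    by rewrite (_ : _ - _ = (a z.1 + a z.2) ^+ 2) ?sqr_ge0//; ring.
rewrite (@integral_both_poisson e (fun x => 2 * a x ^+ 2))//; last first.
  by move=> x; rewrite mulr_ge0// sqr_ge0.
under eq_integral do rewrite EFinM.
rewrite ge0_integralZl//; last 2 first.
- by apply/measurable_EFinP; exact: measurable_funX.
- by move=> x _; rewrite lee_fin sqr_ge0.
by rewrite muleA -EFinM (_ : 4 * pi * 2 = 8 * pi)//; ring.
Qed.

Let sqrrB_le (x y u v : R) :
  (x - y) ^+ 2 <= 2 * (u - v) ^+ 2 + 2 * (x - u - (y - v)) ^+ 2.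
Proof.
rewrite -subr_ge0 (_ : _ - _ = (2 * (u - v) - (x - y)) ^+ 2) ?sqr_ge0//.
by ring.
Qed.

Lemma poisson_defect_sub e a g : 0 < e -> measurable_fun setT a -> measurable_fun setT g ->
  (poisson_defect e a <= 2%:E * poisson_defect e g +
                         2%:E * poisson_defect e (fun x => a x - g x)%R)%E.
Proof.
move=> e0 ma mg.
have mag : measurable_fun setT (fun x => a x - g x) by exact: measurable_funB.
rewrite /poisson_defect -!ge0_integralZl//; last 4 first.
- by apply/measurable_EFinP; exact: (mdefect e0 mag).
- by move=> z _; exact: (defect_ge0 (fun x => a x - g x)).
- by apply/measurable_EFinP; exact: mdefect.
- by move=> z _; exact: defect_ge0.
rewrite -ge0_integralD//; last 4 first.
- by move=> z _; rewrite mule_ge0//; exact: (defect_ge0 g).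
- by apply: measurable_funeM; apply/measurable_EFinP; exact: mdefect.
- by move=> z _; rewrite mule_ge0//; exact: (defect_ge0 (fun x => a x - g x)).
- by apply: measurable_funeM; apply/measurable_EFinP; exact: (mdefect e0 mag).
apply: ge0_le_integral => //.
- by move=> z _; exact: defect_ge0.
- by apply/measurable_EFinP; exact: mdefect.
- by apply: emeasurable_funD; apply: measurable_funeM; apply/measurable_EFinP;
    [exact: mdefect|exact: (mdefect e0 mag)].
- move=> z _; rewrite -!EFinM -EFinD lee_fin.
  rewrite [X in _ <= X + _](mulrA 2) [X in _ <= _ + X](mulrA 2) -mulrDl.
  by rewrite ler_wpM2r ?poisson_ge0// sqrrB_le.
Qed.

(** Close to the diagonal uniform continuity makes the squared difference small against a kernel of
    fixed mass; away from it the difference is at most [2 * G] and the kernel is of order [e]. *)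
Lemma poisson_defect_compact g (G N d : R) : continuous g -> (forall x, `|g x| <= G) ->
  0 < N -> (forall x, N < `|x| -> g x = 0) -> 0 < d ->
  exists c, forall e, 0 < e -> (poisson_defect e g <= (d + c * e)%:E)%E.
Proof.
move=> cg gG N0 gN d0.
have mg : measurable_fun setT g by exact: continuous_measurable_fun.
(* The near part is at most [4 pi] times [d1 ^+ 2] times the length [2 * N] of the support interval;
   this choice makes it exactly [d]. *)
pose d1 : R := Num.sqrt (d / (8 * pi * N)).
have dN0 : 0 < d / (8 * pi * N) by rewrite divr_gt0// !mulr_gt0// pi_gt0.
have d10 : 0 < d1 by rewrite sqrtr_gt0.
have [r r0 gr] := heine_compact (segment_compact (a := - N) (b := N)) cg d10.
pose C := (2 * G) ^+ 2 * (1 + (r ^+ 2)^-1).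
exists (8 * pi * N * C) => e e0.
have C0 : 0 <= C by rewrite mulr_ge0 ?sqr_ge0// addr_ge0// invr_ge0 sqr_ge0.
have CE : C = (2 * G) ^+ 2 * (1 + (r ^+ 2)^-1) by [].
clearbody C.
pose K : set R := `[- N, N]%classic.
have mK : measurable K by exact: measurable_itv.
have muK : mu K = (2 * N)%:E.
  rewrite lebesgue_measure_itv/= lte_fin gtrN// -EFinB; congr EFin; ring.
(* A pair contributes only if one of its points lies in [K], and then [\1_K x + \1_K y] is at least
   1. [c1] majorises the near pairs against [poisson e], [c2] the far ones against [poisson 1]. *)
pose c1 (x : R) := d1 ^+ 2 * \1_K x; pose c2 (x : R) := C * e * \1_K x.
have mc1 : measurable_fun setT c1 by apply: measurable_funM.
have mc2 : measurable_fun setT c2 by apply: measurable_funM.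
have i0 x : 0 <= \1_K x :> R by rewrite indicE ler0n.
have c10 x : 0 <= c1 x by rewrite mulr_ge0// sqr_ge0.
have c20 x : 0 <= c2 x by rewrite mulr_ge0// mulr_ge0// ltW.
have mb (c : R -> R) (t : R) : 0 < t -> measurable_fun setT c ->
    measurable_fun setT (fun z : R * R => (c z.1 + c z.2) * poisson t (z.1 - z.2)).
  move=> t0 mc; apply: measurable_funM; last exact: measurable_poissonB.
  by apply: measurable_funD; [exact: (measurableT_comp mc measurable_fst)|
                              exact: (measurableT_comp mc measurable_snd)].
apply: (@le_trans _ _ (\int[mu \x mu]_z
   (((c1 z.1 + c1 z.2) * poisson e (z.1 - z.2))%:E +
    ((c2 z.1 + c2 z.2) * poisson 1 (z.1 - z.2))%:E))%E).
  apply: ge0_le_integral => //.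
  - by move=> z _; exact: defect_ge0.
  - by apply/measurable_EFinP; exact: mdefect.
  - by apply: emeasurable_funD; apply/measurable_EFinP; exact: mb.
  - move=> [x y] _ /=; rewrite -EFinD lee_fin /c1 /c2 -!mulrDr.
    have [|xyK] := pselect (K x \/ K y); last first.
      have gx0 t : ~ K t -> g t = 0.
        move=> Kt; apply: gN; rewrite ltNge; apply/negP => tN; apply: Kt.
        by rewrite /K /= in_itv/= -ler_norml.
      rewrite !gx0; [|by tauto..].
      rewrite subrr expr0n mul0r addr_ge0// mulr_ge0 ?poisson_ge0//.
        by rewrite mulr_ge0 ?sqr_ge0 ?addr_ge0.
      by rewrite mulr_ge0 ?addr_ge0// mulr_ge0// ltW.
    move=> KK; have i1 : 1 <= \1_K x + \1_K y :> R.
      case: KK => k; rewrite !indicE (mem_set k) mulr1n; first by rewrite lerDl ler0n.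
      by rewrite lerDr ler0n.
    set s := \1_K x + \1_K y in i1 *.
    have s0 : 0 <= s by exact: le_trans i1.
    have [xy|xy] := ltP `|x - y| r.
      rewrite (@le_trans _ _ (d1 ^+ 2 * s * poisson e (x - y)))//; last first.
        by rewrite lerDl mulr_ge0 ?poisson_ge0// mulr_ge0// mulr_ge0// ltW.
      rewrite ler_wpM2r ?poisson_ge0// (@le_trans _ _ (d1 ^+ 2))//; last first.
        by rewrite ler_peMr ?sqr_ge0.
      rewrite -(real_normK (num_real (g x - g y))) ler_sqr ?nnegrE ?(ltW d10)//.
      case: KK => k; first by exact: gr.
      by rewrite distrC; apply: gr => //; rewrite distrC.
    rewrite (@le_trans _ _ (C * e * s * poisson 1 (x - y)))//; last first.
      by rewrite lerDr mulr_ge0 ?poisson_ge0// mulr_ge0 ?sqr_ge0.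
    rewrite (@le_trans _ _ (C * e * poisson 1 (x - y)))//; last first.
      by rewrite ler_wpM2r ?poisson_ge0// ler_peMr// mulr_ge0// ltW.
    rewrite CE [leRHS](_ : _ = (2 * G) ^+ 2 *
      (e * (1 + (r ^+ 2)^-1) * poisson 1 (x - y))); last by ring.
    rewrite ler_pM ?sqr_ge0 ?poisson_ge0//; last exact: poisson_far.
    rewrite -(real_normK (num_real (g x - g y))) ler_sqr ?nnegrE//.
      by rewrite (le_trans (ler_normB _ _))// mulr2n mulrDl mul1r lerD.
    by rewrite mulr_ge0// (le_trans (normr_ge0 _) (gG 0)).
rewrite ge0_integralD//; last 4 first.
- by move=> z _; rewrite lee_fin mulr_ge0 ?addr_ge0// poisson_ge0.
- by apply/measurable_EFinP; exact: mb.
- by move=> z _; rewrite lee_fin mulr_ge0 ?addr_ge0// poisson_ge0.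
- by apply/measurable_EFinP; exact: mb.
rewrite !integral_both_poisson//.
have iK t : 0 <= t -> (\int[mu]_x (t * \1_K x)%:E = (t * (2 * N))%:E)%E.
  move=> t0; under eq_integral do rewrite EFinM.
  rewrite ge0_integralZl//; last by apply/measurable_EFinP.
  by rewrite integral_indic// setIT EFinM; congr (_ * _)%E; exact: muK.
rewrite !iK ?sqr_ge0//; last by rewrite mulr_ge0// ltW.
rewrite -!EFinM -EFinD lee_fin /d1 sqr_sqrtr ?(ltW dN0)//.
rewrite le_eqVlt; apply/orP; left; apply/eqP.
have := pi_gt0 R; move: (pi : R) => p p0.
by field; rewrite !gt_eqF.
Qed.

End poisson_defect.

(** * Density of compactly supported continuous functions in L^2 *)

Section plancherel_line.
Context {R : realType}.
Notation mu := (@lebesgue_measure R).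
Implicit Types (a g : R -> R) (e d : R).

(** [clip] truncates values to the interval from [- N] to [N]; [cutoff] is the trapezoid equal to 1
    up to [N] and to 0 beyond [N + 1]. Both are continuous, so they can be applied to a continuous
    approximant. *)
Let clip (N t : R) : R := Num.max (- N) (Num.min N t).
Let cutoff (N x : R) : R := Num.max 0 (Num.min 1 (N + 1 - `|x|)).

Let clip_le N t : 0 <= N -> `|clip N t| <= N.
Proof.
move=> N0; rewrite ler_norml /clip; have [h|h] := leP N t.
  by have [k|k] := leP (- N) N; apply/andP; split; lra.
by have [k|k] := leP (- N) t; apply/andP; split; lra.
Qed.

Let clip_id N t : `|t| <= N -> clip N t = t.
Proof.
by rewrite ler_norml => /andP[t1 t2]; rewrite /clip (min_idPr t2) (max_idPr t1).
Qed.

(** Projection onto an interval brings a point no further from the points of that interval, so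
    clipping an approximant of a bounded function does no harm. *)
Let clip_dist N s t : `|s| <= N -> `|s - clip N t| <= `|s - t|.
Proof.
rewrite ler_norml /clip => /andP[s1 s2].
have [h|h] := leP N t.
  have [k|k] := leP (- N) N; last by lra.
  by rewrite !ler0_norm; lra.
have [k|k] := leP (- N) t; first by [].
by rewrite !ger0_norm; lra.
Qed.

Let clip_norm N t : 0 <= N -> `|t - clip N t| <= `|t|.
Proof.
move=> N0; rewrite /clip; have [h|h] := leP N t.
  have [k|k] := leP (- N) N; last by lra.
  by rewrite !ger0_norm; lra.
have [k|k] := leP (- N) t; first by rewrite subrr normr0.
by rewrite !ler0_norm; lra.
Qed.

Let cutoff_ge0 N x : 0 <= cutoff N x.
Proof. by rewrite le_max lexx. Qed.

Let cutoff_le1 N x : cutoff N x <= 1.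
Proof. by rewrite ge_max ler01 ge_min lexx. Qed.

Let cutoff1 N x : `|x| <= N -> cutoff N x = 1.
Proof.
move=> xN; rewrite /cutoff (min_idPl _) ?(max_idPr _)//.
by rewrite lerBrDr addrC lerD2r.
Qed.

Let cutoff0 N x : N + 1 < `|x| -> cutoff N x = 0.
Proof.
by move=> xN; apply/max_idPl; rewrite ge_min; apply/orP; right; rewrite subr_le0 ltW.
Qed.

Let continuous_clip N : continuous (clip N).
Proof.
move=> t; apply: (@continuous_max _ _ (cst (- N)) (fun t => Num.min N t)).
  exact: cst_continuous.
by apply: (@continuous_min _ _ (cst N) id) => //; exact: cst_continuous.
Qed.

Let continuous_cutoff N : continuous (cutoff N).
Proof.
move=> x; apply: (@continuous_max _ _ (cst 0) (fun x => Num.min 1 (N + 1 - `|x|))).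
  exact: cst_continuous.
apply: (@continuous_min _ _ (cst 1) (fun x => N + 1 - `|x|)); first exact: cst_continuous.
by apply: cvgB; [exact: cvg_cst|exact: norm_continuous].
Qed.

Let measurable_clip N a : measurable_fun setT a ->
  measurable_fun setT (fun x => clip N (a x)).
Proof.
move=> ma; apply: (@measurableT_comp _ _ _ _ _ _ (clip N)) => //.
by apply: continuous_measurable_fun; exact: continuous_clip.
Qed.

(** Truncation in value and in space converges in L^2 by dominated convergence. The truncated
    function is bounded on a bounded interval, where continuous functions approximate it in L^1;
    once the approximant is clipped at the same level [N], the squared error is at most [2 * N]
    times the L^1 error. *)
Lemma dense_compact_continuous_L2 a d : measurable_fun setT a ->
  (\int[mu]_x (a x ^+ 2)%:E < +oo)%E -> 0 < d ->
  exists g, [/\ continuous g, exists G, forall x, `|g x| <= G,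
    exists2 N, 0 < N & forall x, N < `|x| -> g x = 0 &
    (\int[mu]_x ((a x - g x) ^+ 2)%:E <= d%:E)%E].
Proof.
move=> ma a2 d0.
pose b (n : nat) x := clip n%:R (a x) * cutoff n%:R x.
have mb n : measurable_fun setT (b n).
  apply: measurable_funM; first exact: measurable_clip.
  by apply: continuous_measurable_fun; exact: continuous_cutoff.
have ia2 : mu.-integrable setT (EFin \o (fun x => a x ^+ 2)).
  by apply: ge0_integrable => //; [exact: measurable_funX|move=> x; rewrite sqr_ge0].
have : (\int[mu]_x ((a x - b n x) ^+ 2)%:E @[n --> \oo] --> \int[mu]_x (cst 0 x))%E.
  pose F (n : nat) x := ((a x - b n x) ^+ 2)%:E.
  have mF n : measurable_fun setT (F n).
    by apply/measurable_EFinP; apply: measurable_funX; exact: measurable_funB.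
  have cF : {ae mu, forall x, setT x -> F n x @[n --> \oo] --> cst 0%E x}.
    apply/aeW => x _; apply: cvg_near_cst.
    have [N [aN xN]] : exists N : nat, `|a x| <= N%:R /\ `|x| <= N%:R.
      exists (Num.bound (`|a x| + `|x|)).
      have h := archi_boundP (addr_ge0 (normr_ge0 (a x)) (normr_ge0 x)).
      by split; rewrite (le_trans _ (ltW h))// ?lerDl ?lerDr.
    exists N => // n /= Nn; have Nn' : N%:R <= n%:R :> R by rewrite ler_nat.
    rewrite /F /b clip_id ?cutoff1 ?(le_trans xN)// ?(le_trans aN)//.
    by rewrite mulr1 subrr expr0n.
  have dF : {ae mu, forall x n, setT x -> (`|F n x| <= (a x ^+ 2)%:E)%E}.
    apply/aeW => x n _ /=; rewrite lee_fin ger0_norm ?sqr_ge0//.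
    rewrite -(real_normK (num_real (a x - _))) -(real_normK (num_real (a x))).
    rewrite ler_sqr ?nnegrE// /b.
    (* A convex combination of two numbers, neither exceeding [a x] in modulus. *)
    rewrite (_ : _ - _ = cutoff n%:R x * (a x - clip n%:R (a x)) + (1 - cutoff n%:R x) * a x);
      last by ring.
    have u0 := cutoff_ge0 n%:R x; have u1 := cutoff_le1 n%:R x.
    have v0 : 0 <= 1 - cutoff n%:R x by rewrite subr_ge0.
    rewrite (le_trans (ler_normD _ _))// !normrM (ger0_norm u0) (ger0_norm v0).
    have hc : `|a x - clip n%:R (a x)| <= `|a x| by exact: clip_norm.
    rewrite (le_trans (lerD (ler_wpM2l u0 hc) (lexx _)))//.
    by rewrite -mulrDl addrC subrK mul1r.
  by have [] := @dominated_convergence _ _ _ mu setT measurableT F (cst 0%E) _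
    mF (measurable_cst _) cF ia2 dF.
(* The squared triangle inequality doubles each error. The truncation error [d / 4] becomes [d / 2],
   and below the L^1 error [d / (8 * N)], multiplied by [2 * N] and doubled, is again [d / 2]. *)
rewrite integral0 => /fine_cvgP[bfin /cvgrPdist_lt/(_ (d / 4))].
rewrite divr_gt0// => /(_ isT) bd.
have [n [n0 bn]] : exists n : nat, (0 < n)%N /\
    (\int[mu]_x ((a x - b n x) ^+ 2)%:E < (d / 4)%:E)%E.
  near \oo => n; exists n; split; first by near: n; exact: nbhs_infty_gt.
  have fn : (\int[mu]_x ((a x - b n x) ^+ 2)%:E)%E \is a fin_num by near: n.
  rewrite -(fineK fn) lte_fin.
  have : `|0 - fine (\int[mu]_x ((a x - b n x) ^+ 2)%:E)%E| < d / 4 by near: n.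
  by rewrite sub0r normrN; apply: le_lt_trans; rewrite ler_norm.
pose N : R := n%:R; have N0 : 0 < N by rewrite ltr0n.
pose E : set R := `[- (N + 1), N + 1]%classic.
have mE : measurable E by exact: measurable_itv.
have Efin : (mu E < +oo)%E.
  by rewrite lebesgue_measure_itv/=; case: ifP => _; rewrite ?ltry// -EFinB ltry.
pose f x := clip N (a x).
have mf : measurable_fun setT f by exact: measurable_clip.
have fN x : `|f x| <= N by rewrite clip_le// ltW.
have fi : mu.-integrable E (EFin \o f).
  apply: measurable_bounded_integrable => //; first exact: measurable_funTS.
  exists N; split; first exact: num_real.
  by move=> M NM x _ /=; rewrite (le_trans (fN x))// ltW.
have [g_ [cg gi]] := approximation_continuous_integrable mE Efin fi.
move=> /fine_cvgP[gfin /cvgrPdist_lt/(_ (d / (8 * N)))].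
rewrite divr_gt0// ?mulr_gt0// => /(_ isT) gd.
have [k gk] : exists k, (\int[mu]_(x in E) `|(f x - g_ k x)%:E| < (d / (8 * N))%:E)%E.
  near \oo => k; exists k.
  have fk : (\int[mu]_(x in E) `|(f x - g_ k x)%:E|)%E \is a fin_num by near: k.
  rewrite -(fineK fk) lte_fin.
  have : `|0 - fine (\int[mu]_(x in E) `|(f x - g_ k x)%:E|)%E| < d / (8 * N) by near: k.
  by rewrite sub0r normrN; apply: le_lt_trans; rewrite ler_norm.
pose g x := clip N (g_ k x) * cutoff N x.
have cgg : continuous g.
  move=> x; apply: cvgM; last exact: continuous_cutoff.
  by apply: (@continuous_comp _ _ _ (g_ k) (clip N)); [exact: cg|exact: continuous_clip].
have mg : measurable_fun setT g by exact: continuous_measurable_fun.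
exists g; split => //.
- exists N => x; rewrite normrM (ger0_norm (cutoff_ge0 _ _)).
  by rewrite (le_trans _ (clip_le (g_ k x) (ltW N0)))// ler_piMr.
- exists (N + 1); first by rewrite addr_gt0.
  by move=> x Nx; rewrite /g cutoff0 ?mulr0.
pose h x := 2 * N * (`|f x - g_ k x| * \1_E x).
have mh : measurable_fun setT h.
  apply: measurable_funM => //; apply: measurable_funM => //.
  apply: measurableT_comp => //; apply: measurable_funB => //.
  by apply: continuous_measurable_fun.
have bgh x : (b n x - g x) ^+ 2 <= h x.
  rewrite /h indicE; have [xE|xE] := boolP (x \in E); last first.
    rewrite /b /g cutoff0 ?mulr0 ?subrr ?expr0n//.
    by move: xE; apply: contraNT; rewrite -leNgt ler_norml inE /E /= in_itv.
  rewrite mulr1 /b /g -/(f x) -mulrBl exprMn.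
  rewrite (@le_trans _ _ ((f x - clip N (g_ k x)) ^+ 2))//.
    by rewrite ler_piMr ?sqr_ge0// exprn_ile1.
  rewrite -(real_normK (num_real (f x - clip N (g_ k x)))) expr2 ler_pM//.
    rewrite (le_trans (ler_normB _ _))// (_ : 2 * N = N + N); last by ring.
    by rewrite lerD// clip_le// ltW.
  exact: clip_dist.
have mab2 : measurable_fun setT (fun x => (a x - b n x) ^+ 2).
  by apply: measurable_funX; exact: measurable_funB.
have mab : measurable_fun setT (fun x => 2 * (a x - b n x) ^+ 2).
  exact: measurable_funM.
apply: (@le_trans _ _ (\int[mu]_x ((2 * (a x - b n x) ^+ 2)%:E + (2 * h x)%:E))%E).
  apply: ge0_le_integral => //.
  - by move=> x _; rewrite lee_fin sqr_ge0.
  - by apply/measurable_EFinP; apply: measurable_funX; exact: measurable_funB.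
  - apply: emeasurable_funD; apply/measurable_EFinP => //.
    exact: measurable_funM.
  - move=> x _; rewrite -EFinD lee_fin.
    rewrite (@le_trans _ _ (2 * (a x - b n x) ^+ 2 + 2 * (b n x - g x) ^+ 2))//.
      rewrite -subr_ge0 (_ : _ - _ = (a x - b n x - (b n x - g x)) ^+ 2) ?sqr_ge0//.
      by ring.
    by rewrite lerD2l ler_pM2l.
have h0 x : 0 <= h x.
  by rewrite (le_trans _ (bgh x))// sqr_ge0.
rewrite ge0_integralD//; last 4 first.
- by move=> x _; rewrite lee_fin mulr_ge0// sqr_ge0.
- exact/measurable_EFinP.
- by move=> x _; rewrite lee_fin mulr_ge0.
- by apply/measurable_EFinP; exact: measurable_funM.
rewrite [leRHS](_ : _ = (2 * (d / 4))%:E + (2 * (2 * N * (d / (8 * N))))%:E)%E; last first.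
  by rewrite -EFinD; congr EFin; field; rewrite gt_eqF.
rewrite leeD//.
  under eq_integral do rewrite EFinM.
  rewrite ge0_integralZl//; last 2 first.
  - exact/measurable_EFinP.
  - by move=> x _; rewrite lee_fin sqr_ge0.
  by rewrite EFinM lee_pmul2l// ltW.
have mfE : measurable_fun setT (fun x => `|f x - g_ k x| * \1_E x).
  apply: measurable_funM => //; apply: measurableT_comp => //; apply: measurable_funB => //.
  exact: continuous_measurable_fun.
have fE0 x : 0 <= `|f x - g_ k x| * \1_E x by rewrite mulr_ge0// indicE ler0n.
under eq_integral do rewrite EFinM (EFinM (2 * N)).
rewrite ge0_integralZl//; last 2 first.
- by apply: measurable_funeM; exact/measurable_EFinP.
- by move=> x _; rewrite mule_ge0 ?lee_fin ?fE0// mulr_ge0// ltW.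
rewrite ge0_integralZl//.
rewrite [leRHS]EFinM lee_pmul2l// [leRHS]EFinM lee_pmul2l ?lte_fin ?mulr_gt0//.
rewrite integral_mkcond in gk; rewrite (le_trans _ (ltW gk))//.
rewrite le_eqVlt; apply/orP; left; apply/eqP; apply: eq_integral => x _.
by rewrite patchE indicE; case: (x \in E); rewrite ?mulr1 ?mulr0.
Unshelve. all: try by end_near.
- exact/measurable_EFinP.
- by rewrite lee_fin mulr_ge0// ltW.
Qed.

End plancherel_line.

(** * Plancherel's identity for real functions on the line *)

Section plancherel_line_real.
Context {R : realType}.
Notation mu := (@lebesgue_measure R).
Variable a : R -> R.
Hypothesis ai : mu.-integrable setT (EFin \o a).
Hypothesis a2i : mu.-integrable setT (EFin \o (fun x => a x ^+ 2)).

Let ma : measurable_fun setT a.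
Proof. by apply/measurable_EFinP; exact: measurable_int ai. Qed.

Let A2 := Rintegral mu setT (fun x => a x ^+ 2).

(** The two square terms each contribute the mass [2 * pi] of the kernel. The cross term is
    absolutely integrable because [a] is in L^1 and the kernel is bounded by [2 / e], which allows
    the two to be separated. *)
Lemma poisson_defectE (e : R) : 0 < e ->
  poisson_defect e a = (4 * pi * A2 -
    2 * Rintegral mu setT (fun xi => expw e xi * (cosT a xi ^+ 2 + sinT a xi ^+ 2)))%:E.
Proof.
move=> e0; rewrite Rintegral_expw_sqr_transform//.
pose h1 (z : R * R) := (a z.1 ^+ 2 + a z.2 ^+ 2) * poisson e (z.1 - z.2).
pose h2 (z : R * R) := a z.1 * a z.2 * poisson e (z.1 - z.2).
have ma2 : measurable_fun setT (fun x => a x ^+ 2) by exact: measurable_funX.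
have mh1 : measurable_fun setT h1.
  apply: measurable_funM; last exact: measurable_poissonB.
  by apply: measurable_funD; [exact: (measurableT_comp ma2 measurable_fst)|
                              exact: (measurableT_comp ma2 measurable_snd)].
have h1E : (\int[mu \x mu]_z (h1 z)%:E = (4 * pi * A2)%:E)%E.
  rewrite (@integral_both_poisson R e (fun x => a x ^+ 2))//; last by move=> x; rewrite sqr_ge0.
  by rewrite integral_EFin_Rintegral// -EFinM.
have h1i : (mu \x mu)%E.-integrable setT (EFin \o h1).
  apply: ge0_integrable => //; last by rewrite h1E ltry.
  by move=> z; rewrite mulr_ge0 ?addr_ge0 ?sqr_ge0 ?poisson_ge0.
have h2i : (mu \x mu)%E.-integrable setT (EFin \o h2).
  apply: (integrable_prod_bounded ai ai (B := 2 / e)); first exact: measurable_poissonB.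
  by move=> z; rewrite ger0_norm ?poisson_ge0// poisson_le.
rewrite /poisson_defect.
transitivity (\int[mu \x mu]_z (h1 z - 2 * h2 z)%:E)%E.
  by apply: eq_integral => z _; congr EFin; rewrite /h1 /h2; ring.
rewrite integral_EFin_Rintegral; last exact: integrable_EFinB h1i (integrable_EFinZl 2 h2i).
congr EFin; rewrite RintegralB//; last exact: integrable_EFinZl.
rewrite RintegralZl//; congr (_ - _ * _).
  by apply: EFin_inj; rewrite -integral_EFin_Rintegral.
rewrite {1}/Rintegral -(integral12_prod_meas1 h2i) /fubini_F /= {1}/Rintegral; congr fine.
apply: eq_integral => x _.
have ip : mu.-integrable setT (EFin \o (fun y => a y * poisson e (x - y))).
  apply: (integrable_bounded_mul ai (B := 2 / e)).
    by apply: continuous_measurable_fun; exact: continuous_poisson.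
  by move=> y; rewrite ger0_norm ?poisson_ge0// poisson_le.
rewrite -RintegralZl// -integral_EFin_Rintegral; last exact: integrable_EFinZl.
by apply: eq_integral => y _; rewrite /h2 /= mulrA.
Qed.

Lemma poisson_defect_to0 (d : R) : 0 < d ->
  exists2 r, 0 < r & forall e, 0 < e -> e < r -> (poisson_defect e a <= d%:E)%E.
Proof.
move=> d0.
have p0 := pi_gt0 R.
have a2y : (\int[mu]_x (a x ^+ 2)%:E < +oo)%E by rewrite integral_EFin_Rintegral// ltry.
(* With the uniform constant [8 * pi] the remainder [a - g] has defect at most [d / 4], doubled to
   [d / 2]. The other half goes to [g]: [d / 8] from the diagonal and [d / 8] from [c * e] with [e]
   small, again doubled. *)
have dp : 0 < d / (32 * pi) by rewrite divr_gt0// mulr_gt0.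
have [g [cg [G gG] [N N0 gN] ag]] := dense_compact_continuous_L2 ma a2y dp.
have [c cP] := poisson_defect_compact cg gG N0 gN (divr_gt0 d0 (ltr0n R 8)).
have c0 : 0 < `|c| + 1 by rewrite ltr_pwDr.
exists (d / (8 * (`|c| + 1))); first by rewrite divr_gt0// mulr_gt0.
move=> e e0 er.
have mg : measurable_fun setT g by exact: continuous_measurable_fun.
apply: (le_trans (poisson_defect_sub e0 ma mg)).
rewrite [leRHS](_ : _ = (2 * (d / 4))%:E + (2 * (d / 4))%:E)%E; last first.
  by rewrite -EFinD; congr EFin; field.
rewrite leeD// EFinM lee_pmul2l//.
  apply: (le_trans (cP e e0)); rewrite lee_fin.
  rewrite (_ : d / 4 = d / 8 + d / 8); last by field.
  rewrite lerD2l; apply: (@le_trans _ _ ((`|c| + 1) * e)).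
    by rewrite ler_wpM2r ?(ltW e0)// (le_trans (ler_norm c))// lerDl.
  rewrite -ler_pdivlMl// (le_trans (ltW er))// le_eqVlt; apply/orP; left; apply/eqP.
  by field; rewrite gt_eqF.
have mag : measurable_fun setT (fun x => a x - g x) by exact: measurable_funB.
apply: (le_trans (poisson_defect_le e0 mag)).
apply: (@le_trans _ _ ((8 * pi)%:E * (d / (32 * pi))%:E)%E).
  by rewrite lee_pmul2l ?lte_fin ?mulr_gt0.
rewrite -EFinM lee_fin le_eqVlt; apply/orP; left; apply/eqP.
move: p0; move: (pi : R) => p p0.
by field; rewrite gt_eqF.
Qed.

(** The weighted integrals have two limits along [e = 1 / (n + 1)]: the weights increase to 1, so
    monotone convergence gives the full integral, finite or not, while the vanishing defect gives
    [2 pi |a|^2]. *)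
Lemma integral_sqr_cosT_sinT :
  (\int[mu]_xi (cosT a xi ^+ 2 + sinT a xi ^+ 2)%:E = (2 * pi * A2)%:E)%E.
Proof.
pose T xi := cosT a xi ^+ 2 + sinT a xi ^+ 2.
have mT : measurable_fun setT T.
  by apply: measurable_funD; apply: measurable_funX;
    [exact: measurable_cosT|exact: measurable_sinT].
have T0 xi : 0 <= T xi by rewrite addr_ge0 ?sqr_ge0.
pose e_ (n : nat) : R := n.+1%:R^-1.
have e0 n : 0 < e_ n by rewrite invr_gt0 ltr0n.
pose f (n : nat) xi := (expw (e_ n) xi * T xi)%:E.
have mf n : measurable_fun setT (f n).
  by apply/measurable_EFinP; apply: measurable_funM => //; exact: measurable_expw.
have fi n : mu.-integrable setT (EFin \o (fun xi => expw (e_ n) xi * T xi)).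
  apply: (integrable_bounded_mul (integrable_expw (e0 n))) => // xi.
  by rewrite ger0_norm//; exact: sqr_cosT_sinT_le.
have cvT xi : f n xi @[n --> \oo] --> (T xi)%:E.
  apply/fine_cvgP; split; first exact: nearW.
  rewrite /f /= -[T xi in X in _ --> X]mul1r; apply: cvgM; last exact: cvg_cst.
  rewrite -(expR0 R) /expw.
  apply: (@cvg_comp _ _ _ (fun n => - (e_ n * `|xi|)) (@expR R)); last exact: continuous_expR.
  rewrite -oppr0; apply: cvgN; rewrite -(mul0r `|xi|); apply: cvgM; last exact: cvg_cst.
  exact: cvg_harmonic.
have c1 : (\int[mu]_xi f n xi @[n --> \oo] --> \int[mu]_xi (T xi)%:E)%E.
  rewrite (_ : (fun xi => (T xi)%:E) = (fun xi => limn (f^~ xi))); last first.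
    by apply/funext => xi; apply/esym/cvg_lim => //; exact: cvT.
  apply: cvg_monotone_convergence => //.
    by move=> n xi _; rewrite lee_fin mulr_ge0// expw_ge0.
  move=> xi _ n k nk; rewrite lee_fin ler_wpM2r// ler_expR lerN2 ler_wpM2r//.
  by rewrite lef_pV2 ?posrE// ler_nat.
have c2 : (\int[mu]_xi f n xi @[n --> \oo] --> (2 * pi * A2)%:E)%E.
  have fE n : (\int[mu]_xi f n xi = (Rintegral mu setT (fun xi => expw (e_ n) xi * T xi))%:E)%E.
    by rewrite integral_EFin_Rintegral.
  under eq_fun do rewrite fE.
  apply: cvg_EFin; first exact: nearW.
  apply/cvgrPdist_le => d d0.
  have [r r0 rP] := poisson_defect_to0 d0.
  near=> n.
  have en : e_ n < r.
    near: n; have /cvgrPdist_lt/(_ r r0) := @cvg_harmonic R.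
    apply: filterS => n; rewrite sub0r normrN ger0_norm//.
    by rewrite invr_ge0 ler0n.
  have := rP _ (e0 n) en; rewrite poisson_defectE// lee_fin -/(T _).
  have : (0 <= poisson_defect (e_ n) a)%E.
    by apply: integral_ge0 => z _; rewrite lee_fin mulr_ge0 ?sqr_ge0// poisson_ge0.
  rewrite poisson_defectE// lee_fin.
  rewrite (_ : 4 * pi * A2 = 2 * (2 * pi * A2)); last by ring.
  rewrite /=; set s := Rintegral mu setT _; set t := 2 * pi * A2; move=> h1 h2.
  by rewrite ler_norml; apply/andP; split; lra.
by rewrite -(cvg_lim _ c2)// -(cvg_lim _ c1).
Unshelve. all: by end_near. Qed.

End plancherel_line_real.

(** * Plancherel's identity for complex functions on the line *)

Section plancherel_line_complex.
Context {R : realType}.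
Notation mu := (@lebesgue_measure R).

Lemma ge0_integral_reflection (f : R -> R) : measurable_fun setT f -> (forall x, 0 <= f x) ->
  (\int[mu]_x (f (- x))%:E = \int[mu]_x (f x)%:E)%E.
Proof.
move=> mf f0.
have mN : measurable_fun setT (-%R : measurableTypeR R -> measurableTypeR R).
  exact: oppr_measurable.
transitivity (\int[pushforward mu (-%R : _ -> measurableTypeR R)]_x (f x)%:E)%E.
  rewrite (ge0_integral_pushforward mN)//; last by move=> x _; rewrite lee_fin.
  by apply/measurable_EFinP; exact: mf.
by apply: eq_measure_integral => //= A mA _; rewrite lebesgue_measureN.
Qed.

Lemma cosTN (a : R -> R) xi : cosT a (- xi) = cosT a xi.
Proof. by apply: eq_Rintegral => x _; rewrite mulrN cosN. Qed.

Lemma sinTN (a : R -> R) xi : mu.-integrable setT (EFin \o a) ->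
  sinT a (- xi) = - sinT a xi.
Proof.
move=> ai; rewrite -[RHS]mulN1r /sinT -RintegralZl//.
  by apply: eq_Rintegral => x _; rewrite mulrN sinN; ring.
by apply: integrable_mul_sin => //; exact: measurable_funM.
Qed.

(** The integrand is the squared modulus of the transform of [a + i b]. Beyond the real and
    imaginary contributions it contains cross terms [cosT a * sinT b - cosT b * sinT a], which are
    odd in [xi]. *)
Lemma plancherel_line (a b : R -> R) :
  mu.-integrable setT (EFin \o a) -> mu.-integrable setT (EFin \o b) ->
  mu.-integrable setT (EFin \o (fun x => a x ^+ 2)) ->
  mu.-integrable setT (EFin \o (fun x => b x ^+ 2)) ->
  (\int[mu]_xi ((cosT a xi + sinT b xi) ^+ 2 + (cosT b xi - sinT a xi) ^+ 2)%:E =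
   (2 * pi)%:E * \int[mu]_x (a x ^+ 2 + b x ^+ 2)%:E)%E.
Proof.
move=> ai bi a2i b2i.
have mca := measurable_cosT ai; have msa := measurable_sinT ai.
have mcb := measurable_cosT bi; have msb := measurable_sinT bi.
pose H (xi : R) := (cosT a xi + sinT b xi) ^+ 2 + (cosT b xi - sinT a xi) ^+ 2.
pose Ta (xi : R) := cosT a xi ^+ 2 + sinT a xi ^+ 2.
pose Tb (xi : R) := cosT b xi ^+ 2 + sinT b xi ^+ 2.
have mH : measurable_fun setT H.
  by apply: measurable_funD; apply: measurable_funX;
    [exact: measurable_funD|exact: measurable_funB].
have mTa : measurable_fun setT Ta by apply: measurable_funD; exact: measurable_funX.
have mTb : measurable_fun setT Tb by apply: measurable_funD; exact: measurable_funX.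
have H0 x : 0 <= H x by rewrite addr_ge0 ?sqr_ge0.
have mHN : measurable_fun setT (fun x : R => H (- x)) by exact: measurableT_comp.
have Ta0 x : 0 <= Ta x by rewrite addr_ge0 ?sqr_ge0.
have Tb0 x : 0 <= Tb x by rewrite addr_ge0 ?sqr_ge0.
(* Adding the reflected integrand cancels the odd cross terms pointwise, so only nonnegative
   functions are ever integrated. *)
have sumH : (\int[mu]_x (H x)%:E + \int[mu]_x (H x)%:E =
   2%:E * (\int[mu]_x (Ta x)%:E + \int[mu]_x (Tb x)%:E))%E.
  have D (f g : R -> R) : measurable_fun setT f -> measurable_fun setT g ->
      (forall x, 0 <= f x) -> (forall x, 0 <= g x) ->
      (\int[mu]_x (f x)%:E + \int[mu]_x (g x)%:E = \int[mu]_x (f x + g x)%:E)%E.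
    move=> mf mg f0 g0; rewrite -ge0_integralD//.
    - by move=> x _; rewrite lee_fin.
    - by apply/measurable_EFinP; exact: mf.
    - by move=> x _; rewrite lee_fin.
    - by apply/measurable_EFinP; exact: mg.
  rewrite -[X in (_ + X = _)%E]ge0_integral_reflection// !D// -ge0_integralZl//.
  - apply: eq_integral => x _; rewrite -EFinM /H !cosTN !sinTN//; congr EFin.
    by rewrite /Ta /Tb; ring.
  - by apply/measurable_EFinP; exact: measurable_funD.
  - by move=> x _; rewrite lee_fin addr_ge0.
move: sumH; rewrite !integral_sqr_cosT_sinT// -EFinD -EFinM => sumH.
have ia : (\int[mu]_x (a x ^+ 2 + b x ^+ 2)%:E =
    (Rintegral mu setT (fun x => a x ^+ 2) + Rintegral mu setT (fun x => b x ^+ 2))%:E)%E.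
  rewrite -RintegralD// integral_EFin_Rintegral//.
  exact: integrable_EFinD a2i b2i.
rewrite ia; move: sumH; rewrite -/(H _).
have : (0 <= \int[mu]_x (H x)%:E)%E by apply: integral_ge0 => x _; rewrite lee_fin.
case: (\int[mu]_x (H x)%:E)%E => //= r _; rewrite -EFinD -EFinM => -[] h; congr EFin.
have -> : r = (r + r) / 2 by field.
by rewrite h; field.
Qed.

End plancherel_line_complex.

(** * Integrating out the first variable of a product *)

Section partial_integral.
Context d1 d2 (X : measurableType d1) (Y : measurableType d2) (R : realType).
Variables (m1 : {sigma_finite_measure set X -> \bar R})
          (m2 : {sigma_finite_measure set Y -> \bar R}).
Variable k : X * Y -> R.
Hypothesis ki : (m1 \x m2)%E.-integrable setT (EFin \o k).

Let K y := Rintegral m1 setT (fun x => k (x, y)).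

Let mk : measurable_fun setT k.
Proof. by apply/measurable_EFinP; exact: measurable_int ki. Qed.

Lemma measurable_fun_Rintegral_fst : measurable_fun setT K.
Proof.
have := @measurable_fun_Rintegral_snd _ _ _ _ _ m1 (k \o (fun z => (z.2, z.1))).
apply; apply: measurableT_comp => //.
exact: measurable_fun_pair.
Qed.

Lemma integrable_Rintegral_fst : m2.-integrable setT (EFin \o K).
Proof.
apply/integrableP; split; first by apply/measurable_EFinP; exact: measurable_fun_Rintegral_fst.
have mk1 := measurable_int _ ki.
apply: le_lt_trans ((integrable21ltyP _ _ mk1).1 ki).
apply: ge0_le_integral => //.
- by do 2 apply: measurableT_comp => //; exact: measurable_fun_Rintegral_fst.
- apply: (measurable_fun_fubini_tonelli_G (abse \o (EFin \o k))) => //=.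
  exact: measurableT_comp.
- move=> y _; apply: le_trans (le_abse_integral _ _ _) => //.
    (* [fine] sends infinite values to 0, so the estimate also holds on slices that are not
       integrable. *)
    by rewrite /K /Rintegral /=; case: (\int[_]_x _)%E => [r||] //=; rewrite leey.
  by apply/measurable_EFinP; exact: measurable_fun_pair1.
Qed.

Lemma Rintegral_prod_fst : Rintegral (m1 \x m2)%E setT k = Rintegral m2 setT K.
Proof.
rewrite {1}/Rintegral -(integral21_prod_meas1 ki) {1}/Rintegral; congr fine.
apply: ae_eq_integral => //.
- exact: (measurable_fubini_G ki).
- by apply/measurable_EFinP; exact: measurable_fun_Rintegral_fst.
- apply: filterS (ae_integrable2 ki) => y iy _.
  by rewrite /fubini_G integral_EFin_Rintegral.
Qed.

End partial_integral.

(** * Plancherel's theorem in R^n *)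

Section fourier_rV.
Context {R : realType}.

(** Together with [ft_im], the real and imaginary parts of the integral of
    [exp (- i x . xi) (a + i b)]. *)
Definition ft_re n (a b : 'rV[R]_n -> R) (xi : 'rV[R]_n) : R :=
  Rintegral (lebesgue_rV R n) setT (fun x => a x * cos (dotR x xi) + b x * sin (dotR x xi)).

Definition ft_im n (a b : 'rV[R]_n -> R) (xi : 'rV[R]_n) : R :=
  Rintegral (lebesgue_rV R n) setT (fun x => b x * cos (dotR x xi) - a x * sin (dotR x xi)).

Lemma measurable_dotR d (T : measurableType d) n (f g : T -> 'rV[R]_n) :
  measurable_fun setT f -> measurable_fun setT g ->
  measurable_fun setT (fun x => dotR (f x) (g x)).
Proof.
move=> mf mg; apply: measurable_sum => i; apply: measurable_funM.
- exact: (measurableT_comp (measurable_rV_coord i) mf).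
- exact: (measurableT_comp (measurable_rV_coord i) mg).
Qed.

Lemma measurable_ft_re n (a b : 'rV[R]_n -> R) :
  measurable_fun setT a -> measurable_fun setT b -> measurable_fun setT (ft_re a b).
Proof.
move=> ma mb.
apply: (@measurable_fun_Rintegral_snd _ _ _ _ _ (lebesgue_rV R n)
  (fun z => a z.2 * cos (dotR z.2 z.1) + b z.2 * sin (dotR z.2 z.1))).
apply: measurable_funD; apply: measurable_funM.
- exact: (measurableT_comp ma measurable_snd).
- by apply: measurable_cos; apply: measurable_dotR.
- exact: (measurableT_comp mb measurable_snd).
- by apply: measurable_sin; apply: measurable_dotR.
Qed.

Lemma measurable_ft_im n (a b : 'rV[R]_n -> R) :
  measurable_fun setT a -> measurable_fun setT b -> measurable_fun setT (ft_im a b).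
Proof.
move=> ma mb.
apply: (@measurable_fun_Rintegral_snd _ _ _ _ _ (lebesgue_rV R n)
  (fun z => b z.2 * cos (dotR z.2 z.1) - a z.2 * sin (dotR z.2 z.1))).
apply: measurable_funB; apply: measurable_funM.
- exact: (measurableT_comp mb measurable_snd).
- by apply: measurable_cos; apply: measurable_dotR.
- exact: (measurableT_comp ma measurable_snd).
- by apply: measurable_sin; apply: measurable_dotR.
Qed.

Section rV_succ.
Variable n : nat.
Notation mu := (@lebesgue_measure R).
Notation nu := (lebesgue_rV R n).

Lemma dotR_rV_cons (p q : R * 'rV[R]_n) :
  dotR (rV_cons p) (rV_cons q) = p.1 * q.1 + dotR p.2 q.2.
Proof.
rewrite /dotR big_ord_recl /rV_cons; congr (_ * _ + _).
- rewrite (_ : ord0 = lshift n (ord0 : 'I_1)); last exact: val_inj.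
  exact: etrans (row_mxEl _ _ _ _) (mxE _ _ _ _).
- rewrite (_ : ord0 = lshift n (ord0 : 'I_1)); last exact: val_inj.
  exact: etrans (row_mxEl _ _ _ _) (mxE _ _ _ _).
- apply: eq_bigr => i _.
  rewrite (_ : lift ord0 i = rshift 1 i); last exact: val_inj.
  by congr (_ * _); exact: row_mxEr.
Qed.

Lemma ge0_integral_rV_cons (f : 'rV[R]_n.+1 -> \bar R) :
  measurable_fun setT f -> (forall x, 0 <= f x)%E ->
  (\int[lebesgue_rV R n.+1]_x f x = \int[mu \x nu]_p f (rV_cons p))%E.
Proof.
move=> mf f0.
by rewrite -[RHS](ge0_integral_pushforward (@measurable_rV_cons R n) _ (D := setT)).
Qed.

Lemma integrable_rV_cons (f : 'rV[R]_n.+1 -> R) :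
  (lebesgue_rV R n.+1).-integrable setT (EFin \o f) ->
  (mu \x nu)%E.-integrable setT (EFin \o (fun p => f (rV_cons p))).
Proof.
move=> fi; have mf := measurable_int _ fi.
apply/integrableP; split; first exact: (measurableT_comp mf (@measurable_rV_cons R n)).
rewrite -(@ge0_integral_rV_cons (abse \o (EFin \o f))).
- by case/integrableP: fi.
- exact: measurableT_comp.
- by move=> x; exact: abse_ge0.
Qed.

Lemma Rintegral_rV_cons (f : 'rV[R]_n.+1 -> R) :
  (lebesgue_rV R n.+1).-integrable setT (EFin \o f) ->
  Rintegral (lebesgue_rV R n.+1) setT f = Rintegral (mu \x nu)%E setT (fun p => f (rV_cons p)).
Proof.
move=> fi; have mf := measurable_int _ fi.
rewrite /Rintegral; congr fine.
have := @integral_pushforward _ _ _ _ R _ (@measurable_rV_cons R n) (mu \x nu)%E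
  setT (EFin \o f) mf.
by apply => //; exact: integrable_rV_cons.
Qed.

Lemma integrable_ft_integrand d (T : measurableType d) (m : {measure set T -> \bar R})
    (a b f : T -> R) :
  m.-integrable setT (EFin \o a) -> m.-integrable setT (EFin \o b) -> measurable_fun setT f ->
  m.-integrable setT (EFin \o (fun x => a x * cos (f x) + b x * sin (f x))) /\
  m.-integrable setT (EFin \o (fun x => b x * cos (f x) - a x * sin (f x))).
Proof.
move=> ai bi mf; split.
- apply: integrable_EFinD; [exact: integrable_mul_cos|exact: integrable_mul_sin].
- apply: integrable_EFinB; [exact: integrable_mul_cos|exact: integrable_mul_sin].
Qed.

Section partial_transform.
Variables a b : R * 'rV[R]_n -> R.
Hypotheses (ai : (mu \x nu)%E.-integrable setT (EFin \o a))
           (bi : (mu \x nu)%E.-integrable setT (EFin \o b)).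

(** Real part of the Fourier transform of [a + i b] in the first coordinate alone, at frequency [s],
    the other coordinates [y] being parameters. *)
Definition part_re s y : R :=
  Rintegral mu setT (fun x => a (x, y) * cos (x * s) + b (x, y) * sin (x * s)).
Definition part_im s y : R :=
  Rintegral mu setT (fun x => b (x, y) * cos (x * s) - a (x, y) * sin (x * s)).

Let ma : measurable_fun setT a.
Proof. by apply/measurable_EFinP; exact: measurable_int ai. Qed.

Let mb : measurable_fun setT b.
Proof. by apply/measurable_EFinP; exact: measurable_int bi. Qed.

Let mfs (s : R) : measurable_fun setT (fun p : R * 'rV[R]_n => p.1 * s).
Proof. exact: measurable_funM. Qed.

Lemma integrable_part_re s : nu.-integrable setT (EFin \o part_re s).
Proof.
have [+ _] := integrable_ft_integrand ai bi (mfs s).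
exact: integrable_Rintegral_fst.
Qed.

Lemma integrable_part_im s : nu.-integrable setT (EFin \o part_im s).
Proof.
have [_ +] := integrable_ft_integrand ai bi (mfs s).
exact: integrable_Rintegral_fst.
Qed.

Let mpair : measurable_fun setT (fun z : R * 'rV[R]_n * R => (z.2, z.1.2)).
Proof.
by apply: measurable_fun_pair => //; exact: (measurableT_comp measurable_snd measurable_fst).
Qed.

Let mphase : measurable_fun setT (fun z : R * 'rV[R]_n * R => z.2 * z.1.1).
Proof.
apply: measurable_funM => //; exact: (measurableT_comp measurable_fst measurable_fst).
Qed.

Lemma measurable_part_re : measurable_fun setT (fun p => part_re p.1 p.2).
Proof.
apply: (@measurable_fun_Rintegral_snd _ _ _ _ _ mu (fun z : R * 'rV[R]_n * R =>
  a (z.2, z.1.2) * cos (z.2 * z.1.1) + b (z.2, z.1.2) * sin (z.2 * z.1.1))).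
apply: measurable_funD; apply: measurable_funM.
- exact: (measurableT_comp ma mpair).
- exact: measurable_cos.
- exact: (measurableT_comp mb mpair).
- exact: measurable_sin.
Qed.

Lemma measurable_part_im : measurable_fun setT (fun p => part_im p.1 p.2).
Proof.
apply: (@measurable_fun_Rintegral_snd _ _ _ _ _ mu (fun z : R * 'rV[R]_n * R =>
  b (z.2, z.1.2) * cos (z.2 * z.1.1) - a (z.2, z.1.2) * sin (z.2 * z.1.1))).
apply: measurable_funB; apply: measurable_funM.
- exact: (measurableT_comp mb mpair).
- exact: measurable_cos.
- exact: (measurableT_comp ma mpair).
- exact: measurable_sin.
Qed.

Let ae_int : {ae nu, forall y, mu.-integrable setT (EFin \o (fun x => a (x, y))) /\
                               mu.-integrable setT (EFin \o (fun x => b (x, y)))}.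
Proof.
by apply: filterS2 (ae_integrable2 ai) (ae_integrable2 bi) => y; split.
Qed.

Let mxs (s : R) : measurable_fun setT (fun x : R => x * s).
Proof. exact: measurable_funM. Qed.

(** Splitting the integral needs integrable slices, which Fubini grants for almost every [y]; the
    exceptional set does not depend on [s]. *)
Lemma part_cosT : {ae nu, forall y, forall s,
  part_re s y = cosT (fun x => a (x, y)) s + sinT (fun x => b (x, y)) s /\
  part_im s y = cosT (fun x => b (x, y)) s - sinT (fun x => a (x, y)) s}.
Proof.
apply: filterS ae_int => y [ay by_] s; split.
- by rewrite /part_re RintegralD//;
    [exact: (integrable_mul_cos ay (mxs s))|exact: (integrable_mul_sin by_ (mxs s))].
- by rewrite /part_im RintegralB//;
    [exact: (integrable_mul_cos by_ (mxs s))|exact: (integrable_mul_sin ay (mxs s))].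
Qed.

(** The phase [t] depends only on the remaining coordinates, so its sine and cosine leave the inner
    integral; [c] and [d] will already carry the phase of the first coordinate. *)
Let split_integral (c d : R * 'rV[R]_n -> R) (t : 'rV[R]_n -> R) :
  (mu \x nu)%E.-integrable setT (EFin \o c) -> (mu \x nu)%E.-integrable setT (EFin \o d) ->
  measurable_fun setT t ->
  Rintegral (mu \x nu)%E setT (fun p => c p * cos (t p.2) + d p * sin (t p.2)) =
  Rintegral nu setT (fun y => Rintegral mu setT (fun x => c (x, y)) * cos (t y) +
                             Rintegral mu setT (fun x => d (x, y)) * sin (t y)).
Proof.
move=> ci di mt.
have mt2 : measurable_fun setT (fun p : R * 'rV[R]_n => t p.2).
  exact: (measurableT_comp mt measurable_snd).
have ii := (integrable_ft_integrand ci di mt2).1.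
rewrite Rintegral_prod_fst// /Rintegral; congr fine; apply: ae_eq_integral => //.
- by apply/measurable_EFinP; exact: measurable_fun_Rintegral_fst ii.
- apply/measurable_EFinP; apply: measurable_funD; apply: measurable_funM.
  + exact: measurable_fun_Rintegral_fst ci.
  + exact: measurable_cos.
  + exact: measurable_fun_Rintegral_fst di.
  + exact: measurable_sin.
- apply: filterS2 (ae_integrable2 ci) (ae_integrable2 di) => y cy dy _; congr EFin.
  change (Rintegral mu setT (fun x => c (x, y) * cos (t y) + d (x, y) * sin (t y)) =
    Rintegral mu setT (fun x => c (x, y)) * cos (t y) +
    Rintegral mu setT (fun x => d (x, y)) * sin (t y)).
  rewrite RintegralD//; last 2 first.
  + exact: (integrable_mul_cos cy (measurable_cst (t y))).
  + exact: (integrable_mul_sin dy (measurable_cst (t y))).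
  by rewrite !RintegralZr.
Qed.

Lemma ft_re_partial s eta :
  Rintegral (mu \x nu)%E setT (fun p => a p * cos (p.1 * s + dotR p.2 eta) +
                                b p * sin (p.1 * s + dotR p.2 eta)) =
  ft_re (part_re s) (part_im s) eta.
Proof.
have [i1 i2] := integrable_ft_integrand ai bi (mfs s).
have mt : measurable_fun setT (fun y : 'rV[R]_n => dotR y eta).
  by apply: (@measurable_dotR _ _ n id (cst eta)).
rewrite -[RHS](split_integral i1 i2 mt); apply: eq_Rintegral => -[x y] _ /=.
by rewrite cosD sinD; ring.
Qed.

Lemma ft_im_partial s eta :
  Rintegral (mu \x nu)%E setT (fun p => b p * cos (p.1 * s + dotR p.2 eta) -
                                a p * sin (p.1 * s + dotR p.2 eta)) =
  ft_im (part_re s) (part_im s) eta.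
Proof.
have [i1 i2] := integrable_ft_integrand ai bi (mfs s).
have mt : measurable_fun setT (fun y : 'rV[R]_n => dotR y eta).
  by apply: (@measurable_dotR _ _ n id (cst eta)).
(* The sine coefficient is minus the integrand of [part_re]. The sign is kept inside for the
   interchange and extracted afterwards, on the slices that are integrable. *)
have i1' : (mu \x nu)%E.-integrable setT 
    (EFin \o (fun p => -1 * (a p * cos (p.1 * s) + b p * sin (p.1 * s)))).
  exact: integrable_EFinZl i1.
transitivity (Rintegral nu setT (fun y => part_im s y * cos (dotR y eta) +
    Rintegral mu setT (fun x => -1 * (a (x, y) * cos (x * s) + b (x, y) * sin (x * s))) *
      sin (dotR y eta))).
  rewrite -(split_integral i2 i1' mt); apply: eq_Rintegral => -[x y] _ /=.
  by rewrite cosD sinD; ring.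
rewrite /ft_im /Rintegral; congr fine; apply: ae_eq_integral => //.
- apply/measurable_EFinP; apply: measurable_funD; apply: measurable_funM.
  + exact: measurable_fun_Rintegral_fst i2.
  + exact: measurable_cos.
  + exact: measurable_fun_Rintegral_fst i1'.
  + exact: measurable_sin.
- apply/measurable_EFinP; apply: measurable_funB; apply: measurable_funM.
  + exact: measurable_fun_Rintegral_fst i2.
  + exact: measurable_cos.
  + exact: measurable_fun_Rintegral_fst i1.
  + exact: measurable_sin.
- apply: filterS (ae_integrable2 i1) => y iy _; congr EFin.
  rewrite -/(Rintegral mu setT (fun x => -1 * (a (x, y) * cos (x * s) + b (x, y) * sin (x * s)))).
  by rewrite RintegralZl// -/(part_re s y); ring.
Qed.

End partial_transform.

End rV_succ.

(** The identity on the line is applied for almost every value of the other coordinates, namely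
    where the slices and their squares are integrable, and then integrated over them. *)
Lemma integral_sqr_partial n (a b : R * 'rV[R]_n -> R) :
  (lebesgue_measure \x lebesgue_rV R n)%E.-integrable setT (EFin \o a) ->
  (lebesgue_measure \x lebesgue_rV R n)%E.-integrable setT (EFin \o b) ->
  (lebesgue_measure \x lebesgue_rV R n)%E.-integrable setT (EFin \o (fun p => a p ^+ 2)) ->
  (lebesgue_measure \x lebesgue_rV R n)%E.-integrable setT (EFin \o (fun p => b p ^+ 2)) ->
  (\int[lebesgue_measure \x lebesgue_rV R n]_p
     (part_re a b p.1 p.2 ^+ 2 + part_im a b p.1 p.2 ^+ 2)%:E =
   (2 * pi)%:E * \int[lebesgue_measure \x lebesgue_rV R n]_p (a p ^+ 2 + b p ^+ 2)%:E)%E.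
Proof.
move=> ai bi a2i b2i.
have ma2 : measurable_fun setT (fun p => a p ^+ 2).
  by apply/measurable_EFinP; exact: measurable_int a2i.
have mb2 : measurable_fun setT (fun p => b p ^+ 2).
  by apply/measurable_EFinP; exact: measurable_int b2i.
have mab : measurable_fun setT (fun p => (a p ^+ 2 + b p ^+ 2)%:E).
  by apply/measurable_EFinP; exact: measurable_funD.
have mAB : measurable_fun setT
    (fun p => (part_re a b p.1 p.2 ^+ 2 + part_im a b p.1 p.2 ^+ 2)%:E).
  apply/measurable_EFinP; apply: measurable_funD; apply: measurable_funX.
  - exact: measurable_part_re.
  - exact: measurable_part_im.
rewrite !fubini_tonelli2//; last 2 first.
- by move=> p; rewrite lee_fin addr_ge0 ?sqr_ge0.
- by move=> p; rewrite lee_fin addr_ge0 ?sqr_ge0.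
rewrite -ge0_integralZl//; last 3 first.
- apply: measurable_fun_fubini_tonelli_G => //.
  by move=> p; rewrite lee_fin addr_ge0 ?sqr_ge0.
- by move=> y _; apply: integral_ge0 => x _; rewrite lee_fin addr_ge0 ?sqr_ge0.
- by rewrite lee_fin mulr_ge0// pi_ge0.
apply: ae_eq_integral => //.
- apply: measurable_fun_fubini_tonelli_G => //.
  by move=> p; rewrite lee_fin addr_ge0 ?sqr_ge0.
- apply: measurable_funeM; apply: measurable_fun_fubini_tonelli_G => //.
  by move=> p; rewrite lee_fin addr_ge0 ?sqr_ge0.
have aeI (c d : R * 'rV[R]_n -> R) :
    (lebesgue_measure \x lebesgue_rV R n)%E.-integrable setT (EFin \o c) ->
    (lebesgue_measure \x lebesgue_rV R n)%E.-integrable setT (EFin \o d) ->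
    {ae lebesgue_rV R n, forall y,
      lebesgue_measure.-integrable setT (EFin \o (fun x => c (x, y))) /\
      lebesgue_measure.-integrable setT (EFin \o (fun x => d (x, y)))}.
  by move=> ci di; apply: filterS2 (ae_integrable2 ci) (ae_integrable2 di) => y; split.
have ae1 := aeI _ _ ai bi; have ae2 := aeI _ _ a2i b2i.
apply: filterS3 (part_cosT ai bi) ae1 ae2 => y pE [ay by_] [a2y b2y] _.
rewrite -(plancherel_line ay by_ a2y b2y); apply: eq_integral => s _ /=.
by have [-> ->] := pE s.
Qed.

(** For a fixed first frequency [s] the full transform is the transform, in the remaining
    coordinates, of the partial one. The partial transform is integrable for every [s], but square
    integrable only for almost every [s]; this suffices for applying the induction hypothesis under
    the integral in [s]. *)
Lemma plancherel_rV n (a b : 'rV[R]_n -> R) :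
  (lebesgue_rV R n).-integrable setT (EFin \o a) ->
  (lebesgue_rV R n).-integrable setT (EFin \o b) ->
  (lebesgue_rV R n).-integrable setT (EFin \o (fun x => a x ^+ 2)) ->
  (lebesgue_rV R n).-integrable setT (EFin \o (fun x => b x ^+ 2)) ->
  (\int[lebesgue_rV R n]_xi (ft_re a b xi ^+ 2 + ft_im a b xi ^+ 2)%:E =
   ((2 * pi) ^+ n)%:E * \int[lebesgue_rV R n]_x (a x ^+ 2 + b x ^+ 2)%:E)%E.
Proof.
elim: n a b => [|n IH] a b ai bi a2i b2i.
  (* In dimension 0 the measure is a Dirac mass and the transform is the identity. *)
  have ma : measurable_fun setT a by apply/measurable_EFinP; exact: measurable_int ai.
  have mb : measurable_fun setT b by apply/measurable_EFinP; exact: measurable_int bi.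
  rewrite expr0 mul1e; apply: eq_integral => x _; congr EFin.
  have d0 y z : dotR (y : 'rV[R]_0) z = 0 by rewrite /dotR big_ord0.
  have e0 y : y = x :> 'rV[R]_0 by apply/rowP => -[].
  have reE : ft_re a b x = a x.
    rewrite /ft_re /Rintegral; under eq_integral do rewrite d0 cos0 sin0 mulr1 mulr0 addr0.
    by rewrite integral_dirac ?diracT ?mul1e ?(e0 0)//; exact/measurable_EFinP.
  have imE : ft_im a b x = b x.
    rewrite /ft_im /Rintegral; under eq_integral do rewrite d0 cos0 sin0 mulr1 mulr0 subr0.
    by rewrite integral_dirac ?diracT ?mul1e ?(e0 0)//; exact/measurable_EFinP.
  by rewrite reE imE.
have ma : measurable_fun setT a by apply/measurable_EFinP; exact: measurable_int ai.
have mb : measurable_fun setT b by apply/measurable_EFinP; exact: measurable_int bi.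
pose a' p := a (rV_cons p); pose b' p := b (rV_cons p).
have ai' := integrable_rV_cons ai; have bi' := integrable_rV_cons bi.
have a2i' := integrable_rV_cons a2i; have b2i' := integrable_rV_cons b2i.
pose A s y := part_re a' b' s y; pose B s y := part_im a' b' s y.
have mA : measurable_fun setT (fun p => A p.1 p.2) by exact: measurable_part_re ai' bi'.
have mB : measurable_fun setT (fun p => B p.1 p.2) by exact: measurable_part_im ai' bi'.
have mdot xi : measurable_fun setT (fun x : 'rV[R]_n.+1 => dotR x xi).
  by apply: (@measurable_dotR _ _ n.+1 id (cst xi)).
have reE s eta : ft_re a b (rV_cons (s, eta)) = ft_re (A s) (B s) eta.
  rewrite /ft_re Rintegral_rV_cons; last first.
    exact: (integrable_ft_integrand ai bi (mdot _)).1.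
  rewrite -[RHS](ft_re_partial ai' bi'); apply: eq_Rintegral => p _.
  by rewrite dotR_rV_cons.
have imE s eta : ft_im a b (rV_cons (s, eta)) = ft_im (A s) (B s) eta.
  rewrite /ft_im Rintegral_rV_cons; last first.
    exact: (integrable_ft_integrand ai bi (mdot _)).2.
  rewrite -[RHS](ft_im_partial ai' bi'); apply: eq_Rintegral => p _.
  by rewrite dotR_rV_cons.
have AB2E := integral_sqr_partial ai' bi' a2i' b2i'.
have ab2i : (lebesgue_measure \x lebesgue_rV R n)%E.-integrable setT
    (EFin \o (fun p => a' p ^+ 2 + b' p ^+ 2)).
  exact: integrable_EFinD a2i' b2i'.
(* Plancherel in the first variable gives joint square integrability, hence the square integrable
   slices required by the induction hypothesis. *)
have AB2i : (lebesgue_measure \x lebesgue_rV R n)%E.-integrable setT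
    (EFin \o (fun p => A p.1 p.2 ^+ 2 + B p.1 p.2 ^+ 2)).
  apply: ge0_integrable.
  - by apply: measurable_funD; exact: measurable_funX.
  - by move=> p; rewrite addr_ge0 ?sqr_ge0.
  - by rewrite AB2E (integral_EFin_Rintegral ab2i) -EFinM ltry.
have mT : measurable_fun setT (fun xi => (ft_re a b xi ^+ 2 + ft_im a b xi ^+ 2)%:E).
  apply/measurable_EFinP; apply: measurable_funD; apply: measurable_funX.
  - exact: measurable_ft_re.
  - exact: measurable_ft_im.
have mTc := measurableT_comp mT (@measurable_rV_cons R n).
rewrite ge0_integral_rV_cons//; last by move=> x; rewrite lee_fin addr_ge0 ?sqr_ge0.
rewrite fubini_tonelli1//; last by move=> x; rewrite lee_fin addr_ge0 ?sqr_ge0.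
rewrite ge0_integral_rV_cons; last 2 first.
- by apply/measurable_EFinP; apply: measurable_funD; exact: measurable_funX.
- by move=> x; rewrite lee_fin addr_ge0 ?sqr_ge0.
rewrite exprSr EFinM -muleA -AB2E fubini_tonelli1//; last 2 first.
- exact: measurable_int AB2i.
- by move=> x; rewrite lee_fin addr_ge0 ?sqr_ge0.
have mF : measurable_fun setT (fubini_F (lebesgue_rV R n)
    (fun p => (A p.1 p.2 ^+ 2 + B p.1 p.2 ^+ 2)%:E)).
  apply: measurable_fun_fubini_tonelli_F; first exact: measurable_int AB2i.
  by move=> x; rewrite lee_fin addr_ge0 ?sqr_ge0.
rewrite -ge0_integralZl//; last 2 first.
- by move=> y _; apply: integral_ge0 => x _; rewrite lee_fin addr_ge0 ?sqr_ge0.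
- by rewrite lee_fin exprn_ge0// mulr_ge0// pi_ge0.
apply: ae_eq_integral => //.
- apply: measurable_fun_fubini_tonelli_F => //.
  by move=> x; rewrite lee_fin addr_ge0 ?sqr_ge0.
- exact: measurable_funeM.
apply: filterS (ae_integrable1 AB2i) => s ABs _.
have mAs : measurable_fun setT (fun y => A s y) by exact: (measurable_fun_pair2 s mA).
have mBs : measurable_fun setT (fun y => B s y) by exact: (measurable_fun_pair2 s mB).
rewrite /fubini_F -IH.
- by apply: eq_integral => eta _ /=; rewrite reE imE.
- exact: integrable_part_re.
- exact: integrable_part_im.
- apply: (integrable_le _ _ ABs); first exact: measurable_funX.
  by move=> y; rewrite ger0_norm ?sqr_ge0// lerDl sqr_ge0.
- apply: (integrable_le _ _ ABs); first exact: measurable_funX.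
  by move=> y; rewrite ger0_norm ?sqr_ge0// lerDr sqr_ge0.
Qed.

End fourier_rV.

(** * The Fourier-Plancherel transform of vector fields *)

Section fourier_transform.
Context {R : realType} {n m : nat}.
Implicit Types (u v w : 'rV[R]_n -> 'cV[R[i]]_m).

Let ReB (z1 z2 : R[i]) : complex.Re (z1 - z2) = complex.Re z1 - complex.Re z2.
Proof. by case: z1 z2 => [a b] [c d]. Qed.

Let ImB (z1 z2 : R[i]) : complex.Im (z1 - z2) = complex.Im z1 - complex.Im z2.
Proof. by case: z1 z2 => [a b] [c d]. Qed.

Let Re_expNiM (t : R) (z : R[i]) :
  complex.Re (expNi t * z) = complex.Re z * cos t + complex.Im z * sin t.
Proof. by case: z => a b /=; ring. Qed.

Let Im_expNiM (t : R) (z : R[i]) :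
  complex.Im (expNi t * z) = complex.Im z * cos t - complex.Re z * sin t.
Proof. by case: z => a b /=; ring. Qed.

Lemma Re_fourierL1 w xi j : complex.Re (fourierL1 w xi j ord0) =
  ft_re (fun x => complex.Re (w x j ord0)) (fun x => complex.Im (w x j ord0)) xi.
Proof. by rewrite mxE /=; apply: eq_Rintegral => x _; rewrite Re_expNiM. Qed.

Lemma Im_fourierL1 w xi j : complex.Im (fourierL1 w xi j ord0) =
  ft_im (fun x => complex.Re (w x j ord0)) (fun x => complex.Im (w x j ord0)) xi.
Proof. by rewrite mxE /=; apply: eq_Rintegral => x _; rewrite Im_expNiM. Qed.

Lemma sqnormC_ge0 (z : 'cV[R[i]]_m) : 0 <= sqnormC z.
Proof. by apply: sumr_ge0 => j _; rewrite addr_ge0 ?sqr_ge0. Qed.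

Lemma sqnormL2_ge0 u : (0 <= sqnormL2 u)%E.
Proof. by apply: integral_ge0 => x _; rewrite lee_fin sqnormC_ge0. Qed.

Lemma measurable_sqnormC u : measurable_CV u -> measurable_fun setT (fun x => sqnormC (u x)).
Proof.
move=> mu; apply: measurable_sum => j; have [mr mi] := mu j.
by apply: measurable_funD; exact: measurable_funX.
Qed.

Lemma measurable_CVB u v : measurable_CV u -> measurable_CV v -> measurable_CV (u \- v).
Proof.
move=> mu mv j; have [ur ui] := mu j; have [vr vi] := mv j; split.
- rewrite (_ : (fun x => _) = fun x => complex.Re (u x j ord0) - complex.Re (v x j ord0)).
    exact: measurable_funB.
  by apply/funext => x; rewrite !mxE ReB.
- rewrite (_ : (fun x => _) = fun x => complex.Im (u x j ord0) - complex.Im (v x j ord0)).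
    exact: measurable_funB.
  by apply/funext => x; rewrite !mxE ImB.
Qed.

Let sqr_triangle (x y : R) : x ^+ 2 <= 2 * (x - y) ^+ 2 + 2 * y ^+ 2.
Proof.
by rewrite -subr_ge0 (_ : _ - _ = (x - 2 * y) ^+ 2) ?sqr_ge0//; ring.
Qed.

Lemma sqnormC_triangle (x y : 'cV[R[i]]_m) :
  sqnormC x <= 2 * sqnormC (x - y) + 2 * sqnormC y.
Proof.
rewrite /sqnormC !mulr_sumr -big_split /=; apply: ler_sum => j _.
rewrite !mxE ReB ImB !mulrDr addrACA.
by rewrite lerD.
Qed.

Lemma sqnormL2_triangle u v : measurable_CV u -> measurable_CV v ->
  (sqnormL2 u <= 2%:E * sqnormL2 (u \- v)%R + 2%:E * sqnormL2 v)%E.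
Proof.
move=> mu mv; have muv := measurable_CVB mu mv.
have ms w : measurable_CV w -> measurable_fun setT (fun x => (sqnormC (w x))%:E).
  by move=> mw; apply/measurable_EFinP; exact: measurable_sqnormC.
rewrite /sqnormL2 -!ge0_integralZl//; try exact: ms;
  try by (move=> x _; rewrite lee_fin sqnormC_ge0).
rewrite -ge0_integralD//; last 4 first.
- by move=> x _; rewrite mule_ge0// lee_fin sqnormC_ge0.
- by apply: measurable_funeM; exact: ms.
- by move=> x _; rewrite mule_ge0// lee_fin sqnormC_ge0.
- by apply: measurable_funeM; exact: ms.
apply: ge0_le_integral => //.
- by move=> x _; rewrite lee_fin sqnormC_ge0.
- exact: ms.
- by apply: emeasurable_funD; apply: measurable_funeM; exact: ms.
- by move=> x _; rewrite -!EFinM -EFinD lee_fin sqnormC_triangle.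
Qed.

Let sqnormC_opp (z : 'cV[R[i]]_m) : sqnormC (- z) = sqnormC z.
Proof.
by apply: eq_bigr => j _; rewrite !mxE; case: (z j ord0) => a b /=; rewrite !sqrrN.
Qed.

Lemma sqnormL2_subC u v : sqnormL2 (u \- v) = sqnormL2 (v \- u).
Proof. by apply: eq_integral => x _ /=; rewrite -sqnormC_opp opprB. Qed.

Lemma L2_component w j : L2 w ->
  (lebesgue_rV R n).-integrable setT (EFin \o (fun x => complex.Re (w x j ord0) ^+ 2)) /\
  (lebesgue_rV R n).-integrable setT (EFin \o (fun x => complex.Im (w x j ord0) ^+ 2)).
Proof.
move=> [mw wy].
have wi : (lebesgue_rV R n).-integrable setT (EFin \o (fun x => sqnormC (w x))).
  by apply: ge0_integrable => //; [exact: measurable_sqnormC|move=> x; exact: sqnormC_ge0].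
have [mr mi] := mw j.
have le x : complex.Re (w x j ord0) ^+ 2 + complex.Im (w x j ord0) ^+ 2 <= sqnormC (w x).
  by rewrite /sqnormC (bigD1 j)//= lerDl sumr_ge0// => k _; rewrite addr_ge0 ?sqr_ge0.
split; apply: (integrable_le _ _ wi); try exact: measurable_funX.
- by move=> x; rewrite ger0_norm ?sqr_ge0// (le_trans _ (le x))// lerDl sqr_ge0.
- by move=> x; rewrite ger0_norm ?sqr_ge0// (le_trans _ (le x))// lerDr sqr_ge0.
Qed.

Lemma measurable_fourierL1 w : measurable_CV w -> measurable_CV (fourierL1 w).
Proof.
move=> mw j; have [mr mi] := mw j; split.
- rewrite (_ : (fun x => _) = ft_re (fun x => complex.Re (w x j ord0))
    (fun x => complex.Im (w x j ord0))); first exact: measurable_ft_re.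
  by apply/funext => x; rewrite Re_fourierL1.
- rewrite (_ : (fun x => _) = ft_im (fun x => complex.Re (w x j ord0))
    (fun x => complex.Im (w x j ord0))); first exact: measurable_ft_im.
  by apply/funext => x; rewrite Im_fourierL1.
Qed.

Lemma sqnormL2E w : measurable_CV w -> sqnormL2 w =
  (\sum_(j < m) \int[lebesgue_rV R n]_x
    (complex.Re (w x j ord0) ^+ 2 + complex.Im (w x j ord0) ^+ 2)%:E)%E.
Proof.
move=> mw; rewrite /sqnormL2 -ge0_integral_sum//.
- by apply: eq_integral => x _; rewrite sumEFin.
- move=> j; have [mr mi] := mw j.
  by apply/measurable_EFinP; apply: measurable_funD; exact: measurable_funX.
- by move=> j x _; rewrite lee_fin addr_ge0 ?sqr_ge0.
Qed.

Lemma plancherel_fourierL1 w : L1 w -> L2 w ->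
  sqnormL2 (fourierL1 w) = (((2 * pi) ^+ n)%:E * sqnormL2 w)%E.
Proof.
move=> w1 w2; have mw := w2.1.
rewrite sqnormL2E; last exact: measurable_fourierL1.
rewrite sqnormL2E// ge0_sume_distrr; last first.
  by move=> j _; apply: integral_ge0 => x _; rewrite lee_fin addr_ge0 ?sqr_ge0.
apply: eq_bigr => j _; have [r1 i1] := w1 j; have [r2 i2] := L2_component j w2.
rewrite -(plancherel_rV r1 i1 r2 i2); apply: eq_integral => xi _.
by rewrite Re_fourierL1 Im_fourierL1.
Qed.

Lemma fourierL1B w w' : L1 w -> L1 w' -> fourierL1 (w \- w') = fourierL1 w \- fourierL1 w'.
Proof.
move=> w1 w1'; apply/funext => xi; apply/matrixP => j k.
rewrite (ord1 k) [RHS](_ : _ = fourierL1 w xi j ord0 - fourierL1 w' xi j ord0); last first.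
  by rewrite /= mxE [X in _ + X = _]mxE.
have [r1 i1] := w1 j; have [r1' i1'] := w1' j.
have md : measurable_fun setT (fun x : 'rV[R]_n => dotR x xi).
  by apply: (@measurable_dotR _ _ _ n id (cst xi)).
have [h1 h2] := integrable_ft_integrand r1 i1 md.
have [h1' h2'] := integrable_ft_integrand r1' i1' md.
apply/eqP; rewrite eq_complex ReB ImB !Re_fourierL1 !Im_fourierL1; apply/andP; split; apply/eqP.
- rewrite /ft_re -RintegralB//; apply: eq_Rintegral => x _.
  by rewrite !mxE ReB ImB; ring.
- rewrite /ft_im -RintegralB//; apply: eq_Rintegral => x _.
  by rewrite !mxE ReB ImB; ring.
Qed.

Lemma L1B w w' : L1 w -> L1 w' -> L1 (w \- w').
Proof.
move=> w1 w1' j; have [r1 i1] := w1 j; have [r1' i1'] := w1' j; split.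
- rewrite (_ : (fun x => _) =
    EFin \o (fun x => complex.Re (w x j ord0) - complex.Re (w' x j ord0))).
    exact: integrable_EFinB.
  by apply/funext => x; rewrite !mxE ReB.
- rewrite (_ : (fun x => _) =
    EFin \o (fun x => complex.Im (w x j ord0) - complex.Im (w' x j ord0))).
    exact: integrable_EFinB.
  by apply/funext => x; rewrite !mxE ImB.
Qed.

End fourier_transform.

(** * Norm comparison and uniqueness for the transform on L^2 *)

Section plancherel_fourier.
Context {R : realType} {n m : nat}.
Implicit Types (u v w : 'rV[R]_n -> 'cV[R[i]]_m).

Let K : R := (2 * pi) ^+ n.

Let K_gt0 : 0 < K.
Proof. by rewrite exprn_gt0// mulr_gt0// pi_gt0. Qed.

Let cvge0_near (x : (\bar R)^nat) (e : R) : 0 < e -> x @ \oo --> 0%E ->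
  \forall k \near \oo, (x k <= e%:E)%E.
Proof.
move=> e0 /fine_cvgP[fx /cvgrPdist_lt/(_ e e0) xe].
near=> k; have fk : x k \is a fin_num by near: k.
rewrite -(fineK fk) lee_fin.
have : `|0 - fine (x k)| < e by near: k.
by rewrite sub0r normrN => /ltW; apply: le_trans; rewrite ler_norm.
Unshelve. all: by end_near. Qed.

Lemma is_fourier_approx u v (e : R) : 0 < e -> is_fourier u v ->
  exists w, [/\ L1 w, L2 w, (sqnormL2 (w \- u)%R <= e%:E)%E &
                (sqnormL2 (fourierL1 w \- v)%R <= e%:E)%E].
Proof.
move=> e0 [_ _ [w [w12 /(cvge0_near e0) wu /(cvge0_near e0) wv]]].
near \oo => k; exists (w k); have [? ?] := w12 k; split => //.
- by near: k.
- by near: k.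
Unshelve. all: by end_near. Qed.

(** The estimate goes from [v] to the transform of an approximant [w], then by Plancherel to [w],
    then to [u]. The two approximation steps double the squared norm once each, whence the 4; with
    both errors at most [d] the surplus is [(2 + 4 * K) * d]. *)
Lemma is_fourier_norm_le u v : is_fourier u v ->
  (sqnormL2 v <= (4 * K)%:E * sqnormL2 u)%E.
Proof.
move=> uv; have [u2 v2 _] := uv.
apply/lee_addgt0Pr => e e0.
have d0 : 0 < e / (2 + 4 * K) by rewrite divr_gt0// addr_gt0// mulr_gt0.
have [w [w1 w2 wu wv]] := is_fourier_approx d0 uv.
have mFw := measurable_fourierL1 w2.1.
apply: (le_trans (sqnormL2_triangle v2.1 mFw)).
rewrite sqnormL2_subC plancherel_fourierL1// -/K.
have := sqnormL2_triangle w2.1 u2.1.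
have : (sqnormL2 u < +oo)%E := u2.2.
have := sqnormL2_ge0 u; have := sqnormL2_ge0 w; have := w2.2; have := sqnormL2_ge0 (w \- u)%R.
have := sqnormL2_ge0 (fourierL1 w \- v)%R.
move: wu wv.
case: (sqnormL2 (w \- u)%R) => [x| |]//; case: (sqnormL2 (fourierL1 w \- v)%R) => [y| |]//.
case: (sqnormL2 w) => [p| |]//; case: (sqnormL2 u) => [q| |]//.
rewrite -?EFinM -?EFinD !lee_fin => xd yd y0 x0 _ p0 q0 _ pq.
set d := e / _ in xd yd d0.
have dE : e = d * (2 + 4 * K) by rewrite /d; field; rewrite gt_eqF// addr_gt0// mulr_gt0.
rewrite dE; clear dE; clearbody d.
apply: (@le_trans _ _ (2 * d + 2 * (K * (2 * d + 2 * q)))).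
  by rewrite lerD// ler_pM2l// ler_pM2l// (le_trans pq)// lerD2r ler_pM2l.
by rewrite le_eqVlt; apply/orP; left; apply/eqP; ring.
Qed.

Lemma is_fourier_norm_ge u v : is_fourier u v ->
  (sqnormL2 u <= (4 / K)%:E * sqnormL2 v)%E.
Proof.
move=> uv; have [u2 v2 _] := uv.
apply/lee_addgt0Pr => e e0.
have Kp : 0 < K^-1 by rewrite invr_gt0.
have d0 : 0 < e / (2 + 4 / K) by rewrite divr_gt0// addr_gt0// mulr_gt0.
have [w [w1 w2 wu wv]] := is_fourier_approx d0 uv.
have mFw := measurable_fourierL1 w2.1.
apply: (le_trans (sqnormL2_triangle u2.1 w2.1)).
rewrite sqnormL2_subC.
have := sqnormL2_triangle mFw v2.1.
rewrite plancherel_fourierL1// -/K.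
have : (sqnormL2 v < +oo)%E := v2.2.
have := sqnormL2_ge0 v; have := sqnormL2_ge0 w; have := w2.2; have := sqnormL2_ge0 (w \- u)%R.
have := sqnormL2_ge0 (fourierL1 w \- v)%R.
move: wu wv.
case: (sqnormL2 (w \- u)%R) => [x| |]//; case: (sqnormL2 (fourierL1 w \- v)%R) => [y| |]//.
case: (sqnormL2 w) => [p| |]//; case: (sqnormL2 v) => [q| |]//.
rewrite -?EFinM -?EFinD !lee_fin => xd yd y0 x0 _ p0 q0 _ pq.
set d := e / _ in xd yd d0.
have dE : e = d * (2 + 4 / K).
  rewrite /d; field; rewrite !gt_eqF//.
  by rewrite addr_gt0// mulr_gt0.
rewrite dE; clear dE; clearbody d.
apply: (@le_trans _ _ (2 * d + 2 * (K^-1 * (2 * d + 2 * q)))).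
  rewrite lerD// ler_pM2l// -[p](mulKf (lt0r_neq0 K_gt0)) ler_pM2l//.
  by rewrite (le_trans pq)// lerD2r ler_pM2l.
by rewrite le_eqVlt; apply/orP; left; apply/eqP; ring.
Qed.

Let sqnormL2_chain u v w : measurable_CV u -> measurable_CV v -> measurable_CV w ->
  (sqnormL2 (u \- w)%R <= 2%:E * sqnormL2 (u \- v)%R + 2%:E * sqnormL2 (v \- w)%R)%E.
Proof.
move=> mu mv mw.
have := sqnormL2_triangle (measurable_CVB mu mw) (measurable_CVB mv mw).
rewrite (_ : ((u \- w) \- (v \- w))%R = (u \- v)%R)//.
by apply/funext => x /=; rewrite opprB addrA subrK.
Qed.

(** A decay character and a solution each come with their own representative of the transform, and
    these must be identified. The approximants of [v] and [v'] both tend to [u], so Plancherel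
    applied to their difference closes the chain; [6 + 16 * K] collects the doubled errors. *)
Lemma is_fourier_unique u v v' : is_fourier u v -> is_fourier u v' ->
  sqnormL2 (v \- v')%R = 0%E.
Proof.
move=> uv uv'; have [u2 v2 _] := uv; have [_ v2' _] := uv'.
apply/eqP; rewrite eq_le sqnormL2_ge0 andbT; apply/lee_addgt0Pr => e e0; rewrite add0e.
have c0 : 0 < 6 + 16 * K by rewrite addr_gt0// mulr_gt0.
have d0 : 0 < e / (6 + 16 * K) by rewrite divr_gt0.
have [w [w1 w2 wu wv]] := is_fourier_approx d0 uv.
have [w' [w1' w2' wu' wv']] := is_fourier_approx d0 uv'.
have mFw := measurable_fourierL1 w2.1; have mFw' := measurable_fourierL1 w2'.1.
have ch1 := sqnormL2_chain v2.1 mFw v2'.1.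
have ch2 := sqnormL2_chain mFw mFw' v2'.1.
have ch3 := sqnormL2_chain w2.1 u2.1 w2'.1.
rewrite (sqnormL2_subC v (fourierL1 w)) in ch1; rewrite (sqnormL2_subC u w') in ch3.
have L2ww' : L2 (w \- w').
  split; first exact: measurable_CVB w2.1 w2'.1.
  apply: (le_lt_trans ch3); rewrite lte_add_pinfty//.
    by rewrite lte_mul_pinfty// (le_lt_trans wu)// ltry.
  by rewrite lte_mul_pinfty// (le_lt_trans wu')// ltry.
have FE := plancherel_fourierL1 (L1B w1 w1') L2ww'.
rewrite fourierL1B// -/K in FE.
rewrite {}FE in ch2.
have h0 := sqnormL2_ge0.
move: ch1 ch2 ch3 wu wu' wv wv' (h0 R n m (w \- u)) (h0 R n m (w' \- u)) (L2ww'.2)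
  (h0 R n m (fourierL1 w \- v)) (h0 R n m (fourierL1 w' \- v')) (h0 R n m (w \- w'))
  (h0 R n m (fourierL1 w \- v')) (h0 R n m (v \- v')).
case: (sqnormL2 (w \- u)%R) => [x| |]//; case: (sqnormL2 (fourierL1 w \- v)%R) => [y| |]//.
case: (sqnormL2 (w' \- u)%R) => [x'| |]//; case: (sqnormL2 (fourierL1 w' \- v')%R) => [y'| |]//.
case: (sqnormL2 (w \- w')%R) => [z| |]//; case: (sqnormL2 (fourierL1 w \- v')%R) => [p| |]//;
case: (sqnormL2 (v \- v')%R) => [q| |]//.
rewrite -?EFinM -?EFinD !lee_fin => ch1 ch2 ch3 xd xd' yd yd' *.
set d := e / _ in xd xd' yd yd' d0.
have dE : e = d * (6 + 16 * K) by rewrite /d; field; rewrite gt_eqF.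
rewrite dE; clear dE; clearbody d.
apply: (@le_trans _ _ (2 * d + 2 * (2 * (K * (2 * d + 2 * d)) + 2 * d))).
  rewrite (le_trans ch1)// lerD ?ler_pM2l// (le_trans ch2)// lerD ?ler_pM2l//.
  by rewrite (le_trans ch3)// lerD ?ler_pM2l.
by rewrite le_eqVlt; apply/orP; left; apply/eqP; ring.
Qed.

Let sqnormC_eq0 (z : 'cV[R[i]]_m) : sqnormC z = 0 -> z = 0.
Proof.
move=> /eqP; rewrite psumr_eq0 => [|j _]; last by rewrite addr_ge0 ?sqr_ge0.
move=> /allP z0; apply/colP => j; have := z0 j (mem_index_enum _).
rewrite /= paddr_eq0 ?sqr_ge0// !sqrf_eq0 mxE => /andP[/eqP a0 /eqP b0].
by apply/eqP; rewrite eq_complex a0 b0 /= !eqxx.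
Qed.

Lemma eq_integral_sqnormC v v' (D : set 'rV[R]_n) : measurable D ->
  measurable_CV v -> measurable_CV v' -> sqnormL2 (v \- v')%R = 0%E ->
  (\int[lebesgue_rV R n]_(x in D) (sqnormC (v x))%:E =
   \int[lebesgue_rV R n]_(x in D) (sqnormC (v' x))%:E)%E.
Proof.
move=> mD mv mv' vv'.
have ms w : measurable_CV w -> measurable_fun setT (fun x => (sqnormC (w x))%:E).
  by move=> mw; apply/measurable_EFinP; exact: measurable_sqnormC.
have mvv' := ms _ (measurable_CVB mv mv').
apply: ae_eq_integral => //; try (apply: measurable_funTS; exact: ms).
have /(ae_eq_integral_abs _ measurableT mvv').1 :
    (\int[lebesgue_rV R n]_x `|(sqnormC ((v \- v')%R x))%:E| = 0)%E.
  by rewrite -vv'; apply: eq_integral => x _; rewrite gee0_abs// lee_fin sqnormC_ge0.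
apply: filterS => x /(_ I) [] /sqnormC_eq0 /eqP; rewrite subr_eq0 => /eqP -> _.
by [].
Qed.

End plancherel_fourier.

(** * Exponential of the symbol *)

Lemma cvgn_sum (R : realType) (I : Type) (r : seq I) (F : I -> R^nat) (L : I -> R) :
  (forall i, F i @ \oo --> L i) ->
  (fun n => \sum_(i <- r) F i n) @ \oo --> \sum_(i <- r) L i.
Proof.
move=> FL; elim: r => [|i r IH].
  under eq_fun do rewrite big_nil; rewrite big_nil; exact: cvg_cst.
under eq_fun do rewrite big_cons; rewrite big_cons; exact: cvgD.
Qed.

Section exponential_of_symbol.
Context {R : realType} {m : nat}.
Implicit Types (P A : 'M[R]_m) (d : 'rV[R]_m) (x : 'cV[R]_m).

Definition sqnR x : R := \sum_(j < m) x j ord0 ^+ 2.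

Lemma sqnRE x : sqnR x = (x^T *m x) ord0 ord0.
Proof. by rewrite !mxE; apply: eq_bigr => j _; rewrite mxE expr2. Qed.

Lemma sqnR_orthogonal P x : P^T *m P = 1%:M -> sqnR (P *m x) = sqnR x.
Proof. by move=> PP; rewrite !sqnRE trmx_mul mulmxA -[_ *m P^T *m P]mulmxA PP mulmx1. Qed.

Lemma conj_diag_exp P d k : P *m P^T = 1%:M ->
  (P^T *m diag_mx d *m P) ^+ k = P^T *m diag_mx (map_mx (fun s => s ^+ k) d) *m P.
Proof.
move=> PP; elim: k => [|k IH].
  rewrite expr0 (_ : diag_mx _ = 1%:M).
    by rewrite mulmx1 (mulmx1C PP).
  by apply/matrixP => i j; rewrite !mxE.
rewrite exprSr IH.
rewrite [LHS](_ : _ = (P^T *m diag_mx (map_mx (fun s => s ^+ k) d) *m P) *m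
   (P^T *m diag_mx d *m P))//.
rewrite -!mulmxA (mulmxA P P^T) PP mul1mx; congr (_ *m _); rewrite !mulmxA; congr (_ *m _).
apply/matrixP => i j; rewrite mul_diag_mx !mxE.
by case: eqP => [->|_]; rewrite ?mulr0n ?mulr0// !mulr1n exprSr.
Qed.

(** Powers commute with orthogonal conjugation, so each entry of the matrix series is a finite
    combination of scalar exponential series. *)
Lemma expmx_conj_diag P d : P *m P^T = 1%:M ->
  expmx (P^T *m diag_mx d *m P) = P^T *m diag_mx (map_mx expR d) *m P.
Proof.
move=> PP; apply/matrixP => i j; rewrite mxE.
(* Stated for an arbitrary [f] so as to serve both for the powers in the partial sums and for the
   exponential in the limit. *)
have E (f : R -> R) : (P^T *m diag_mx (map_mx f d) *m P) i j = \sum_l P l i * P l j * f (d ord0 l).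
  rewrite mxE; apply: eq_bigr => l _; rewrite mul_mx_diag !mxE.
  by rewrite mulrAC.
rewrite E; apply/cvg_lim => //.
rewrite (_ : series _ = fun n => \sum_l P l i * P l j * series (exp_coeff (d ord0 l)) n).
  apply: cvgn_sum => l; apply: cvgM; first exact: cvg_cst.
  exact: is_cvg_series_exp_coeff.
apply/funext => n; rewrite /series /=.
under [RHS]eq_bigr do rewrite mulr_sumr.
rewrite exchange_big /=; apply: eq_bigr => k _.
rewrite conj_diag_exp// E mulr_suml; apply: eq_bigr => l _.
by rewrite /exp_coeff /= mulrA.
Qed.

Let Re_mul A (z : 'cV[R[i]]_m) j :
  complex.Re ((map_mx (real_complex R) A *m z) j ord0) =
  (A *m (\col_k complex.Re (z k ord0))) j ord0.
Proof.
rewrite !mxE (big_morph (@complex.Re R) (id1 := 0) (op1 := +%R)) //; last by case=> a b [].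
apply: eq_bigr => k _; rewrite !mxE; case: (z k ord0) => a b /=.
by rewrite mul0r subr0.
Qed.

Let Im_mul A (z : 'cV[R[i]]_m) j :
  complex.Im ((map_mx (real_complex R) A *m z) j ord0) =
  (A *m (\col_k complex.Im (z k ord0))) j ord0.
Proof.
rewrite !mxE (big_morph (@complex.Im R) (id1 := 0) (op1 := +%R)) //; last by case=> a b [].
apply: eq_bigr => k _; rewrite !mxE; case: (z k ord0) => a b /=.
by rewrite mul0r addr0.
Qed.

Lemma sqnormCE (z : 'cV[R[i]]_m) :
  sqnormC z = sqnR (\col_k complex.Re (z k ord0)) + sqnR (\col_k complex.Im (z k ord0)).
Proof. by rewrite /sqnormC big_split /=; congr (_ + _); apply: eq_bigr => j _; rewrite mxE. Qed.

Lemma sqnormC_real_mul A (z : 'cV[R[i]]_m) :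
  sqnormC (map_mx (real_complex R) A *m z) =
  sqnR (A *m (\col_k complex.Re (z k ord0))) + sqnR (A *m (\col_k complex.Im (z k ord0))).
Proof.
rewrite /sqnormC /sqnR big_split /=; congr (_ + _); apply: eq_bigr => j _.
- by rewrite Re_mul.
- by rewrite Im_mul.
Qed.

(** In the coordinates [P *m x] the map scales each component separately, and both changes of
    coordinates preserve the Euclidean norm. *)
Lemma sqnR_conj_diag_bounds P d x (lo hi : R) : P *m P^T = 1%:M ->
  (forall l, lo <= d ord0 l ^+ 2 <= hi) ->
  lo * sqnR x <= sqnR (P^T *m diag_mx d *m P *m x) <= hi * sqnR x.
Proof.
move=> PP dlh; have PP' := mulmx1C PP.
have -> : sqnR (P^T *m diag_mx d *m P *m x) = \sum_l d ord0 l ^+ 2 * (P *m x) l ord0 ^+ 2.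
  rewrite -!mulmxA sqnR_orthogonal; last by rewrite trmxK.
  by apply: eq_bigr => l _; rewrite mul_diag_mx mxE exprMn.
rewrite -(sqnR_orthogonal x PP') /sqnR !mulr_sumr; apply/andP; split; apply: ler_sum => l _.
- by rewrite ler_wpM2r ?sqr_ge0//; case/andP: (dlh l).
- by rewrite ler_wpM2r ?sqr_ge0//; case/andP: (dlh l).
Qed.

(** The system is squeezed between two scalar flows of rates [C] and [c0]; the factor 2 in the
    exponents comes from squaring the norm. The real matrix acts on real and imaginary parts
    independently. *)
Lemma expmx_symbol_bounds n (alpha t c0 C : R) (c : 'I_m -> R) (xi : 'rV[R]_n) P
    (z : 'cV[R[i]]_m) : 0 <= t -> P *m P^T = 1%:M -> (forall i, c0 <= c i <= C) ->
  let q := sqnormC (map_mx (real_complex R)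
     (expmx (t *: (invmx P *m symbol_diag alpha c xi *m P))) *m z) in
  expR (- (2 * t * C * enorm xi `^ (2 * alpha))) * sqnormC z <= q <=
  expR (- (2 * t * c0 * enorm xi `^ (2 * alpha))) * sqnormC z.
Proof.
move=> t0 PP cC; set r := enorm xi `^ (2 * alpha).
have r0 : 0 <= r by exact: powR_ge0.
have Pu : P \in unitmx by case/mulmx1_unit: PP.
have invP : invmx P = P^T by rewrite -[LHS]mulmx1 -PP mulmxA mulVmx// mul1mx.
pose d : 'rV[R]_m := \row_l (- (t * c l * r)).
have -> : t *: (invmx P *m symbol_diag alpha c xi *m P) = P^T *m diag_mx d *m P.
  rewrite invP scalemxAl scalemxAr; congr (_ *m _ *m _).
  apply/matrixP => i j; rewrite !mxE -/r.
  by case: (eqVneq i j) => [_|_]; rewrite ?mulr1n ?mulr0n ?mulr0//; ring.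
rewrite expmx_conj_diag// sqnormC_real_mul sqnormCE /=.
have bnd l : expR (- (2 * t * C * r)) <= (map_mx expR d) ord0 l ^+ 2 <= expR (- (2 * t * c0 * r)).
  rewrite !mxE expr2 -expRD !ler_expR.
  rewrite (_ : - (t * c l * r) - t * c l * r = - (2 * t * c l * r)); last by ring.
  have [c1 c2] := andP (cC l).
  by rewrite !lerN2 !ler_wpM2r// ler_wpM2l// mulr_ge0.
have /andP[l1 h1] := sqnR_conj_diag_bounds (\col_k complex.Re (z k ord0)) PP bnd.
have /andP[l2 h2] := sqnR_conj_diag_bounds (\col_k complex.Im (z k ord0)) PP bnd.
by rewrite !mulrDr !lerD.
Qed.

End exponential_of_symbol.

(** * Mass near the origin and decay of the weighted integral *)

Section tauberian.
Context {R : realType}.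
Variables (H G : R -> R) (N gamma : R).
Hypotheses (gamma_gt0 : 0 < gamma) (H_ge0 : forall s, 0 < s -> 0 <= H s)
  (H_le : forall s, 0 < s -> H s <= N)
  (G_le_H : forall s tau, 0 < s -> 0 < tau -> G tau <= expR (s * tau) * H s)
  (H_le_G : forall s tau, 0 < s -> 0 < tau ->
    H s <= G tau + expR (- (s / 2 * tau)) * H (s / 2)).

Let powR_invM (s : R) : 0 < s -> s^-1 `^ gamma * s `^ gamma = 1.
Proof. by move=> s0; rewrite -powRM ?invr_ge0 ?(ltW s0)// mulVf ?gt_eqF// powR1. Qed.

Let powR_half (s : R) : 0 < s -> s `^ gamma = 2 `^ gamma * (s / 2) `^ gamma.
Proof. by move=> s0; rewrite -powRM// ?divr_ge0 ?(ltW s0)//; congr (_ `^ _); field. Qed.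

(* Splitting the integral defining [H s] at the radius [tau = L / s], with [L] so large that
   the outer part is at most half of [H (s / 2)] in the scale [s `^ (- gamma)]. *)
Lemma decay_of_small_ball (b : R) : (forall tau, 0 < tau -> G tau <= b * tau `^ gamma) ->
  exists B, forall s, 0 < s -> H s * s `^ gamma <= B.
Proof.
move=> Gb.
pose L : R := 2 * ((gamma + 1) * ln 2).
have ln20 : 0 < ln 2 :> R by rewrite ln_gt0// ltr1n.
have L0 : 0 < L by rewrite !mulr_gt0// addr_gt0.
have EL : expR (- (L / 2)) * 2 `^ gamma = 2^-1.
  rewrite /L /powR (gt_eqF (ltr0n R 2)) -expRD.
  rewrite (_ : _ + _ = - ln 2); last by field.
  by rewrite expRN lnK// posrE.
pose B := Num.max (2 * (b * L `^ gamma)) N.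
exists B => s s0.
have [n sn] : exists n, s <= 2 ^+ n.
  exists (Num.bound s); rewrite (le_trans (ltW (archi_boundP (ltW s0))))//.
  by rewrite -natrX ler_nat ltnW// ltn_expl.
elim: n s s0 sn => [|n IH] s s0 sn.
  rewrite (@le_trans _ _ (N * 1))//; last by rewrite mulr1 le_max lexx orbT.
  rewrite ler_pM ?powR_ge0 ?H_ge0 ?H_le//.
  rewrite expr0 in sn; rewrite [leRHS](_ : _ = 1 `^ gamma); last by rewrite powR1.
  rewrite ge0_ler_powR ?nnegrE ?(ltW s0)//.
  exact: ltW.
have s20 : 0 < s / 2 by rewrite divr_gt0.
have := IH (s / 2) s20.
rewrite ler_pdivrMr// -exprSr => /(_ sn) IHs.
have tau0 : 0 < L / s by rewrite divr_gt0.
rewrite (@le_trans _ _ ((b * (L / s) `^ gamma + expR (- (L / 2)) * H (s / 2)) * s `^ gamma))//.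
  rewrite ler_wpM2r ?powR_ge0// (le_trans (H_le_G s0 tau0))// lerD ?Gb//.
  rewrite (_ : s / 2 * (L / s) = L / 2)//; by field; rewrite gt_eqF.
rewrite mulrDl.
rewrite (_ : b * _ * _ = b * L `^ gamma); last first.
  by rewrite powRM ?invr_ge0 ?(ltW s0) ?(ltW L0)// -!mulrA powR_invM// mulr1.
rewrite (_ : expR _ * _ * _ = 2^-1 * (H (s / 2) * (s / 2) `^ gamma)); last first.
  by rewrite (powR_half s0) -[X in _ = X * _]EL; ring.
rewrite (_ : B = 2^-1 * B + 2^-1 * B); last by field.
rewrite lerD// ?ler_pM2l// ler_pdivlMl//.
by rewrite le_max lexx.
Qed.

(** The ball of size [tau = 1 / s] loses only a factor [expR 1]; it is small enough as soon as [s]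
    exceeds [1 / tau0]. *)
Lemma decay_lower_of_ball (a tau0 : R) : 0 < a -> 0 < tau0 ->
  (forall tau, 0 < tau -> tau < tau0 -> a * tau `^ gamma <= G tau) ->
  exists2 A, 0 < A & forall s, tau0^-1 < s -> A <= H s * s `^ gamma.
Proof.
move=> a0 t0 Ga; exists (a / expR 1); first by rewrite divr_gt0// expR_gt0.
move=> s s0t.
have s0 : 0 < s by rewrite (le_lt_trans _ s0t)// invr_ge0 ltW.
have si0 : 0 < s^-1 by rewrite invr_gt0.
have := G_le_H s0 si0; rewrite mulfV ?gt_eqF// => GH.
rewrite ler_pdivrMr ?expR_gt0// mulrAC [_ * expR 1]mulrC.
rewrite (@le_trans _ _ (a * s^-1 `^ gamma * s `^ gamma))//.
  by rewrite -mulrA powR_invM// mulr1.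
rewrite ler_wpM2r ?powR_ge0// (le_trans _ GH)// Ga//.
by rewrite -[tau0]invrK ltf_pV2 ?posrE// invr_gt0.
Qed.

Lemma ball_upper_of_decay (B : R) : (forall s, 0 < s -> H s * s `^ gamma <= B) ->
  forall tau, 0 < tau -> G tau <= expR 1 * B * tau `^ gamma.
Proof.
move=> HB tau t0.
have ti0 : 0 < tau^-1 by rewrite invr_gt0.
have := G_le_H ti0 t0; rewrite mulVf ?gt_eqF// => /le_trans; apply.
rewrite -mulrA ler_pM2l ?expR_gt0//.
rewrite -[leLHS]mulr1 -(powR_invM t0) mulrA ler_wpM2r ?powR_ge0// HB//.
Qed.

(** At time [s = L / tau] the lower bound [A] on the rescaled heat splits into a ball part and an
    outer part. The upper bound [B] at time [s / 2] makes the outer part at most [A / 2] for [L]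
    large, leaving at least [A / 2] to the ball. *)
Lemma ball_lower_of_decay (A B s0 : R) : 0 < A -> 0 < s0 ->
  (forall s, 0 < s -> H s * s `^ gamma <= B) ->
  (forall s, s0 < s -> A <= H s * s `^ gamma) ->
  exists a tau0, [/\ 0 < a, 0 < tau0 &
    forall tau, 0 < tau -> tau < tau0 -> a * tau `^ gamma <= G tau].
Proof.
move=> A0 s00 HB HA.
have B0 : 0 < B.
  by rewrite (lt_le_trans A0)// (le_trans (HA (s0 + 1) _)) ?ltrDl// HB// addr_gt0.
pose x : R := 2 * (B * 2 `^ gamma) / A.
(* Half of [L] exceeds [ln x], so [expR (- (L / 2))] is below [1 / x]; the absolute value keeps [L]
   positive when [x < 1]. *)
pose L := 2 * (`|ln x| + 1).
have x0 : 0 < x by rewrite divr_gt0// !mulr_gt0// powR_gt0.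
have L0 : 0 < L by rewrite mulr_gt0// ltr_pwDr.
have EL : expR (- (L / 2)) * (B * 2 `^ gamma) <= A / 2.
  rewrite (_ : B * 2 `^ gamma = x * (A / 2)); last by rewrite /x; field; rewrite gt_eqF.
  rewrite mulrA ger_pMl ?divr_gt0//.
  have xE : expR (ln x) = x by rewrite lnK// posrE.
  rewrite -[X in _ * X <= _]xE -expRD -[leRHS]expR0 ler_expR.
  rewrite (_ : L / 2 = `|ln x| + 1); last by rewrite /L; field.
  by have := ler_norm (ln x); lra.
exists (A / 2 / L `^ gamma), (L / s0); split.
- by rewrite !divr_gt0// powR_gt0.
- by rewrite divr_gt0.
move=> tau t0 tL.
have s_gt : s0 < L / tau by rewrite ltr_pdivlMr// mulrC -ltr_pdivlMr.
have s_gt0 : 0 < L / tau by rewrite divr_gt0.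
have h1 := HA _ s_gt.
have h2 := HB (L / tau / 2) (divr_gt0 s_gt0 (ltr0n _ 2)).
have h3 := H_le_G s_gt0 t0.
rewrite (_ : L / tau / 2 * tau = L / 2) in h3; last by field; rewrite gt_eqF.
rewrite mulrAC ler_pdivrMr ?powR_gt0//.
rewrite (_ : L `^ gamma = (L / tau) `^ gamma * tau `^ gamma); last first.
  by rewrite -powRM ?(ltW t0) ?(ltW s_gt0)// divfK// gt_eqF.
rewrite mulrA ler_pM2r ?powR_gt0//.
have : H (L / tau) * (L / tau) `^ gamma <=
    (G tau + expR (- (L / 2)) * H (L / tau / 2)) * (L / tau) `^ gamma.
  by rewrite ler_wpM2r ?powR_ge0.
rewrite mulrDl => h4.
have : expR (- (L / 2)) * H (L / tau / 2) * (L / tau) `^ gamma <= A / 2.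
  rewrite (le_trans _ EL)// (powR_half s_gt0) -mulrA ler_pM2l ?expR_gt0//.
  by rewrite mulrCA mulrC ler_wpM2r ?powR_ge0.
lra.
Qed.

End tauberian.

(** * The weighted integral and the mass of balls *)

Section heat_integral.
Context {R : realType} {n m : nat}.
Variables (alpha : R) (v : 'rV[R]_n -> 'cV[R[i]]_m).
Hypotheses (alpha_gt0 : 0 < alpha) (L2v : L2 v).

Definition weight (s : R) (xi : 'rV[R]_n) : R := expR (- (s * enorm xi `^ (2 * alpha))).

Definition heat (s : R) : R :=
  Rintegral (lebesgue_rV R n) setT (fun xi => weight s xi * sqnormC (v xi)).

Definition eball (rho : R) : set 'rV[R]_n := [set xi | enorm xi <= rho].

Definition ball_mass (rho : R) : R :=
  Rintegral (lebesgue_rV R n) (eball rho) (fun xi => sqnormC (v xi)).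

Lemma measurable_enorm : measurable_fun setT (@enorm R n).
Proof.
apply: (@measurableT_comp _ _ _ _ _ _ (@Num.sqrt R)).
  by apply: continuous_measurable_fun; exact: sqrt_continuous.
by apply: (@measurable_dotR _ _ _ n id id).
Qed.

Lemma measurable_eball rho : measurable (eball rho).
Proof.
have := @measurable_enorm measurableT `]-oo, rho]%classic (measurable_itv _).
by rewrite setTI; congr measurable; apply/seteqP; split => x /=; rewrite in_itv.
Qed.

Lemma measurable_weight s : measurable_fun setT (weight s).
Proof.
apply: measurableT_comp => //; apply: measurableT_comp => //.
apply: measurable_funM => //.
exact: (measurableT_comp (measurable_powR _) measurable_enorm).
Qed.

Lemma weight_ge0 s xi : 0 <= weight s xi.
Proof. exact: expR_ge0. Qed.

Lemma weight_le1 s xi : 0 <= s -> weight s xi <= 1.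
Proof. by move=> s0; rewrite -[leRHS]expR0 ler_expR oppr_le0 mulr_ge0// powR_ge0. Qed.

Let mh : measurable_fun setT (fun xi => sqnormC (v xi)).
Proof. exact: measurable_sqnormC L2v.1. Qed.

Let hi : (lebesgue_rV R n).-integrable setT (EFin \o (fun xi => sqnormC (v xi))).
Proof. by apply: ge0_integrable => //; [move=> x; exact: sqnormC_ge0|exact: L2v.2]. Qed.

Lemma integrable_heat s : 0 <= s ->
  (lebesgue_rV R n).-integrable setT (EFin \o (fun xi => weight s xi * sqnormC (v xi))).
Proof.
move=> s0; apply: (integrable_le _ _ hi).
  by apply: measurable_funM => //; exact: measurable_weight.
move=> xi; rewrite ger0_norm ?mulr_ge0 ?weight_ge0 ?sqnormC_ge0//.
by rewrite ler_piMl ?sqnormC_ge0// weight_le1.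
Qed.

Lemma heat_ge0 s : 0 <= heat s.
Proof. by apply: Rintegral_ge0 => x _; rewrite mulr_ge0 ?weight_ge0 ?sqnormC_ge0. Qed.

Lemma heat_anti s t : 0 <= s -> s <= t -> heat t <= heat s.
Proof.
move=> s0 st; apply: le_Rintegral => //.
- by apply: integrable_heat; exact: le_trans st.
- exact: integrable_heat.
- move=> x _; rewrite ler_wpM2r ?sqnormC_ge0// ler_expR lerN2 ler_wpM2r//.
  exact: powR_ge0.
Qed.

Lemma ball_massE rho :
  ball_mass rho = Rintegral (lebesgue_rV R n) setT (fun xi => sqnormC (v xi) * \1_(eball rho) xi).
Proof.
rewrite /ball_mass Rintegral_mkcond; apply: eq_Rintegral => xi _.
by rewrite patchE indicE; case: (xi \in _); rewrite ?mulr1 ?mulr0.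
Qed.

Let ball_int rho : (lebesgue_rV R n).-integrable setT
  (EFin \o (fun xi => sqnormC (v xi) * \1_(eball rho) xi)).
Proof.
apply: (integrable_bounded_mul hi (B := 1)).
  by apply: measurable_indic; exact: measurable_eball.
by move=> x; rewrite indicE; case: (x \in _); rewrite ?normr1 ?normr0.
Qed.

Lemma ball_mass_le rho :
  ball_mass rho <= Rintegral (lebesgue_rV R n) setT (fun xi => sqnormC (v xi)).
Proof.
rewrite ball_massE; apply: le_Rintegral => //.
by move=> xi _; rewrite indicE ler_piMr ?sqnormC_ge0//; case: (xi \in _).
Qed.

Lemma ball_mass_le_heat s tau : 0 < s -> 0 < tau ->
  ball_mass (tau `^ (2 * alpha)^-1) <= expR (s * tau) * heat s.
Proof.
move=> s0 t0; rewrite ball_massE -RintegralZl ?integrable_heat ?(ltW s0)//.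
apply: le_Rintegral => //.
  by apply: integrable_EFinZl; apply: integrable_heat; exact: ltW.
move=> xi _; rewrite indicE mulrA mulrC ler_wpM2r ?sqnormC_ge0// -expRD.
case: (boolP (xi \in _)) => [|_]; last by rewrite expR_ge0.
rewrite inE /eball /= => xit; rewrite [leLHS](_ : _ = expR 0); last by rewrite expR0.
rewrite ler_expR subr_ge0 ler_pM2l//.
rewrite (@le_trans _ _ ((tau `^ (2 * alpha)^-1) `^ (2 * alpha)))//.
  by rewrite ge0_ler_powR ?nnegrE ?powR_ge0 ?sqrtr_ge0// mulr_ge0// ltW.
by rewrite -powRrM mulVf ?gt_eqF ?mulr_gt0// powRr1// ltW.
Qed.

(** Outside the ball the exponent is shared equally: one half is at least [s / 2 * tau] and gives
    the exponential gain, the other is kept as the weight at time [s / 2]. *)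
Lemma heat_le_ball_mass s tau : 0 < s -> 0 < tau ->
  heat s <= ball_mass (tau `^ (2 * alpha)^-1) + expR (- (s / 2 * tau)) * heat (s / 2).
Proof.
move=> s0 t0; have s20 : 0 <= s / 2 by rewrite divr_ge0// ltW.
rewrite ball_massE -RintegralZl ?integrable_heat// -RintegralD//; last first.
  by apply: integrable_EFinZl; exact: integrable_heat.
apply: le_Rintegral => //.
- by apply: integrable_heat; exact: ltW.
- apply: integrable_EFinD; first exact: ball_int.
  by apply: integrable_EFinZl; exact: integrable_heat.
move=> xi _; rewrite indicE.
case: (boolP (xi \in _)) => [_|].
  rewrite mulr1 (@le_trans _ _ (sqnormC (v xi)))//.
    by rewrite ler_piMl ?sqnormC_ge0// weight_le1// ltW.
  by rewrite lerDl !mulr_ge0 ?expR_ge0 ?sqnormC_ge0.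
move=> xit; rewrite mulr0 add0r mulrA ler_wpM2r ?sqnormC_ge0// -expRD ler_expR.
rewrite -opprD lerN2 -mulrDr.
rewrite [leRHS](_ : _ = s / 2 * (enorm xi `^ (2 * alpha) + enorm xi `^ (2 * alpha))); last by field.
rewrite ler_wpM2l// lerD2r.
have {}xit : tau `^ (2 * alpha)^-1 < enorm xi.
  by rewrite ltNge; apply: contra xit => xit; rewrite inE.
rewrite (@le_trans _ _ ((tau `^ (2 * alpha)^-1) `^ (2 * alpha)))//.
  by rewrite -powRrM mulVf ?gt_eqF ?mulr_gt0// powRr1// ltW.
by rewrite ge0_ler_powR ?nnegrE ?powR_ge0 ?sqrtr_ge0 ?(ltW xit)// mulr_ge0// ltW.
Qed.

Lemma heat_le s : 0 < s -> heat s <= Rintegral (lebesgue_rV R n) setT (fun xi => sqnormC (v xi)).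
Proof.
move=> s0; apply: le_Rintegral => //; first by apply: integrable_heat; exact: ltW.
by move=> x _; rewrite ler_piMl ?sqnormC_ge0// weight_le1// ltW.
Qed.

Lemma integral_eball rho :
  (\int[lebesgue_rV R n]_(xi in eball rho) (sqnormC (v xi))%:E = (ball_mass rho)%:E)%E.
Proof.
rewrite /ball_mass /Rintegral fineK//; apply: integrable_fin_num => //.
  exact: measurable_eball.
apply: integrableS hi => //; exact: measurable_eball.
Qed.

End heat_integral.

(** * Decay indicators *)

Section limit_superior.
Context {R : realType} (F : set_system R).
Implicit Type f : R -> \bar R.

Lemma limf_esup_ltyP {FF : Filter F} f :
  (limf_esup f F < +oo)%E <-> exists b : R, \forall x \near F, (f x <= b%:E)%E.
Proof.
split=> [|[b fb]].
  move=> /ereal_inf_lt [_ [V FV <-]] Vy.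
  have [b Vb] : exists b : R, (ereal_sup (f @` V) <= b%:E)%E.
    by case: (ereal_sup _) Vy => [r _| |_]//; [exists r|exists 0; rewrite leNye].
  exists b; apply: filterS FV => x Vx; apply: le_trans Vb.
  by apply: ereal_sup_ubound; exists x.
apply: (@le_lt_trans _ _ b%:E); last by rewrite ltry.
rewrite limf_esupE; apply: (@le_trans _ _ (ereal_sup (f @` [set x | (f x <= b%:E)%E]))).
  by apply: ereal_inf_lbound; exists [set x | (f x <= b%:E)%E].
by apply: ge_ereal_sup => _ [x fx <-].
Qed.

Lemma limf_einf_gt0P {FF : Filter F} f :
  (0 < limf_einf f F)%E <-> exists2 a : R, 0 < a & \forall x \near F, (a%:E <= f x)%E.
Proof.
rewrite limf_einfE; split=> [|[a a0 fa]].
  move=> /ereal_sup_gt [_ [V FV <-]] Vy.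
  have [a a0 Va] : exists2 a : R, 0 < a & (a%:E <= ereal_inf (f @` V))%E.
    by case: (ereal_inf _) Vy => [r r0| _|]//; [exists r|exists 1; rewrite ?leey].
  exists a => //; apply: filterS FV => x Vx; apply: le_trans Va _.
  by apply: ereal_inf_lbound; exists x.
apply: (@lt_le_trans _ _ a%:E); first by rewrite lte_fin.
apply: (@le_trans _ _ (ereal_inf (f @` [set x | (a%:E <= f x)%E]))).
  by apply: le_ereal_inf_tmp => _ [x fx <-].
by apply: ereal_sup_ubound; exists [set x | (a%:E <= f x)%E].
Qed.

End limit_superior.

(** * Decay indicators as power bounds on the mass of small balls *)

Section decay_indicators.
Context {R : realType} {n m : nat}.
Variable v : 'rV[R]_n -> 'cV[R[i]]_m.
Hypothesis L2v : L2 v.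
Implicit Types r s : R.

Let near0P (P : R -> Prop) :
  (\forall rho \near 0^'+, P rho) <->
  exists2 rho0, 0 < rho0 & forall rho, 0 < rho -> rho < rho0 -> P rho.
Proof.
split=> [[e /= e0 H]|[e e0 H]].
  by exists e => // x x0 xe; apply: H => //=; rewrite sub0r normrN gtr0_norm.
exists e => // x /=; rewrite sub0r normrN => xe x0; apply: H => //.
by rewrite (le_lt_trans (ler_norm x)).
Qed.

Let decay_quotientE s rho :
  decay_quotient s v rho = (rho `^ (- (2 * s + n%:R)) * ball_mass v rho)%:E.
Proof.
rewrite /decay_quotient -/(eball rho) (integral_eball L2v) -EFinM.
by congr (_ `^ _ * _)%:E; ring.
Qed.

Lemma decay_sup_ltyP s : (decay_sup s v < +oo)%E <->
  exists b rho0, 0 < rho0 /\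
    forall rho, 0 < rho -> rho < rho0 -> ball_mass v rho <= b * rho `^ (2 * s + n%:R).
Proof.
rewrite limf_esup_ltyP; split => [[b /near0P[e e0 H]]|[b [e [e0 H]]]].
  exists b, e; split => // rho rho0 rhoe.
  have := H rho rho0 rhoe; rewrite decay_quotientE lee_fin powRN.
  by rewrite mulrC ler_pdivrMr ?powR_gt0.
exists b; apply/near0P; exists e => // rho rho0 rhoe.
by rewrite decay_quotientE lee_fin powRN mulrC ler_pdivrMr ?powR_gt0// H.
Qed.

Lemma decay_inf_gt0P s : (0 < decay_inf s v)%E <->
  exists a rho0, [/\ 0 < a, 0 < rho0 &
    forall rho, 0 < rho -> rho < rho0 -> a * rho `^ (2 * s + n%:R) <= ball_mass v rho].
Proof.
rewrite limf_einf_gt0P; split => [[a a0 /near0P[e e0 H]]|[a [e [a0 e0 H]]]].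
  exists a, e; split => // rho rho0 rhoe.
  have := H rho rho0 rhoe; rewrite decay_quotientE lee_fin powRN.
  by rewrite mulrC ler_pdivlMr ?powR_gt0.
exists a => //; apply/near0P; exists e => // rho rho0 rhoe.
by rewrite decay_quotientE lee_fin powRN mulrC ler_pdivlMr ?powR_gt0// H.
Qed.

Lemma powR_le_exponent (a b p q rho0 : R) : 0 < a -> 0 < rho0 ->
  (forall rho, 0 < rho -> rho < rho0 -> a * rho `^ p <= b * rho `^ q) -> q <= p.
Proof.
move=> a0 r0 H; rewrite leNgt; apply/negP => pq.
have qp0 : 0 < q - p by rewrite subr_gt0.
have b0 : 0 < `|b| + 1 by rewrite ltr_pwDr.
pose x := (a / (2 * (`|b| + 1))) `^ (q - p)^-1.
have x0 : 0 < x by rewrite powR_gt0// divr_gt0// mulr_gt0.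
pose rho := Num.min (rho0 / 2) x.
have rhop : 0 < rho by rewrite lt_min divr_gt0.
have rhole : rho < rho0.
  rewrite gt_min; apply/orP; left; lra.
have := H rho rhop rhole; apply/negP; rewrite -ltNge.
have -> : rho `^ q = rho `^ (q - p) * rho `^ p.
  by rewrite -powRD ?subrK ?(gt_eqF rhop) ?implybT.
rewrite mulrA ltr_pM2r ?powR_gt0//.
have h : rho `^ (q - p) <= a / (2 * (`|b| + 1)).
  rewrite (@le_trans _ _ (x `^ (q - p)))//.
    by rewrite ge0_ler_powR ?nnegrE ?(ltW rhop) ?(ltW x0) ?(ltW qp0)// ge_min lexx orbT.
  by rewrite /x -powRrM mulVf ?gt_eqF// powRr1// divr_ge0 ?(ltW a0)// mulr_ge0// ltW.
rewrite (@le_lt_trans _ _ ((`|b| + 1) * (a / (2 * (`|b| + 1)))))//.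
  rewrite (@le_trans _ _ ((`|b| + 1) * rho `^ (q - p)))//.
    by rewrite ler_wpM2r ?powR_ge0// (le_trans (ler_norm b))// lerDl.
  by rewrite ler_pM2l.
move: b0; move: (`|b| + 1) => c c0.
rewrite [ltLHS](_ : _ = a / 2); last by field; rewrite gt_eqF.
by rewrite ltr_pdivrMr// ltr_pMr// ltr1n.
Qed.

(** The two bounds show that [r] itself is admissible on both sides. Any other admissible exponent
    is compared with [r] by setting its one-sided bound against the opposite bound for [r]. *)
Lemma decay_character_of_ball r a b rho0 : 0 < a -> 0 < rho0 ->
  (forall rho, 0 < rho -> rho < rho0 ->
     a * rho `^ (2 * r + n%:R) <= ball_mass v rho <= b * rho `^ (2 * r + n%:R)) ->
  is_max [set s | (decay_sup s v < +oo)%E] r /\ is_min [set s | (0 < decay_inf s v)%E] r.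
Proof.
move=> a0 r0 H; split; split => /=.
- by apply/decay_sup_ltyP; exists b, rho0; split => // x x0 xr; case/andP: (H x x0 xr).
- move=> s /= /decay_sup_ltyP[b' [r1 [r10 H']]].
  have := @powR_le_exponent a b' (2 * r + n%:R) (2 * s + n%:R) (Num.min rho0 r1) a0.
  rewrite lt_min r0 r10 lerD2r ler_pM2l// => /(_ isT); apply => x x0.
  rewrite lt_min => /andP[xr xr1]; case/andP: (H x x0 xr) => h _.
  exact: le_trans h (H' x x0 xr1).
- by apply/decay_inf_gt0P; exists a, rho0; split => // x x0 xr; case/andP: (H x x0 xr).
- move=> s /= /decay_inf_gt0P[a' [r1 [a'0 r10 H']]].
  have := @powR_le_exponent a' b (2 * s + n%:R) (2 * r + n%:R) (Num.min rho0 r1) a'0.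
  rewrite lt_min r0 r10 lerD2r ler_pM2l// => /(_ isT); apply => x x0.
  rewrite lt_min => /andP[xr xr1]; case/andP: (H x x0 xr) => _ h.
  exact: le_trans (H' x x0 xr1) h.
Qed.

End decay_indicators.

(** * Decay of solutions *)

Section decay_of_solutions.
Context {R : realType} {n m : nat}.
Implicit Types (v : 'rV[R]_n -> 'cV[R[i]]_m) (M : 'rV[R]_n -> 'M[R]_m).

(** All that the two implications retain of the operator: pointwise bounds on the symbol, integrated
    almost everywhere and carried back to [u t] by the norm comparison, which supplies [k1] and
    [k2]. *)
Lemma solution_heat_bounds (alpha : R) M u0 (u : R -> 'rV[R]_n -> 'cV[R[i]]_m) :
  symbol_class alpha M -> is_solution M u0 u ->
  exists v0 k1 k2 c0 C, [/\ is_fourier u0 v0, (0 < k1) && (0 < k2), (0 < c0) && (0 < C) &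
    forall t, 0 < t ->
      ((k1 * heat alpha v0 (2 * t * C))%:E <= sqnormL2 (u t))%E /\
      (sqnormL2 (u t) <= (k2 * heat alpha v0 (2 * t * c0))%:E)%E].
Proof.
move=> [P [c [c0 [c00 cc0 _ _ PM]]]] [v0 [u0v0 sol]].
pose K : R := (2 * pi) ^+ n.
have K0 : 0 < K by rewrite exprn_gt0// mulr_gt0// pi_gt0.
(* A common upper bound of the [c i], all of which are positive; the summand [c0] keeps it positive
   for an empty sum too. *)
pose C := c0 + \sum_i c i.
have sumc0 : 0 <= \sum_i c i by apply: sumr_ge0 => i _; exact: le_trans (ltW c00) (cc0 i).
have C0 : 0 < C by rewrite ltr_pwDl.
have cC i : c0 <= c i <= C.
  rewrite cc0 /= /C (bigD1 i)//= addrCA lerDl addr_ge0 ?(ltW c00)// sumr_ge0// => j _.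
  exact: le_trans (ltW c00) (cc0 j).
have [_ L2v0 _] := u0v0.
exists v0, (4 * K)^-1, (4 / K), c0, C; split => //.
- by rewrite invr_gt0 divr_gt0// mulr_gt0.
- by rewrite c00.
move=> t t0; have [v [uv vE]] := sol t (ltW t0); have [_ L2v _] := uv.
have b : {ae lebesgue_rV R n, forall xi,
    weight alpha (2 * t * C) xi * sqnormC (v0 xi) <= sqnormC (v xi) <=
    weight alpha (2 * t * c0) xi * sqnormC (v0 xi)}.
  apply: filterS2 PM vE => xi [PP ->] ->.
  exact: expmx_symbol_bounds (ltW t0) PP cC.
have mv : measurable_fun setT (fun xi => (sqnormC (v xi))%:E).
  by apply/measurable_EFinP; exact: measurable_sqnormC L2v.1.
have mw s : measurable_fun setT (fun xi => (weight alpha s xi * sqnormC (v0 xi))%:E).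
  apply/measurable_EFinP; apply: measurable_funM; first exact: measurable_weight.
  exact: measurable_sqnormC L2v0.1.
have hE s : 0 < s -> (\int[lebesgue_rV R n]_xi (weight alpha s xi * sqnormC (v0 xi))%:E =
    (heat alpha v0 s)%:E)%E.
  by move=> s0; rewrite integral_EFin_Rintegral//; apply: integrable_heat => //; exact: ltW.
have lo : ((heat alpha v0 (2 * t * C))%:E <= sqnormL2 v)%E.
  rewrite -hE ?mulr_gt0//; apply: ae_ge0_le_integral => //.
  - by move=> xi _; rewrite lee_fin mulr_ge0 ?weight_ge0 ?sqnormC_ge0.
  - by move=> xi _; rewrite lee_fin sqnormC_ge0.
  - by apply: filterS b => xi /andP[h _] _; rewrite lee_fin.
have hi : (sqnormL2 v <= (heat alpha v0 (2 * t * c0))%:E)%E.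
  rewrite -hE ?mulr_gt0//; apply: ae_ge0_le_integral => //.
  - by move=> xi _; rewrite lee_fin sqnormC_ge0.
  - by move=> xi _; rewrite lee_fin mulr_ge0 ?weight_ge0 ?sqnormC_ge0.
  - by apply: filterS b => xi /andP[_ h] _; rewrite lee_fin.
split.
  rewrite EFinM -(@lee_pmul2l _ (4 * K)%:E)//; last by rewrite lte_fin mulr_gt0.
  rewrite muleA -!EFinM mulfV ?mul1r; last by rewrite gt_eqF// mulr_gt0.
  exact: le_trans lo (is_fourier_norm_le uv).
apply: le_trans (is_fourier_norm_ge uv) _.
by rewrite [leRHS]EFinM lee_pmul2l// lte_fin divr_gt0.
Qed.

Let ball_scale (alpha r tau : R) : 0 < alpha -> 0 < tau ->
  (tau `^ (2 * alpha)^-1) `^ (2 * r + n%:R) = tau `^ (alpha^-1 * (r + n%:R / 2)).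
Proof.
move=> a0 t0; rewrite -powRrM; congr (_ `^ _).
by field; rewrite gt_eqF.
Qed.

Let scale_ball (alpha r rho : R) : 0 < alpha -> 0 < rho ->
  (rho `^ (2 * alpha)) `^ (alpha^-1 * (r + n%:R / 2)) = rho `^ (2 * r + n%:R).
Proof.
move=> a0 t0; rewrite -powRrM; congr (_ `^ _).
by field; rewrite gt_eqF.
Qed.

Let radiusK (alpha rho : R) : 0 < alpha -> 0 < rho ->
  (rho `^ (2 * alpha)) `^ (2 * alpha)^-1 = rho.
Proof. by move=> a0 r0; rewrite -powRrM mulfV ?gt_eqF ?mulr_gt0// powRr1// ltW. Qed.

Lemma two_sided_decay_of_character (alpha r : R) M u0
    (u : R -> 'rV[R]_n -> 'cV[R[i]]_m) : 0 < alpha ->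
  symbol_class alpha M -> is_solution M u0 u -> has_decay_character u0 r ->
  exists C1 C2 : R, [/\ 0 < C1, 0 < C2 & two_sided_decay alpha r C1 C2 u].
Proof.
move=> a0 symbM sol [rn [v [u0v [rsup _] [rinf _]]]].
have [v0 [k1 [k2 [c0 [C [u0v0 /andP[k10 k20] /andP[c00 C0] ub]]]]]] :=
  solution_heat_bounds symbM sol.
have [_ L2v _] := u0v; have [_ L2v0 _] := u0v0.
have vv0 rho : ball_mass v rho = ball_mass v0 rho.
  apply: EFin_inj; rewrite -!integral_eball//.
  apply: eq_integral_sqnormC; [exact: measurable_eball|exact: L2v.1|exact: L2v0.1|].
  exact: is_fourier_unique u0v u0v0.
move: rsup rinf => /(decay_sup_ltyP L2v)[b [e [e0 Hb]]] /(decay_inf_gt0P L2v)[a [e' [a'0 e'0 Ha]]].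
set g := alpha^-1 * (r + n%:R / 2).
have g0 : 0 < g by rewrite mulr_gt0 ?invr_gt0// -ltrBlDr sub0r.
pose H := heat alpha v0; pose G tau := ball_mass v0 (tau `^ (2 * alpha)^-1).
pose N := Rintegral (lebesgue_rV R n) setT (fun xi => sqnormC (v0 xi)).
have HN s : 0 < s -> H s <= N by exact: heat_le.
have H0 s : 0 < s -> 0 <= H s by move=> _; exact: heat_ge0.
have GH s tau : 0 < s -> 0 < tau -> G tau <= expR (s * tau) * H s by exact: ball_mass_le_heat.
have HG s tau : 0 < s -> 0 < tau -> H s <= G tau + expR (- (s / 2 * tau)) * H (s / 2).
  exact: heat_le_ball_mass.
have N0 : 0 <= N := le_trans (H0 1 ltr01) (HN 1 ltr01).
have small e1 tau : 0 < e1 -> 0 < tau -> tau < e1 `^ (2 * alpha) ->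
    tau `^ (2 * alpha)^-1 < e1.
  move=> e10 t0 te; rewrite -[ltRHS](radiusK a0 e10).
  by rewrite gt0_ltr_powR ?nnegrE ?powR_ge0 ?(ltW t0)// invr_gt0 mulr_gt0.
(* The indicator controls small balls only; beyond the threshold the mass is at most the total [N],
   which the second constant absorbs. *)
have Gb tau : 0 < tau -> G tau <= (`|b| + N / (e `^ (2 * alpha)) `^ g) * tau `^ g.
  move=> t0; rewrite mulrDl; have [te|te] := ltP tau (e `^ (2 * alpha)).
    rewrite (@le_trans _ _ (b * tau `^ g))//.
      rewrite /G -(ball_scale r a0 t0) -vv0; apply: Hb; first exact: powR_gt0.
      exact: small.
    rewrite (@le_trans _ _ (`|b| * tau `^ g))//.
      by rewrite ler_wpM2r ?powR_ge0// ler_norm.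
    by rewrite lerDl mulr_ge0 ?powR_ge0// divr_ge0// powR_ge0.
  rewrite (@le_trans _ _ (N / (e `^ (2 * alpha)) `^ g * tau `^ g))//; last first.
    by rewrite lerDr mulr_ge0// powR_ge0.
  have et0 : 0 < e `^ (2 * alpha) by exact: powR_gt0.
  rewrite (@le_trans _ _ N)//.
    exact: ball_mass_le.
  rewrite mulrAC ler_pdivlMr ?powR_gt0// ler_wpM2l//.
  by rewrite ge0_ler_powR ?nnegrE ?(ltW g0) ?(ltW t0) ?(ltW et0).
have [B HB] := decay_of_small_ball g0 H0 HN HG Gb.
have Ga tau : 0 < tau -> tau < e' `^ (2 * alpha) -> a * tau `^ g <= G tau.
  move=> t0 te; rewrite /G -(ball_scale r a0 t0) -vv0; apply: Ha; first exact: powR_gt0.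
  exact: small.
have e2 : 0 < e' `^ (2 * alpha) by exact: powR_gt0.
have [A A0 HA] := decay_lower_of_ball GH a'0 e2 Ga.
(* Time [S * (1 + t)] dominates [2 * t * C] and always exceeds the threshold of [HA]. As [heat] is
   nonincreasing, the lower bound thus holds for all [t], small ones included. *)
pose S := 2 * C + (e' `^ (2 * alpha))^-1.
have S0 : 0 < S by rewrite addr_gt0 ?mulr_gt0// invr_gt0.
have B0 : 0 <= B by rewrite (le_trans _ (HB 1 ltr01))// mulr_ge0 ?powR_ge0// H0.
(* In the second constant the first term serves [t >= 1], where [1 + t <= 2 * t]; the next serves
   [t < 1], where [heat] is at most [N] and [1 + t] at most 2; the final 1 makes it positive. *)
exists (k1 * (A / S `^ g)), (k2 * (B / c0 `^ g + N * 2 `^ g + 1)); split.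
- by rewrite mulr_gt0// divr_gt0// powR_gt0.
- by rewrite mulr_gt0// ltr_wpDl// addr_ge0// ?divr_ge0 ?mulr_ge0 ?powR_ge0.
move=> t t0; have [lo hi] := ub t t0; have t10 : 0 < 1 + t by rewrite addr_gt0.
have p0 := powR_gt0 g t10.
split.
  apply: le_trans lo; rewrite -/g lee_fin -(mulrA k1) ler_pM2l//.
  have St0 : 0 < S * (1 + t) by rewrite mulr_gt0.
  rewrite (@le_trans _ _ (H (S * (1 + t))))//; last first.
    apply: heat_anti => //; first by rewrite !mulr_ge0// ltW.
    rewrite (mulrC 2) -mulrA mulrC ler_pM ?mulr_ge0 ?(ltW C0) ?(ltW t0)//.
      by rewrite lerDl invr_ge0 ltW.
    by rewrite lerDr.
  have /HA : (e' `^ (2 * alpha))^-1 < S * (1 + t).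
    rewrite (@lt_le_trans _ _ S)//; first by rewrite ltrDr mulr_gt0.
    by rewrite ler_peMr ?(ltW S0)// lerDl ltW.
  rewrite powRM ?(ltW S0) ?(ltW t10)// => hA.
  by rewrite powRN -mulrA -invfM ler_pdivrMr// mulr_gt0// powR_gt0.
apply: (le_trans hi); rewrite -/g lee_fin -(mulrA k2) ler_pM2l//.
rewrite powRN ler_pdivlMr//.
have [t1|t1] := leP 1 t.
  rewrite (@le_trans _ _ (B / c0 `^ g))//; last first.
    by rewrite -addrA lerDl addr_ge0 ?mulr_ge0 ?powR_ge0.
  rewrite ler_pdivlMr ?powR_gt0// -mulrA -powRM ?(ltW c00) ?(ltW t10)//.
  have s0 : 0 < 2 * t * c0 by rewrite !mulr_gt0.
  rewrite (le_trans _ (HB _ s0))// ler_wpM2l ?H0//.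
  rewrite ge0_ler_powR ?nnegrE ?(ltW g0) ?(ltW s0)//;
    first by rewrite mulr_ge0 ?(ltW t10) ?(ltW c00).
  by rewrite ler_pM2r// mulr_natl mulr2n lerD2r.
rewrite (@le_trans _ _ (N * 2 `^ g))//; last first.
  by rewrite addrAC lerDr addr_ge0// divr_ge0 ?powR_ge0.
rewrite ler_pM ?H0 ?powR_ge0 ?HN ?mulr_gt0//.
by rewrite ge0_ler_powR ?nnegrE ?(ltW g0) ?(ltW t10)// -[2]/(1 + 1) lerD2l ltW.
Qed.

Lemma character_of_two_sided_decay (alpha r C1 C2 : R) M u0
    (u : R -> 'rV[R]_n -> 'cV[R[i]]_m) : 0 < alpha ->
  symbol_class alpha M -> is_solution M u0 u -> - (n%:R / 2) < r -> 0 < C1 -> 0 < C2 ->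
  two_sided_decay alpha r C1 C2 u -> has_decay_character u0 r.
Proof.
move=> a0 symbM sol rn C10 C20 dec.
have [v0 [k1 [k2 [c0 [C [u0v0 /andP[k10 k20] /andP[c00 C0] ub]]]]]] :=
  solution_heat_bounds symbM sol.
split => //; exists v0; have [_ L2v0 _] := u0v0.
set g := alpha^-1 * (r + n%:R / 2).
have g0 : 0 < g by rewrite mulr_gt0 ?invr_gt0// -ltrBlDr sub0r.
pose H := heat alpha v0; pose G tau := ball_mass v0 (tau `^ (2 * alpha)^-1).
have H0 s : 0 < s -> 0 <= H s by move=> _; exact: heat_ge0.
have GH s tau : 0 < s -> 0 < tau -> G tau <= expR (s * tau) * H s by exact: ball_mass_le_heat.
have HG s tau : 0 < s -> 0 < tau -> H s <= G tau + expR (- (s / 2 * tau)) * H (s / 2).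
  exact: heat_le_ball_mass.
(* The time [t = s / (2 * C)] turns the lower comparison of [u t] into a bound on [H s], and [s] is
   at most [2 * C * (1 + t)]. *)
have HB s : 0 < s -> H s * s `^ g <= C2 / k1 * (2 * C) `^ g.
  move=> s0; pose t := s / (2 * C).
  have t0 : 0 < t by rewrite divr_gt0// mulr_gt0.
  have sE : 2 * t * C = s by rewrite /t; field; rewrite gt_eqF.
  have t10 : 0 < 1 + t by rewrite addr_gt0.
  have := le_trans (ub t t0).1 (dec t t0).2; rewrite lee_fin sE -/H -/g => h.
  have {}h : H s <= C2 / k1 * (1 + t) `^ (- g).
    by rewrite mulrAC ler_pdivlMr// mulrC.
  rewrite (@le_trans _ _ (C2 / k1 * (1 + t) `^ (- g) * s `^ g))//.
    by rewrite ler_wpM2r ?powR_ge0.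
  rewrite -mulrA ler_pM2l ?divr_gt0// powRN mulrC ler_pdivrMr ?powR_gt0//.
  rewrite -powRM ?(ltW t10) ?mulr_ge0 ?(ltW C0)//.
  rewrite ge0_ler_powR ?nnegrE ?(ltW g0) ?(ltW s0) ?mulr_ge0 ?(ltW t10) ?(ltW C0)//.
  by rewrite -{1}sE mulrAC ler_pM2l ?mulr_gt0// lerDr.
(* Here [t = s / (2 * c0)], and [s > 1] is what gives [1 + t <= s * (1 + 1 / (2 * c0))]; a lower
   bound for large [s] is enough, as only small balls matter. *)
have HA s : 1 < s -> C1 / k2 / (1 + (2 * c0)^-1) `^ g <= H s * s `^ g.
  move=> s1; have s0 : 0 < s by exact: lt_trans s1.
  pose t := s / (2 * c0).
  have t0 : 0 < t by rewrite divr_gt0// mulr_gt0.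
  have sE : 2 * t * c0 = s by rewrite /t; field; rewrite gt_eqF.
  have t10 : 0 < 1 + t by rewrite addr_gt0.
  have := le_trans (dec t t0).1 (ub t t0).2; rewrite lee_fin sE -/H -/g => h.
  have D0 : 0 < 1 + (2 * c0)^-1 by rewrite addr_gt0// invr_gt0 mulr_gt0.
  rewrite ler_pdivrMr ?powR_gt0// ler_pdivrMr//.
  move: h; rewrite powRN ler_pdivrMr ?powR_gt0// => /le_trans; apply.
  rewrite -!mulrA [leRHS](_ : _ = k2 * (H s * (s `^ g * (1 + (2 * c0)^-1) `^ g))); last by ring.
  rewrite ler_pM2l// ler_wpM2l ?H0// -powRM ?(ltW s0) ?(ltW D0)//.
  rewrite ge0_ler_powR ?nnegrE ?(ltW g0) ?(ltW t10) ?mulr_ge0 ?(ltW s0) ?(ltW D0)//.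
  by rewrite mulrDr mulr1 lerD2r ltW.
have A0 : 0 < C1 / k2 / (1 + (2 * c0)^-1) `^ g.
  by rewrite divr_gt0 ?divr_gt0// powR_gt0// addr_gt0// invr_gt0 mulr_gt0.
have [a [tau0 [a'0 tau00 Ga]]] := ball_lower_of_decay HG A0 ltr01 HB HA.
have Gb := ball_upper_of_decay GH HB.
have [] := @decay_character_of_ball R n m v0 L2v0 r a (expR 1 * (C2 / k1 * (2 * C) `^ g))
  (tau0 `^ (2 * alpha)^-1) a'0 (powR_gt0 _ tau00).
  move=> rho rho0 rhot.
  have t0 : 0 < rho `^ (2 * alpha) by exact: powR_gt0.
  have tt0 : rho `^ (2 * alpha) < tau0.
    rewrite (_ : tau0 = (tau0 `^ (2 * alpha)^-1) `^ (2 * alpha)); last first.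
      by rewrite -powRrM mulVf ?gt_eqF ?mulr_gt0// powRr1// ltW.
    by rewrite gt0_ltr_powR ?nnegrE ?powR_ge0 ?(ltW rho0)// mulr_gt0.
  have := Ga _ t0 tt0; have := Gb _ t0.
  by rewrite /G radiusK// scale_ball// => -> ->.
by [].
Qed.

End decay_of_solutions.

Unset Implicit Arguments.
Set Strict Implicit.
Set Printing Implicit Defensive.

Theorem theorem2p9 (R : realType) (n m : nat) (alpha : R)
    (M : 'rV[R]_n -> 'M[R]_m)
    (u0 : 'rV[R]_n -> 'cV[R[i]]_m) (u : R -> 'rV[R]_n -> 'cV[R[i]]_m)
    (n_gt0 : (0 < n)%N) (m_gt0 : (0 < m)%N) (alpha_gt0 : 0 < alpha)
    (symbM : symbol_class alpha M)
    (L2u0 : L2 u0) (solu : is_solution M u0 u) :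
  (forall r : R, has_decay_character u0 r ->
     exists C1 C2 : R, [/\ 0 < C1, 0 < C2 & two_sided_decay alpha r C1 C2 u]) /\
  (forall r C1 C2 : R, - (n%:R / 2) < r -> 0 < C1 -> 0 < C2 ->
     two_sided_decay alpha r C1 C2 u -> has_decay_character u0 r).
Proof.
split=> [r|r C1 C2].
- exact: two_sided_decay_of_character alpha_gt0 symbM solu.
- exact: character_of_two_sided_decay alpha_gt0 symbM solu.
Qed.
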